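(* Let $p\in(0,\infty)$. For every symmetric convex body $K\subset\mathbb{R}^2$, $$\mathcal{M}_p([-1,1]^2)\ \leq\ \mathcal{M}_p(K).$$
   Context: A convex body in $\mathbb{R}^n$ is a compact convex set with nonempty interior; $K$ is symmetric if $K=-K$; $|K|$ is Lebesgue measure. For $p\in(0,\infty)$ the $L^p$-support function of $K$ is $h_{p,K}(y)=\frac1p\log\left(\int_K e^{p\langle x,y\rangle}\frac{dx}{|K|}\right)$, $y\in\mathbb{R}^n$, and the $L^p$-Mahler volume is $\mathcal{M}_p(K)=|K|\int_{\mathbb{R}^n}e^{-h_{p,K}(y)}\,dy\in(0,\infty]$. *)

(* Defs.v *)
From HB Require Import structures.
From mathcomp Require Import all_boot all_order all_algebra.
From mathcomp Require Import all_classical all_reals all_analysis.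

Set Implicit Arguments.
Unset Strict Implicit.
Unset Printing Implicit Defensive.

Import Order.TTheory GRing.Theory Num.Theory.
Import numFieldNormedType.Exports.

Local Open Scope classical_set_scope.
Local Open Scope ring_scope.

Section planar_Lp_Mahler.
Context {R : realType}.

Definition lebesgue_measure2 :
    {measure set (measurableTypeR R * measurableTypeR R) -> \bar R} :=
  (@lebesgue_measure R \x @lebesgue_measure R)%E.

Definition dotp (x y : R * R) : R := x.1 * y.1 + x.2 * y.2.

(* [R^o * R^o] is [R * R] with its left-module structure over [R], which
   [convex_set] needs; topological notions are those of the product [R * R]. *)
Definition convex_body (K : set (R * R)) : Prop :=
  [/\ compact K,
      convex_set (K : set (R^o * R^o)) &
      interior K !=set0].

Definition symmetric_set (K : set (R * R)) : Prop := K = -%R @` K.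

(* For a convex body [K], |K| is a positive real and the exponential is bounded
   on [K], so [fine] and the real-valued integral lose no information. *)
Definition Lp_support (p : R) (K : set (R * R)) (y : R * R) : R :=
  p^-1 * ln (\int[lebesgue_measure2]_(x in K)
               (expR (p * dotp x y) / fine (lebesgue_measure2 K))).

(* Extended-real valued: the outer integral may be infinite. *)
Definition Lp_Mahler (p : R) (K : set (R * R)) : \bar R :=
  (lebesgue_measure2 K *
   \int[lebesgue_measure2]_y (expR (- Lp_support p K y))%:E)%E.

Definition square : set (R * R) := `[-1, 1] `*` `[-1, 1].

End planar_Lp_Mahler.

(* Main.v *)
Require Import Defs.
From mathcomp Require Import all_boot all_order all_algebra.
From mathcomp Require Import all_classical all_reals all_analysis.
From mathcomp Require Import measurable_realfun ring lra.

(** Why the inequality holds.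

    Write A_K(y) for the integral of exp(p <x, y>) over K, so that the Mahler
    volume of K is |K| times the integral over y of (A_K(y) / |K|)^(-1/p).
    The square is reached from K through symmetric polygons, by moves that
    never increase this quantity.

    A symmetric polygon is given by the edges ds met along half a turn, any two
    of which form a positive determinant (ccw); pmahler p ds is its Mahler
    volume.  Slide the vertex w1 shared by two consecutive edges, together with
    the opposite vertex, parallel to the chord v that joins its neighbours w0
    and w2.  The area stays constant, and up to terms that do not depend on the
    position t of the vertex, A(y) is a constant times
    evexp (p <w0, y>) (p <w1 + t v, y>) (p <w2, y>), where evexp is a
    log-convex and even function of three variables.  In coordinates of y of
    which one is c = p <v, y>, the Mahler volume becomes the integral over
    (x, c) of exp(- L(x, t c, c)) with L convex and even.  Such an integral is
    a quasi-concave function of t (busemann_quasi); this is the functional form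
    of Busemann's theorem on sections of convex bodies: integrating out x
    leaves a log-concave function of (t c, c) by the Prekopa-Leindler
    inequality, the substitution z = 1 / c turns the lines with slope t in the
    (c, t c) plane into vertical lines, and the Brunn-Minkowski inequality on
    the level sets in z concludes.

    By quasi-concavity, the vertex can be slid in one of the two directions,
    without increasing the Mahler volume, until one of its two edges becomes
    parallel to the next edge of the polygon; these merge, and the polygon has
    two vertices fewer (slide_plus, slide_minus).  After finitely many steps it
    is a parallelogram, and all parallelograms have the same Mahler volume as
    the square, by linear invariance (pmahler_min).

    A symmetric convex body K is finally squeezed between a polygon P and k P
    for k > 1 arbitrarily close to 1 (inner_polygon).  To obtain P with
    pairwise non-parallel edges, the gauge of K is first made strictly convex by
    adding a small multiple of the Euclidean norm, and P has its vertices close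
    to each other on the unit curve of this new norm (norm_polygon).  Then |P|
    is at most |K| and A_K is at most A_(k P), so that the Mahler volume of K is
    at least a power of 1 / k times that of k P, and k tends to 1
    (Lp_Mahler_ge). *)

Set Implicit Arguments.
Unset Strict Implicit.
Unset Printing Implicit Defensive.
Import Order.TTheory GRing.Theory Num.Theory.
Import numFieldNormedType.Exports.
Local Open Scope classical_set_scope.
Local Open Scope ring_scope.

(** * Integration in the plane *)

Section measure_prelims.
Context {R : realType}.
Local Notation mR := (measurableTypeR R).
Local Notation mu := (@lebesgue_measure R).
Local Notation mu2 := (@lebesgue_measure2 R).

Lemma measurable_affine (a b : R) :
  measurable_fun [set: mR] (fun x : mR => a * x + b : mR).
Proof.
by apply: measurable_funD => //; apply: measurable_funM.
Qed.

(** Lebesgue measure is the only measure with the right values on intervals, so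
    it equals its own image under an affine map, rescaled. *)
Lemma ge0_integral_affine (f : mR -> \bar R) (a b : R) :
  measurable_fun [set: mR] f -> (forall x, (0 <= f x)%E) -> a != 0 ->
  (\int[mu]_x f x = `|a|%:E * \int[mu]_x f (a * x + b)%R)%E.
Proof.
move=> mf f0 a0.
pose phi := (fun x => a * x + b) : mR -> mR.
have mphi : measurable_fun [set: mR] phi := measurable_affine a b.
pose pm : {measure set mR -> \bar R} :=
  measure_function_pushforward__canonical__measure_function_Measure mu mphi.
pose nu : {measure set mR -> \bar R} := mscale (NngNum (normr_ge0 a)) pm.
have E A : measurable A -> mu A = nu A.
  apply: lebesgue_measure_unique => _ [[x y]] _ <-.
  change (mu `]x,y] = `|a|%:E * mu (phi @^-1` `]x,y]))%E.
  rewrite !lebesgue_measure_itv/= !lte_fin.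
  have [a1|a1] := ltP 0 a.
    rewrite (_ : phi @^-1` _ = `](x - b) / a, (y - b) / a]%classic); last first.
      apply/seteqP; split => z /=; rewrite /phi !in_itv/= ltr_pdivrMr// ler_pdivlMr//; lra.
    rewrite lebesgue_measure_itv/= !lte_fin gtr0_norm// -!EFinD.
    rewrite ltr_pM2r ?invr_gt0// ltrD2r; case: ifPn => _; last by rewrite mule0.
    by rewrite -EFinM; congr EFin; field.
  have {}a1 : a < 0 by rewrite lt_neqAle a0.
  rewrite (_ : phi @^-1` _ = `[(y - b) / a, (x - b) / a[%classic); last first.
    apply/seteqP; split => z /=; rewrite /phi !in_itv/= ltr_ndivlMr// ler_ndivrMr//; lra.
  rewrite lebesgue_measure_itv/= !lte_fin ltr0_norm// -!EFinD.
  rewrite ltr_nM2r ?invr_lt0// ltrD2r; case: ifPn => _; last by rewrite mule0.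
  by rewrite -EFinM; congr EFin; field.
transitivity (\int[nu]_x f x)%E.
  by apply: eq_measure_integral => A mA _; exact: (E A mA).
rewrite ge0_integral_mscale//; congr (_ * _)%E.
by rewrite ge0_integral_pushforward.
Qed.

Lemma ge0_integral_affine' (f : mR -> \bar R) (a b : R) :
  measurable_fun [set: mR] f -> (forall x, (0 <= f x)%E) -> a != 0 ->
  (\int[mu]_x f (a * x + b)%R = `|a|^-1%:E * \int[mu]_x f x)%E.
Proof.
move=> mf f0 a0; rewrite (ge0_integral_affine b mf f0 a0) muleA -EFinM.
by rewrite mulVf ?mul1e// normr_eq0.
Qed.

Lemma integral2E (f : mR * mR -> \bar R) :
  measurable_fun setT f -> (forall x, (0 <= f x)%E) ->
  (\int[mu2]_x f x = \int[mu]_x \int[mu]_y f (x, y))%E.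
Proof. by move=> mf f0; rewrite fubini_tonelli1. Qed.

Lemma integral2_swap (f : mR * mR -> \bar R) :
  measurable_fun setT f -> (forall x, (0 <= f x)%E) ->
  (\int[mu2]_x f x = \int[mu]_y \int[mu]_x f (x, y))%E.
Proof. by move=> mf f0; rewrite fubini_tonelli2. Qed.

Lemma measurable_int_fst (F : mR * mR -> \bar R) : measurable_fun setT F ->
  (forall z, (0 <= F z)%E) -> measurable_fun [set: mR] (fun y => \int[mu]_x F (x, y))%E.
Proof. by move=> mF F0; exact: (measurable_fun_fubini_tonelli_G F). Qed.

Lemma measurable_int_snd (F : mR * mR -> \bar R) : measurable_fun setT F ->
  (forall z, (0 <= F z)%E) -> measurable_fun [set: mR] (fun x => \int[mu]_y F (x, y))%E.
Proof. by move=> mF F0; exact: (measurable_fun_fubini_tonelli_F F). Qed.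

Definition lcomb (u v s : R * R) : R * R := (s.1 * u.1 + s.2 * v.1, s.1 * u.2 + s.2 * v.2).
Definition det (u v : R * R) : R := u.1 * v.2 - u.2 * v.1.

Lemma measurable_lcomb u v : measurable_fun setT (lcomb u v : mR * mR -> mR * mR).
Proof.
by apply: measurable_fun_pair; apply: measurable_funD => //; apply: measurable_funM.
Qed.

(** The linear change of variables is a composition of two shears, one in each
    variable, each of which is an affine substitution on the line; dividing by
    u.1 makes the first one invertible. *)
Lemma ge0_integral_lcomb0 (f : mR * mR -> \bar R) u v :
  measurable_fun setT f -> (forall x, (0 <= f x)%E) -> u.1 != 0 -> det u v != 0 ->
  (\int[mu2]_x f x = `|det u v|%:E * \int[mu2]_s f (lcomb u v s))%E.
Proof.
move=> mf f0 u0 d0.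
rewrite (integral2_swap (measurableT_comp mf (measurable_lcomb u v)) (fun=> f0 _)).
pose F (z : mR * mR) := f (z.1, z.1 * (u.2 / u.1) + z.2 * (det u v / u.1))%R.
have mF : measurable_fun [set: mR * mR] F.
  apply: measurableT_comp => //; apply: measurable_fun_pair => //.
  by apply: measurable_funD; apply: measurable_funM.
transitivity (`|det u v|%:E * \int[mu]_t (`|u.1|^-1%:E * \int[mu]_x F (x, t)))%E;
  last first.
  congr (_ * _)%E; apply: eq_integral => t _.
  rewrite -(ge0_integral_affine' (f := fun x => F (x, t)) (t * v.1)) => [|||//].
  - apply: eq_integral => s _; congr (f (_, _)); rewrite /=; first ring.
    by rewrite /det; field.
  - exact: measurableT_comp.
  - by move=> x; exact: f0.
rewrite ge0_integralZl//; last 2 first.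
- exact: (measurable_int_fst mF (fun=> f0 _)).
- by move=> t _; apply: integral_ge0 => ? _; exact: f0.
rewrite muleA -EFinM -(integral2_swap mF (fun=> f0 _)) (integral2E mf f0).
rewrite (integral2E mF (fun=> f0 _)) -ge0_integralZl//; last 2 first.
- exact: (measurable_int_snd mF (fun=> f0 _)).
- by move=> t _; apply: integral_ge0 => ? _; exact: f0.
apply: eq_integral => x _.
have e0 : det u v / u.1 != 0 by rewrite mulf_neq0 ?invr_neq0.
rewrite (ge0_integral_affine (x * (u.2 / u.1)) _ _ e0)//; last first.
  exact: measurableT_comp.
rewrite normrM normfV; congr (_ * _)%E; apply: eq_integral => t _.
by congr (f (_, _)); rewrite /=; ring.
Qed.

Lemma integral2_transpose (f : mR * mR -> \bar R) :
  measurable_fun setT f -> (forall x, (0 <= f x)%E) ->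
  (\int[mu2]_x f x = \int[mu2]_x f (x.2, x.1))%E.
Proof.
move=> mf f0; rewrite integral2E// integral2_swap//.
by apply: measurableT_comp => //; exact: measurable_fun_pair.
Qed.

Lemma ge0_integral_lcomb (f : mR * mR -> \bar R) u v :
  measurable_fun setT f -> (forall x, (0 <= f x)%E) -> det u v != 0 ->
  (\int[mu2]_x f x = `|det u v|%:E * \int[mu2]_s f (lcomb u v s))%E.
Proof.
move=> mf f0 d0; have [u0|u0] := eqVneq u.1 0; last exact: ge0_integral_lcomb0.
have v0 : v.1 != 0.
  by apply: contraNneq d0; rewrite /det u0 => ->; rewrite mulr0 mul0r subrr.
have vu : det v u != 0 by rewrite /det -opprB oppr_eq0 mulrC [v.1 * _]mulrC.
rewrite (ge0_integral_lcomb0 mf f0 v0 vu); congr (_ * _)%E.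
  by congr EFin; rewrite /det -normrN opprB; congr `|_|; ring.
rewrite integral2_transpose//.
  by apply: eq_integral => s _; congr f; rewrite /lcomb/= addrC (addrC (s.2 * _)).
exact: measurableT_comp (measurable_lcomb v u).
Qed.

Lemma ge0_integral2_opp (f : mR * mR -> \bar R) :
  measurable_fun setT f -> (forall x, (0 <= f x)%E) ->
  (\int[mu2]_x f (- x)%R = \int[mu2]_x f x)%E.
Proof.
move=> mf f0; rewrite (@ge0_integral_lcomb f (-1, 0) (0, -1))//; last first.
  by rewrite /det/= mulr0 subr0 mulrNN mulr1 oner_eq0.
rewrite /det/= mulr0 subr0 mulrNN mulr1 normr1 mul1e; apply: eq_integral => x _.
case: x => x1 x2; congr f; rewrite /lcomb/= !mulr0 addr0 add0r !mulrN1//.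
Qed.

Lemma FTC2 (f F : R -> R) (a b : R) : a < b -> continuous f ->
  (forall x : R, is_derive x (1 : R) F (f x)) ->
  (\int[mu]_(x in `[a, b]) (f x)%:E = (F b - F a)%:E)%E.
Proof.
move=> ab cf dF.
have cF : continuous F.
  move=> x; apply: differentiable_continuous; apply/derivable1_diffP.
  by apply: ex_derive.
rewrite (@continuous_FTC2 _ f F) //.
- exact: continuous_subspaceT.
- split.
  + by move=> t _; apply: ex_derive.
  + by apply: cvg_at_right_filter; exact: cF.
  + by apply: cvg_at_left_filter; exact: cF.
- by move=> t _; rewrite derive1E; apply: derive_val.
Qed.

Lemma integral_id_segment (x : R) : 0 < x ->
  (\int[mu]_(t in `]0%R, x[) (2 * t)%:E = (x ^+ 2)%:E)%E.
Proof.
move=> x0.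
rewrite -(@integral_itv_bndoo _ _ _ (fun t => (2 * t)%:E) true false); last first.
  by apply/measurable_EFinP; apply: measurable_funM.
have cf : continuous ( *%R (2 : R)).
  by move=> t; apply: cvgM; [exact: cvg_cst | exact: cvg_id].
have dF (t : R) : is_derive t (1 : R) (fun t => t ^+ 2) (2 * t).
  apply: DeriveDef; first exact: exprn_derivable.
  by rewrite exp_derive expr1 /GRing.scale/= mulr1.
by rewrite (FTC2 x0 cf dF) expr0n/= subr0.
Qed.

Lemma indic_pos (z : R) : \1_(`]0%R, +oo[%classic) z = (0 < z)%R%:R :> R.
Proof. by rewrite indicE mem_setE in_itv/= andbT. Qed.

Lemma indic_01 (z : R) : \1_(`]0%R, 1%R[%classic) z = (0 < z < 1)%R%:R :> R.
Proof. by rewrite indicE mem_setE in_itv/=. Qed.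

(** The substitution c = 1 / z without differentiating: insert the factor
    1 = int_(0 < z < 1) 2 z dz, then apply Fubini around the linear substitutions
    c = u / z (for fixed z) and z = u z' (for fixed u); what remains of the
    inserted variable integrates to 1 / z^2. *)
Lemma ge0_integral_inv (g : mR -> \bar R) :
  measurable_fun setT g -> (forall x, (0 <= g x)%E) ->
  (\int[mu]_(c in `]0%R, +oo[) g c =
   \int[mu]_(z in `]0%R, +oo[) ((z^-1 ^+ 2)%:E * g (z^-1)%R))%E.
Proof.
move=> mg g0.
pose I1 : mR -> mR := \1_(`]0%R, 1%R[%classic).
pose Io : mR -> mR := \1_(`]0%R, +oo[%classic).
have mI1 : measurable_fun setT I1 by exact: measurable_indic.
have mIo : measurable_fun setT Io by exact: measurable_indic.
have I10 z : 0 <= I1 z by rewrite /I1.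
have Io0 z : 0 <= Io z by rewrite /Io.
(* on positive numbers, the inverse is the power - 1, which is measurable *)
have mpow : measurable_fun setT ((@powR R)^~ (-1) : mR -> mR) by exact: measurable_powR.
pose P (z : mR * mR) := ((I1 z.1 * Io z.2 * 2)%:E * g (z.2 * (z.1 `^ -1))%R)%E.
have P0 z : (0 <= P z)%E by rewrite mule_ge0// lee_fin !mulr_ge0.
have mP : measurable_fun [set: mR * mR] P.
  apply: emeasurable_funM.
    apply/measurable_EFinP; apply: measurable_funM => //; apply: measurable_funM.
      exact: (measurableT_comp mI1).
    exact: (measurableT_comp mIo).
  apply: measurableT_comp => //; apply: measurable_funM => //.
  exact: (measurableT_comp mpow).
pose Q (q : mR * mR) :=
  ((Io q.2 * (2 * q.2) * I1 (q.1 * q.2))%:E * g (q.1 `^ -1)%R)%E.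
have Q0 z : (0 <= Q z)%E.
  rewrite mule_ge0// lee_fin mulr_ge0// /Io indic_pos.
  by case: ltP => [/ltW|] ?; rewrite ?mul0r// mul1r mulr_ge0.
have mQ : measurable_fun [set: mR * mR] Q.
  apply: emeasurable_funM.
    apply/measurable_EFinP; apply: measurable_funM.
      apply: measurable_funM; last exact: measurable_funM.
      exact: (measurableT_comp mIo).
    by apply: (measurableT_comp mI1); apply: measurable_funM.
  by apply: measurableT_comp => //; exact: (measurableT_comp mpow).
transitivity (\int[mu]_z \int[mu]_u P (z, u))%E.
  transitivity (\int[mu]_z ((I1 z * (2 * z))%:E * \int[mu]_(c in `]0%R, +oo[) g c))%E.
    rewrite ge0_integralZr//; last 3 first.
    - by apply/measurable_EFinP; apply: measurable_funM => //; exact: measurable_funM.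
    - move=> z _; rewrite lee_fin /I1 indic_01.
      have [/andP[/ltW ? _]|_] := boolP (0 < z < 1); rewrite ?mul0r// mul1r.
      exact: mulr_ge0.
    - exact: integral_ge0.
    rewrite (_ : (\int[_]_x (I1 x * _)%:E)%E = 1%E) ?mul1e//.
    have := integral_id_segment ltr01; rewrite expr1n => h1.
    rewrite -[RHS]h1 [RHS]integral_mkcond.
    by apply: eq_integral => z _; rewrite epatch_indic/= EFinM muleC.
  apply: eq_integral => z _; rewrite /P/= /I1 indic_01.
  have [/andP[z0 z1]|_] := boolP (0 < z < 1); last first.
    rewrite !mul0r mul0e; apply/esym; apply: integral0_eq => u _.
    by rewrite !mul0r mul0e.
  rewrite mul1r integral_mkcond epatch_indic/=.
  rewrite (ge0_integral_affine 0 (a := z^-1)); last 3 first.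
  - by apply: emeasurable_funM => //; apply/measurable_EFinP.
  - by move=> x; rewrite mule_ge0// lee_fin.
  - by rewrite invr_eq0 gt_eqF.
  rewrite muleA -EFinM gtr0_norm ?invr_gt0// mulfK ?gt_eqF//.
  rewrite -ge0_integralZl//; last 2 first.
  - apply: (@measurableT_comp _ _ _ _ _ _ (fun x => g x * (\1_(`]0%R, +oo[%classic) x)%:E)%E _
     (fun x => z^-1 * x + 0)); last exact: measurable_affine.
    by apply: emeasurable_funM => //; apply/measurable_EFinP.
  - by move=> x _; rewrite mule_ge0// lee_fin.
  apply: eq_integral => u _; rewrite powR_inv1 1?ltW// /Io !indic_pos.
  rewrite addr0 pmulr_rgt0 ?invr_gt0// mul1r muleCA muleC -EFinM [(z^-1 * u)%R]mulrC.
  by rewrite [(2 * _)%R]mulrC.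
rewrite -integral2E// integral2_swap//.
transitivity (\int[mu]_u \int[mu]_z Q (z, u))%E.
  apply: eq_integral => u _; have [u0|u0] := ltP 0 u; last first.
    by apply: eq_integral => z _; rewrite /P/Q/= /Io indic_pos ltNge u0 !(mulr0,mul0r,mul0e).
  have mPu : measurable_fun setT (fun x => P (x, u)) by exact: measurable_fun_pair1.
  rewrite (ge0_integral_affine 0 (a := u)); last 3 first.
  - exact: mPu.
  - by move=> x; exact: P0.
  - by rewrite gt_eqF.
  rewrite -ge0_integralZl//; last exact: (measurableT_comp mPu (measurable_affine u 0)).
  apply: eq_integral => z _; rewrite /P/Q/Io /= indic_pos u0 addr0 gtr0_norm// !mulr1 !mul1r.
  rewrite (mulrC u z) /I1 !indic_01; have [/andP[z0 _]|_] := boolP (0 < z * u < 1); last first.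
    by rewrite !(mulr0,mul0r,mul0e,mule0).
  have zp : 0 < z by move: z0; rewrite pmulr_lgt0.
  rewrite mulr1 mul1r muleA -EFinM (mulrC u 2) !powR_inv1 1?ltW//; congr (_ * g _)%E.
  by field; rewrite !gt_eqF.
rewrite -integral2_swap// integral2E//.
rewrite [RHS]integral_mkcond; apply: eq_integral => z _/=.
rewrite epatch_indic/= indic_pos /Q/=.
have [z0|z0] := ltP 0 z; last first.
  rewrite mule0; apply: integral0_eq => u _; rewrite /Io indic_pos.
  have [u0|u0] := ltP 0 u; last by rewrite !mul0r mul0e.
  by rewrite /I1 indic_01 pmulr_lgt0// ltNge z0/= mulr0 mul0e.
rewrite mule1 powR_inv1 1?ltW// ge0_integralZr//; last 2 first.
- apply/measurable_EFinP; apply: measurable_funM; first exact: measurable_funM.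
  by apply: (measurableT_comp mI1); apply: measurable_funM.
- move=> u _; rewrite lee_fin mulr_ge0// /Io indic_pos.
  by case: ltP => [/ltW|] ?; rewrite ?mul0r// mul1r mulr_ge0.
congr (_ * _)%E.
rewrite -integral_id_segment ?invr_gt0// [RHS]integral_mkcond.
apply: eq_integral => u _; rewrite epatch_indic/= /Io/I1 indic_pos indic_01.
rewrite indicE mem_setE in_itv/= -EFinM.
have [u0|u0] := ltP 0 u; last by rewrite !mul0r mulr0.
rewrite mul1r mulr_gt0//=; congr ((_ * (nat_of_bool _)%:R)%:E).
by rewrite -[u < z^-1](ltr_pM2l z0) mulfV ?gt_eqF.
Qed.

Definition oline (a b : R) : set (mR * mR) := [set x | a * x.1 + b * x.2 = 0].

Lemma measurable_oline a b : measurable (oline a b).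
Proof.
rewrite -[X in measurable X]setTI (_ : oline a b = (fun x : mR * mR => a * x.1 + b * x.2 : mR) @^-1` [set 0]) //.
have : measurable_fun setT (fun x : mR * mR => a * x.1 + b * x.2 : mR).
  by apply: measurable_funD; apply: measurable_funM.
by apply.
Qed.

Lemma oline_null a b : (a, b) != 0 -> mu2 (oline a b) = 0%E.
Proof.
move=> ab0.
have mi a' b' : measurable_fun setT (fun y : mR * mR => (\1_(oline a' b') y)%:E).
  by apply/measurable_EFinP; apply: measurable_indic; exact: measurable_oline.
have i0 a' b' (y : mR * mR) : (0 <= (\1_(oline a' b') y)%:E :> \bar R)%E by rewrite lee_fin.
have muE a' b' : mu2 (oline a' b') = (\int[mu2]_y (\1_(oline a' b') y)%:E)%E.
  by rewrite integral_indic ?setIT//; exact: measurable_oline.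
have H (a' b' : R) : b' != 0 -> mu2 (oline a' b') = 0%E.
  move=> b0.
  rewrite muE integral2E//.
  apply: integral0_eq => x _.
  rewrite (_ : (fun y => _) = (fun y => (\1_[set (- (a' * x) / b')%R] y)%:E)); last first.
    apply/funext => y; rewrite !indicE; congr ((nat_of_bool _)%:R%:E); apply/idP/idP.
      rewrite !inE /oline/= => h; apply: (mulIf b0); rewrite divfK//; lra.
    by rewrite !inE /oline/= => ->; field.
  by rewrite integral_indic// setIT; exact: lebesgue_measure_set1.
have [b0|b0] := eqVneq b 0; last exact: H.
have a0 : a != 0 by apply: contraNneq ab0 => ->; rewrite b0.
rewrite -[RHS](H b a a0) !muE [LHS]integral2_transpose//.
apply: eq_integral => y _; rewrite !indicE; congr ((nat_of_bool _)%:R%:E).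
by apply/idP/idP; rewrite !inE /oline/= addrC.
Qed.

Lemma rat_between (a b : R) : a < b -> exists q : rat, a < ratr q /\ ratr q < b.
Proof. by move=> /rat_in_itvoo[q]; rewrite in_itv/= => /andP[aq qb]; exists q. Qed.

(** An open set is a countable union of squares with rational centres and
    radii, which belong to the product sigma-algebra. *)
Lemma open2_measurable (A : set (R * R)) : open A -> measurable (A : set (mR * mR)).
Proof.
move=> oA.
pose B (q : rat * rat * rat) : set (mR * mR) :=
  [set x | `|ratr q.1.1 - x.1| < ratr q.2 /\ `|ratr q.1.2 - x.2| < ratr q.2].
pose B' q := if pselect (B q `<=` A) then B q else set0.
have mB q : measurable (B q).
  rewrite (_ : B q = (ball (ratr q.1.1 : R) (ratr q.2) : set R) `*` (ball (ratr q.1.2 : R) (ratr q.2) : set R)).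
    by apply: measurableX; exact: measurable_ball.
  by apply/seteqP; split => x.
rewrite (_ : A = \bigcup_q B' q).
  apply: countable_bigcupT_measurable; first exact: countableP.
  move=> q; rewrite /B'; case: pselect => /= _; first exact: mB.
  exact: measurable0.
apply/seteqP; split => [x Ax|x [q _]]; last first.
  by rewrite /B'; case: pselect => //= BA Bx; exact: BA.
have /nbhs_ballP [e /= e0 eA] : nbhs x A by apply: open_nbhs_nbhs; split.
have e20 : 0 < e / 2 by rewrite divr_gt0.
have [r [r0 re]] := rat_between e20.
have [|q1 [a1 b1]] := @rat_between x.1 (x.1 + ratr r); first by rewrite ltrDl.
have [|q2 [a2 b2]] := @rat_between x.2 (x.2 + ratr r); first by rewrite ltrDl.
exists (q1, q2, r) => //; rewrite /B'; case: pselect => /= [_|nB].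
  by rewrite /B/= !gtr0_norm ?subr_gt0//; split; lra.
exfalso; apply: nB => y [/= h1 h2]; apply: eA; split; rewrite /ball/=.
  by move: h1; rewrite !ltr_norml => /andP[? ?]; apply/andP; split; lra.
by move: h2; rewrite !ltr_norml => /andP[? ?]; apply/andP; split; lra.
Qed.

End measure_prelims.

(** * Level sets and the Brunn-Minkowski inequality on the line *)

Section one_dim.
Context {R : realType}.
Local Notation mR := (measurableTypeR R).
Local Notation mu := (@lebesgue_measure R).
Local Notation mu2 := (@lebesgue_measure2 R).

Lemma eq_indic (T U : Type) (A : set T) (B : set U) x y :
  (A x <-> B y) -> \1_A x = \1_B y :> R.
Proof.
move=> h; rewrite !indicE; congr ((nat_of_bool _)%:R).
by apply/idP/idP; rewrite !inE => /h.
Qed.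

Lemma integral1_indic (E : set mR) : measurable E -> (\int[mu]_x (\1_E x : R)%:E = mu E)%E.
Proof. by move=> mE; rewrite integral_indic// setIT. Qed.

Lemma measurable_superlevel (f : mR -> \bar R) : measurable_fun setT f ->
  measurable [set q : mR * mR | (0 < q.2)%R /\ (q.2%:E <= f q.1)%E].
Proof.
move=> mf.
rewrite (_ : [set _ | _] = (setT `*` `]0%R, +oo[) `&` (setT `&` [set q : mR * mR | (q.2%:E <= f q.1)%E])).
  apply: measurableI.
    by apply: measurableX => //; exact: measurable_itv.
  apply: measurable_lee => //.
    by apply/measurable_EFinP; exact: measurable_snd.
  by apply: measurableT_comp => //; exact: measurable_fst.
by apply/seteqP; split => q /=; rewrite in_itv/= andbT; tauto.
Qed.

(** The level is t M with M meant to be the supremum of f, so that t ranges over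
    ]0, 1[ for all the functions that are compared. *)
Definition superlevel (f : mR -> \bar R) (M t : R) : set mR :=
  [set x | ((t * M)%:E <= f x)%E].

Lemma measurable_superlevel1 (f : mR -> \bar R) M t : measurable_fun setT f ->
  measurable (superlevel f M t).
Proof.
move=> mf; rewrite /superlevel -[X in measurable X]setTI.
exact: measurable_lee.
Qed.

(** Fubini for the indicator function of the region under the graph of f. *)
Lemma layer_cake (f : mR -> \bar R) : measurable_fun setT f -> (forall x, 0 <= f x)%E ->
  (\int[mu]_x f x = \int[mu]_(t in `]0%R, +oo[) mu (superlevel f 1 t))%E.
Proof.
move=> mf f0.
pose A := [set q : mR * mR | (0 < q.2)%R /\ (q.2%:E <= f q.1)%E].
have mA : measurable A := measurable_superlevel mf.
have mI : measurable_fun setT (fun q : mR * mR => (\1_A q : R)%:E).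
  by apply/measurable_EFinP; exact: measurable_indic.
have I0 (q : mR * mR) : (0 <= (\1_A q)%:E :> \bar R)%E by rewrite lee_fin.
transitivity (\int[mu2]_q (\1_A q)%:E)%E.
  rewrite integral2E//; apply: eq_integral => x _.
  rewrite (_ : (fun y => _) = (fun y => (\1_[set y : mR | (0 < y)%R /\ (y%:E <= f x)%E] y)%:E)); last first.
    by apply/funext => y; congr EFin; apply: eq_indic.
  have := f0 x; case: (f x) => [r r0||//].
    rewrite (_ : [set y | _] = `]0%R, r]%classic); last first.
      by apply/seteqP; split => y /=; rewrite in_itv/= lee_fin => /andP.
    rewrite integral1_indic// lebesgue_measure_itv/= lte_fin.
    rewrite lee_fin in r0; case: ltP => r1; first by rewrite oppr0 adde0.
    by congr EFin; apply/le_anti/andP.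
  move=> _; rewrite (_ : [set y | _] = `]0%R, +oo[%classic); last first.
    apply/seteqP; split => y /=; rewrite in_itv/= ?andbT; first by case.
    by move=> ?; rewrite leey.
  by rewrite integral1_indic// lebesgue_measure_itv/= ltry.
rewrite integral2_swap// [RHS]integral_mkcond; apply: eq_integral => t _.
rewrite epatch_indic/= indic_pos.
have [t0|t0] := ltP 0 t; last first.
  rewrite mule0; apply: integral0_eq => x _; rewrite indicE memNset// /A/=.
  by rewrite ltNge t0 => -[].
rewrite mule1 -integral1_indic//; last exact: measurable_superlevel1.
apply: eq_integral => x _; congr EFin; apply: eq_indic.
by rewrite /A/superlevel/= mulr1; split=> [[]|].
Qed.

Lemma measurable_mu_superlevel (f : mR -> \bar R) M : measurable_fun setT f ->
  measurable_fun setT (fun t => mu (superlevel f M t)).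
Proof.
move=> mf.
pose A := [set q : mR * mR | ((q.2 * M)%:E <= f q.1)%E].
have mA : measurable A.
  rewrite -[A]setTI; apply: measurable_lee => //.
    by apply/measurable_EFinP; apply: measurable_funM.
  by apply: measurableT_comp => //; exact: measurable_fst.
have mI : measurable_fun setT (fun q : mR * mR => (\1_A q : R)%:E).
  by apply/measurable_EFinP; exact: measurable_indic.
have I0 (q : mR * mR) : (0 <= (\1_A q)%:E :> \bar R)%E by rewrite lee_fin.
rewrite (_ : (fun t => _) = (fun t => \int[mu]_x (\1_A (x, t))%:E)%E).
  exact: (measurable_int_fst mI I0).
apply/funext => t; by rewrite -integral1_indic//; exact: measurable_superlevel1.
Qed.

Lemma layer_cake_scaled (f : mR -> \bar R) M : measurable_fun setT f ->
  (forall x, 0 <= f x)%E -> 0 < M ->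
  (M%:E * \int[mu]_(t in `]0%R, +oo[) mu (superlevel f M t) = \int[mu]_x f x)%E.
Proof.
move=> mf f0 M0; rewrite layer_cake//.
rewrite [X in (_ * X)%E]integral_mkcond [RHS]integral_mkcond !epatch_indic.
rewrite [RHS](ge0_integral_affine 0 (a := M)) ?gt_eqF//; last 2 first.
- apply: emeasurable_funM; first exact: measurable_mu_superlevel.
  by apply/measurable_EFinP; exact: measurable_indic.
- by move=> x; rewrite mule_ge0// lee_fin.
rewrite gtr0_norm//; congr (_ * _)%E; apply: eq_integral => t _ /=.
rewrite !indic_pos addr0 pmulr_rgt0//; congr (mu _ * _)%E.
by rewrite /superlevel mulr1 mulrC.
Qed.

(** Otherwise E lies in an interval of length r. This lets an interval of length
    almost mu E stand for E, even when E is unbounded. *)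
Lemma exists_large_gap (E : set mR) (x0 r : R) : E x0 -> (r%:E < mu E)%E -> measurable E ->
  exists p q : R, [/\ E p, E q, p <= q & r <= q - p].
Proof.
move=> Ex0 rE mE; apply: contrapT => nex.
have H p q : E p -> E q -> p <= q -> q - p < r.
  move=> Ep Eq pq; rewrite ltNge; apply/negP => rqp.
  by apply: nex; exists p, q.
have r0 : 0 < r by have := H x0 x0 Ex0 Ex0 (lexx _); rewrite subrr.
have lb : lbound E (x0 - r).
  move=> y Ey; have [/ltW xy|yx] := ltP x0 y; first by apply: le_trans xy; lra.
  have := H _ _ Ey Ex0 yx; lra.
have iE : has_inf E by split; [exists x0|exists (x0 - r)].
have sub : E `<=` `[inf E, inf E + r].
  move=> y Ey; rewrite /= in_itv/= ge_inf//=; last by case: iE.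
  rewrite leNgt; apply/negP => yr.
  have e0 : 0 < y - (inf E + r) by rewrite subr_gt0.
  have [z Ez zy] := inf_adherent e0 iE.
  have zy' : z <= y by apply: le_trans (ltW zy) _; lra.
  by have := H _ _ Ez Ey zy'; lra.
have : (mu E <= mu `[inf E, (inf E + r)%R])%E.
  by apply: le_measure => //; rewrite inE.
rewrite lebesgue_measure_itv/= lte_fin ltrDl r0 -EFinD (addrC (inf E)) addrK => h.
by have := lt_le_trans rE h; rewrite ltxx.
Qed.

(** Passing from all r < A to A; A may be infinite. *)
Lemma affine_le_ereal (A B : \bar R) (c d : R) : 0 < c -> (0 <= A)%E ->
  (forall r : R, r%:E < A -> (c * r + d)%:E <= B)%E -> (c%:E * A + d%:E <= B)%E.
Proof.
move=> c0; case: A => [a a0 H|_ H|//].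
- apply/lee_addgt0Pr => e e0.
  have := H (a - e / c); rewrite lte_fin ltrBlDr ltrDl divr_gt0// => /(_ isT) h.
  rewrite -leeBlDr//; apply: le_trans h.
  rewrite mulrBr [c * (e / c)]mulrC divfK ?gt_eqF// lee_fin; lra.
- rewrite gt0_muley ?lte_fin// addye//.
  case: B H => [b|//|] H; last by have := H 0 (ltry _); rewrite leeNy_eq.
  have := H ((b - d + 1) / c) (ltry _); rewrite lee_fin mulrC divfK ?gt_eqF// => h.
  by exfalso; lra.
Qed.

(** Intervals, described without endpoints. *)
Definition oconvex (E : set mR) := forall x y z : R, E x -> E y -> x <= z <= y -> E z.

(** By exists_large_gap, E0 and E1 contain segments of length almost mu E0 and
    mu E1; the combination of these two segments is a segment contained in E. *)
Lemma brunn_minkowski1 (E0 E1 E : set mR) (l : R) : 0 < l < 1 ->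
  measurable E0 -> measurable E1 -> measurable E -> oconvex E0 -> oconvex E1 ->
  E0 !=set0 -> E1 !=set0 ->
  (forall x y : R, E0 x -> E1 y -> E ((1 - l) * x + l * y)) ->
  ((1 - l)%:E * mu E0 + l%:E * mu E1 <= mu E)%E.
Proof.
move=> /andP[l0 l1] m0 m1 mE c0 c1 [x0 Ex0] [x1 Ex1] H.
have l1' : 0 < 1 - l by rewrite subr_gt0.
have K (r0 r1 : R) : (r0%:E < mu E0 -> r1%:E < mu E1 -> ((1 - l) * r0 + l * r1)%:E <= mu E)%E.
  move=> h0 h1.
  have [p0 [q0 [Ep0 Eq0 pq0 rpq0]]] := exists_large_gap Ex0 h0 m0.
  have [p1 [q1 [Ep1 Eq1 pq1 rpq1]]] := exists_large_gap Ex1 h1 m1.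
  set p := (1 - l) * p0 + l * p1; set q := (1 - l) * q0 + l * q1.
  have pq : p <= q by rewrite lerD// ler_pM2l.
  have sub : `[p, q] `<=` E.
    move=> z /=; rewrite in_itv/= => /andP[pz zq].
    have [e|ne] := eqVneq p q.
      rewrite (_ : z = p); first exact: H.
      by apply/le_anti; rewrite pz e zq.
    have D0 : 0 < q - p by rewrite subr_gt0 lt_neqAle ne.
    pose s := (z - p) / (q - p).
    have s0 : 0 <= s by rewrite divr_ge0 ?subr_ge0// ltW.
    have s1 : s <= 1 by rewrite ler_pdivrMr// mul1r lerD2r.
    have hz : z = p + s * (q - p) by rewrite /s divfK ?gt_eqF// addrC subrK.
    rewrite (_ : z = (1 - l) * (p0 + s * (q0 - p0)) + l * (p1 + s * (q1 - p1))).
      apply: H.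
        by apply: (c0 _ _ _ Ep0 Eq0); rewrite lerDl mulr_ge0 ?subr_ge0//=; nra.
      by apply: (c1 _ _ _ Ep1 Eq1); rewrite lerDl mulr_ge0 ?subr_ge0//=; nra.
    by rewrite hz /p /q; ring.
  have : (mu `[p, q] <= mu E)%E.
    by apply: le_measure => //; rewrite inE.
  apply: le_trans; rewrite lebesgue_measure_itv/= lte_fin.
  have hl : (1 - l) * r0 + l * r1 <= q - p.
    rewrite (_ : q - p = (1 - l) * (q0 - p0) + l * (q1 - p1)); last by rewrite /p/q; ring.
    by rewrite lerD// ler_pM2l.
  case: ltP => [_|qp]; first by rewrite -EFinD lee_fin.
  by rewrite lee_fin (le_trans hl)// subr_le0.
rewrite addeC.
have fin (r0 : R) : (r0%:E < mu E0 -> l%:E * mu E1 + ((1 - l) * r0)%:E <= mu E)%E.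
  move=> h0; apply: affine_le_ereal => // r1 h1; rewrite addrC; exact: K.
have [[r1 e1]|e1|e1] : [\/ exists r : R, mu E1 = r%:E, mu E1 = +oo%E | mu E1 = -oo%E].
  by case: (mu E1) => [r||]; [apply: Or31; exists r|apply: Or32|apply: Or33].
- rewrite e1 -EFinM addeC; apply: affine_le_ereal => // r0 h0.
  by have := fin _ h0; rewrite e1 -EFinM -EFinD addrC.
- have := fin (- 1) (lt_le_trans _ (measure_ge0 _ _)); rewrite lte_fin oppr_lt0 ltr01.
  move=> /(_ isT); rewrite e1 gt0_muley ?lte_fin// addye//.
  by rewrite leye_eq => /eqP ->; rewrite leey.
- by have : (0 <= mu E1)%E := measure_ge0 _ _; rewrite e1.
Qed.

Lemma layer_cake01 (f : mR -> \bar R) M : measurable_fun setT f ->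
  (forall x, 0 <= f x)%E -> (forall x, f x <= M%:E)%E -> 0 < M ->
  (\int[mu]_x f x = M%:E * \int[mu]_(t in `]0%R, 1%R[) mu (superlevel f M t))%E.
Proof.
move=> mf f0 fM M0; rewrite -(layer_cake_scaled mf f0 M0); congr (_ * _)%E.
have ms : measurable_fun (setT : set mR) (fun t => mu (superlevel f M t)).
  exact: measurable_mu_superlevel.
transitivity (\int[mu]_(t in `]0%R, 1%R]) mu (superlevel f M t))%E; last first.
  by apply: integral_itv_bndoo; exact: measurable_funS ms.
rewrite (@itv_bndbnd_setU _ _ _ (BRight 1%R))//; last by rewrite bnd_simp ler01.
rewrite ge0_integral_setU//; last 2 first.
- exact: measurable_funS ms.
- apply/disj_setPS => t [] /=; rewrite !in_itv/= => /andP[_ t1] /andP[t2 _].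
  by have := lt_le_trans t2 t1; rewrite ltxx.
rewrite -[RHS]adde0; congr (_ + _)%E.
apply: integral0_eq => t; rewrite /= in_itv/= andbT => t1.
rewrite (_ : superlevel f M t = set0) ?measure0//.
apply/seteqP; split => // x; rewrite /superlevel/= => h.
have := le_trans h (fM x); rewrite lee_fin -ler_pdivlMr// divff ?gt_eqF// leNgt t1//.
Qed.

(** The level sets of f at level t M contain the combinations of those of f0 at
    t M0 and f1 at t M1. Normalising f0 and f1 by their suprema M0 and M1 makes
    both families of level sets nonempty for the same t, which is what the
    Brunn-Minkowski inequality requires; then integrate it over t. *)
Lemma level_sets_ineq (f f0 f1 : mR -> \bar R) (M M0 M1 l : R) :
  0 < l < 1 -> 0 < M -> 0 < M0 -> 0 < M1 ->
  measurable_fun setT f -> measurable_fun setT f0 -> measurable_fun setT f1 ->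
  (forall x, 0 <= f x)%E -> (forall x, 0 <= f0 x)%E -> (forall x, 0 <= f1 x)%E ->
  (forall x, f0 x <= M0%:E)%E -> (forall x, f1 x <= M1%:E)%E ->
  (forall t, 0 < t < 1 -> superlevel f0 M0 t !=set0) ->
  (forall t, 0 < t < 1 -> superlevel f1 M1 t !=set0) ->
  (forall t, 0 < t < 1 -> oconvex (superlevel f0 M0 t)) ->
  (forall t, 0 < t < 1 -> oconvex (superlevel f1 M1 t)) ->
  (forall t x y, 0 < t < 1 -> superlevel f0 M0 t x -> superlevel f1 M1 t y ->
     superlevel f M t ((1 - l) * x + l * y)) ->
  (M%:E * (((1 - l) / M0)%:E * \int[mu]_x f0 x + (l / M1)%:E * \int[mu]_x f1 x)
   <= \int[mu]_x f x)%E.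
Proof.
move=> l01 Mp Mp0 Mp1 mf mf0 mf1 p p0 p1 b0 b1 ne0 ne1 c0 c1 H.
have /andP[l0 l1] := l01; have l1' : 0 <= 1 - l by rewrite subr_ge0 ltW.
rewrite -(layer_cake_scaled mf p Mp) lee_pmul2l// ?lte_fin//.
rewrite (layer_cake01 mf0 p0 b0 Mp0) (layer_cake01 mf1 p1 b1 Mp1).
rewrite !muleA -!EFinM !divfK ?gt_eqF//.
have ms f' M' : measurable_fun setT f' -> forall D, measurable_fun (D : set mR) (fun t => mu (superlevel f' M' t)).
  by move=> mf' D; apply: measurable_funTS; exact: measurable_mu_superlevel.
have Z (c M' : R) f' : 0 <= c -> measurable_fun setT f' ->
    (c%:E * \int[mu]_(t in `]0%R, 1%R[) mu (superlevel f' M' t) =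
     \int[mu]_(t in `]0%R, 1%R[) (c%:E * mu (superlevel f' M' t)))%E.
  by move=> c0' mf'; rewrite ge0_integralZl//; exact: ms.
rewrite !Z//; last exact: ltW.
rewrite -ge0_integralD//; last 4 first.
- by move=> t _; rewrite mule_ge0.
- by apply: emeasurable_funM => //; exact: ms.
- by move=> t _; rewrite mule_ge0// lee_fin ltW.
- by apply: emeasurable_funM => //; exact: ms.
apply: (@le_trans _ _ (\int[mu]_(t in `]0%R, 1%R[) mu (superlevel f M t))%E).
  apply: ge0_le_integral => //.
  - by move=> t _; rewrite adde_ge0// mule_ge0// lee_fin ltW.
  - by apply: emeasurable_funD; apply: emeasurable_funM => //; exact: ms.
  - exact: ms.
  - move=> t /=; rewrite in_itv/= => t01.
    apply: brunn_minkowski1 => //; [exact: measurable_superlevel1|exact: measurable_superlevel1|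
      exact: measurable_superlevel1|exact: c0|exact: c1|exact: ne0|exact: ne1|].
    by move=> x y; exact: H.
apply: ge0_subset_integral => //; first exact: ms.
by move=> t /=; rewrite !in_itv/= andbT => /andP[].
Qed.

End one_dim.

(** * A functional Busemann theorem *)

Section busemann.
Context {R : realType}.
Local Notation mR := (measurableTypeR R).
Local Notation mu := (@lebesgue_measure R).
Local Notation mu2 := (@lebesgue_measure2 R).

Lemma expR_convex (l u v : R) : 0 <= l <= 1 ->
  expR ((1 - l) * u + l * v) <= (1 - l) * expR u + l * expR v.
Proof.
move=> /andP[l0 l1]; set w := _ + _.
have H x : expR w * (1 + (x - w)) <= expR x.
  have -> : expR x = expR w * expR (x - w) by rewrite -expRD addrC subrK.
  by rewrite ler_pM2l ?expR_gt0// expR_ge1Dx.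
have := H u; have := H v; have := expR_gt0 w.
have -> : expR w = (1 - l) * (expR w * (1 + (u - w))) + l * (expR w * (1 + (v - w))).
  by rewrite /w; ring.
move=> _ h1 h2; apply: lerD; apply: ler_wpM2l => //; by rewrite ?subr_ge0//.
Qed.

Lemma ln_concave (l u v : R) : 0 <= l <= 1 -> 0 < u -> 0 < v ->
  (1 - l) * ln u + l * ln v <= ln ((1 - l) * u + l * v).
Proof.
move=> l01 u0 v0; have /andP[l0 l1] := l01.
have := expR_convex (ln u) (ln v) l01; rewrite !lnK ?posrE// => h.
by rewrite -[leLHS]expRK ler_ln ?posrE ?expR_gt0// (lt_le_trans (expR_gt0 _) h).
Qed.

(** The Prekopa-Leindler inequality on the line for bounded functions with
    intervals as level sets. After normalisation by the suprema, the level set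
    inequality gives an arithmetic mean of the normalised integrals, which the
    convexity of the exponential bounds below by the geometric mean. *)
Lemma prekopa (f f0 f1 : mR -> R) (B l a0 a1 : R) : 0 < l < 1 ->
  measurable_fun setT f -> measurable_fun setT f0 -> measurable_fun setT f1 ->
  (forall x, f0 x <= B) -> (forall x, f1 x <= B) ->
  (forall c x y z : R, c <= f0 x -> c <= f0 y -> x <= z <= y -> c <= f0 z) ->
  (forall c x y z : R, c <= f1 x -> c <= f1 y -> x <= z <= y -> c <= f1 z) ->
  (forall x y : R, (1 - l) * f0 x + l * f1 y <= f ((1 - l) * x + l * y)) ->
  ((expR a0)%:E <= \int[mu]_x (expR (f0 x))%:E)%E ->
  ((expR a1)%:E <= \int[mu]_x (expR (f1 x))%:E)%E ->
  ((expR ((1 - l) * a0 + l * a1))%:E <= \int[mu]_x (expR (f x))%:E)%E.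
Proof.
move=> l01 mf mf0 mf1 b0 b1 q0 q1 H h0 h1; have /andP[l0 l1] := l01.
have hs g : (forall x, g x <= B) -> has_sup (range (g : mR -> R)).
  by move=> b; split; [exists (g 0), 0|exists B => _ [x _ <-]].
pose s0 := sup (range f0); pose s1 := sup (range f1).
have f0s x : f0 x <= s0 by apply: ub_le_sup; [exact: (hs _ b0).2|exists x].
have f1s x : f1 x <= s1 by apply: ub_le_sup; [exact: (hs _ b1).2|exists x].
have mexp (g : mR -> R) : measurable_fun setT g -> measurable_fun setT (fun x => (expR (g x))%:E).
  by move=> mg; apply/measurable_EFinP; exact: measurableT_comp.
have lev (g : mR -> R) s t x : 0 < t < 1 ->
    superlevel (fun x => (expR (g x))%:E) (expR s) t x <-> ln t + s <= g x.
  move=> /andP[t0 _]; rewrite /superlevel/= lee_fin -{1}(lnK (x := t)) ?posrE//.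
  by rewrite -expRD ler_expR.
have ne (g : mR -> R) t : (forall x, g x <= B) -> 0 < t < 1 ->
    superlevel (fun x => (expR (g x))%:E) (expR (sup (range g))) t !=set0.
  move=> b t01; have /andP[t0 t1] := t01.
  have e0 : 0 < - ln t by rewrite oppr_gt0 ln_lt0 ?t0.
  have [_ [x _ <-] hx] := sup_adherent e0 (hs _ b).
  by exists x; apply/lev => //; rewrite addrC; move: hx; rewrite opprK => /ltW.
have := @level_sets_ineq R (fun x => (expR (f x))%:E) (fun x => (expR (f0 x))%:E)
  (fun x => (expR (f1 x))%:E) (expR ((1 - l) * s0 + l * s1)) (expR s0) (expR s1) l l01
  (expR_gt0 _) (expR_gt0 _) (expR_gt0 _) (mexp _ mf) (mexp _ mf0) (mexp _ mf1).
move=> /(_ _ _ _ _ _ (ne _ ^~ b0) (ne _ ^~ b1)) h.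
apply: le_trans (h _ _ _ _ _ _ _ _); last 8 first.
- by move=> x; rewrite lee_fin expR_ge0.
- by move=> x; rewrite lee_fin expR_ge0.
- by move=> x; rewrite lee_fin expR_ge0.
- by move=> x; rewrite lee_fin ler_expR.
- by move=> x; rewrite lee_fin ler_expR.
- move=> t t01 x y z /(lev _ _ _ _ t01) hx /(lev _ _ _ _ t01) hy xyz.
  by apply/(lev _ _ _ _ t01); apply: q0 xyz.
- move=> t t01 x y z /(lev _ _ _ _ t01) hx /(lev _ _ _ _ t01) hy xyz.
  by apply/(lev _ _ _ _ t01); apply: q1 xyz.
- move=> t x y t01 /(lev _ _ _ _ t01) hx /(lev _ _ _ _ t01) hy.
  apply/(lev _ _ _ _ t01); apply: le_trans (H _ _).
  have -> : ln t + ((1 - l) * s0 + l * s1) = (1 - l) * (ln t + s0) + l * (ln t + s1) by ring.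
  by apply: lerD; apply: ler_wpM2l => //; lra.
have l1' : 0 <= 1 - l by lra.
apply: (@le_trans _ _ ((expR ((1 - l) * s0 + l * s1))%:E * (((1 - l) / expR s0)%:E * (expR a0)%:E +
   (l / expR s1)%:E * (expR a1)%:E)))%E; last first.
  rewrite lee_pmul2l ?lte_fin ?expR_gt0//.
  by apply: leeD; apply: lee_wpmul2l => //; rewrite lee_fin divr_ge0 ?expR_ge0// ltW.
rewrite lee_fin -!mulrA -!expRN -!expRD.
have -> : (1 - l) * a0 + l * a1 = ((1 - l) * s0 + l * s1) + ((1 - l) * (- s0 + a0) + l * (- s1 + a1)) by ring.
rewrite [leLHS]expRD; apply: ler_wpM2l; first exact: expR_ge0.
by apply: expR_convex; rewrite !ltW.
Qed.

(** Inversion is discontinuous at 0, where its value is 0; writing it as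
    z (z^2)^(-1) avoids the sign of z. *)
Lemma measurable_invr : measurable_fun setT (fun z : mR => z^-1 : mR).
Proof.
rewrite (_ : (fun z => _) = (fun z : mR => z * (z ^+ 2) `^ (-1))); last first.
  apply/funext => z; have [->|z0] := eqVneq z 0; first by rewrite invr0 mul0r.
  by rewrite powR_inv1 ?sqr_ge0//; field.
apply: measurable_funM => //.
apply: (measurableT_comp (measurable_powR _ : measurable_fun setT ((@powR R)^~ (-1) : mR -> mR))).
exact: measurable_funX.
Qed.

(** The integral of exp(- L) over the plane with slope t through the first axis
    is shown to be quasi-concave in t, for a convex and even L. *)
Section slices.
Variable L : R -> R -> R -> R.
Hypothesis Lcvx : forall l a b c a' b' c' : R, 0 <= l <= 1 ->
  L ((1 - l) * a + l * a') ((1 - l) * b + l * b') ((1 - l) * c + l * c') <=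
  (1 - l) * L a b c + l * L a' b' c'.
Hypothesis Lev : forall a b c, L (- a) (- b) (- c) = L a b c.
Hypothesis Lm : forall t : R, measurable_fun setT (fun q : mR * mR => L q.1 (t * q.2) q.2 : mR).

Let F (t : R) (q : mR * mR) : \bar R := (expR (- L q.1 (t * q.2) q.2))%:E.
Let mF t : measurable_fun setT (F t).
Proof.
apply/measurable_EFinP; apply: measurableT_comp => //.
by apply: measurableT_comp => //; exact: Lm.
Qed.
Let F0 t q : (0 <= F t q)%E. Proof. by rewrite lee_fin expR_ge0. Qed.

Let m t (c : mR) : \bar R := (\int[mu]_a F t (a, c))%E.
Let mm t : measurable_fun setT (m t). Proof. exact: (measurable_int_fst (mF t) (F0 t)). Qed.
Let m0 t c : (0 <= m t c)%E. Proof. exact: integral_ge0. Qed.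

Let L_ge0 (a b c : R) : L 0 0 0 <= L a b c.
Proof.
have h : 0 <= (2^-1 : R) <= 1 by apply/andP; split; lra.
have := @Lcvx 2^-1 a b c (- a) (- b) (- c) h; rewrite Lev.
have e x : (1 - 2^-1) * x + 2^-1 * - x = 0 :> R by field.
by rewrite !e => /le_trans; apply; lra.
Qed.

(** The functions to which prekopa applies must have intervals as level sets. *)
Let L_quasi (b c k x y z : R) : k <= - L x b c -> k <= - L y b c -> x <= z <= y -> k <= - L z b c.
Proof.
move=> hx hy /andP[xz zy].
have [e|ne] := eqVneq x y; first by have -> : z = x by [apply/le_anti; rewrite xz e zy].
have D0 : 0 < y - x by rewrite subr_gt0 lt_neqAle ne (le_trans xz zy).
pose s := (z - x) / (y - x).
have s0 : 0 <= s by apply: divr_ge0; lra.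
have s1 : s <= 1 by rewrite ler_pdivrMr// mul1r lerD2r.
have hz : (1 - s) * x + s * y = z by rewrite /s; field; rewrite gt_eqF.
have s01 : 0 <= s <= 1 by rewrite s0.
have := @Lcvx s x b c y b c s01.
have e k' : (1 - s) * k' + s * k' = k' by ring.
rewrite hz !e; nra.
Qed.

(** The product t c is linear in the point (t c, c), not in t: the hypotheses
    relate the three points (t c, c) as the convexity of L wants them. *)
Let m_logconcave (l t0 t1 t c0 c1 c a0 a1 : R) : 0 < l < 1 ->
  t * c = (1 - l) * (t0 * c0) + l * (t1 * c1) -> c = (1 - l) * c0 + l * c1 ->
  ((expR a0)%:E <= m t0 c0)%E -> ((expR a1)%:E <= m t1 c1)%E ->
  ((expR ((1 - l) * a0 + l * a1))%:E <= m t c)%E.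
Proof.
move=> l01 htc hc h0 h1; have /andP[l0 l1] := l01.
have ms t' c' : measurable_fun setT (fun a : mR => - L a (t' * c') c' : mR).
  apply: measurableT_comp => //.
  exact: (measurable_fun_pair1 c' (Lm t')).
apply: (@prekopa (fun a => - L a (t * c) c) (fun a => - L a (t0 * c0) c0)
  (fun a => - L a (t1 * c1) c1) (- L 0 0 0) l a0 a1) => //; try exact: ms.
- by move=> x; rewrite lerN2.
- by move=> x; rewrite lerN2.
- by move=> k x y z; exact: L_quasi.
- by move=> k x y z; exact: L_quasi.
- move=> x y; rewrite htc hc !mulrN -opprD lerN2; apply: Lcvx.
  by rewrite !ltW.
Qed.

(** m t after the substitution z = 1 / c. In this variable the combinations of
    points (t c, c) become combinations of the pairs (t, z). *)
Let G t (z : mR) : \bar R := ((\1_(`]0%R, +oo[%classic) z * (z^-1 ^+ 2))%:E * m t (z^-1)%R)%E.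
Let mG t : measurable_fun setT (G t).
Proof.
apply: emeasurable_funM.
  apply/measurable_EFinP; apply: measurable_funM; first exact: measurable_indic.
  by apply: measurable_funX; exact: measurable_invr.
exact: (measurableT_comp (mm t) measurable_invr).
Qed.
Let G0 t z : (0 <= G t z)%E.
Proof. by rewrite mule_ge0// lee_fin mulr_ge0// sqr_ge0. Qed.

(** G^(-1/2) is a convex function of (t, z): a point (1 - l, l) between z0 and z1
    corresponds to the weight k = l z1 / z between the values c0 and c1, and
    G = z^(-2) m(1 / z) with m log-concave, so that the inequality reduces to the
    concavity of ln at s0 / z0 and s1 / z1. The numbers s0 and s1 are the values
    of G^(-1/2), kept as variables because G may be infinite. *)
Let G_conc (l t0 t1 z0 z1 s0 s1 : R) : 0 < l < 1 -> 0 < z0 -> 0 < z1 -> 0 < s0 -> 0 < s1 ->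
  ((s0^-1 ^+ 2)%:E <= G t0 z0)%E -> ((s1^-1 ^+ 2)%:E <= G t1 z1)%E ->
  ((((1 - l) * s0 + l * s1)^-1 ^+ 2)%:E <= G ((1 - l) * t0 + l * t1)%R ((1 - l) * z0 + l * z1)%R)%E.
Proof.
move=> /andP[l0 l1] z00 z10 s00 s10; rewrite /G !indic_pos z00 z10 !mul1r => h0 h1.
have l1' : 0 < 1 - l by rewrite subr_gt0.
set z := (1 - l) * z0 + l * z1; set t := (1 - l) * t0 + l * t1.
set s := (1 - l) * s0 + l * s1.
have zp : 0 < z by rewrite addr_gt0// mulr_gt0.
have sp : 0 < s by rewrite addr_gt0// mulr_gt0.
rewrite zp mul1r.
pose k := l * z1 / z.
have k0 : 0 < k by rewrite divr_gt0// mulr_gt0.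
have k1 : k < 1 by rewrite ltr_pdivrMr// mul1r ltrDr mulr_gt0.
have k01 : 0 < k < 1 by rewrite k0.
have e1k : 1 - k = (1 - l) * z0 / z.
  by apply: (mulIf (lt0r_neq0 zp)); rewrite mulrBl mul1r !divfK ?gt_eqF// /z addrK.
have H (z' s' t' : R) : 0 < z' -> 0 < s' -> ((s'^-1 ^+ 2)%:E <= (z'^-1 ^+ 2)%:E * m t' (z'^-1)%R)%E <->
    ((expR (2 * ln (z' / s')))%:E <= m t' (z'^-1)%R)%E.
  move=> zp' sp'; rewrite mulr_natl -lnXn ?divr_gt0// lnK ?posrE ?exprn_gt0 ?divr_gt0//.
  have -> : s'^-1 ^+ 2 = z'^-1 ^+ 2 * (z' / s') ^+ 2 by rewrite -exprMn mulKf ?gt_eqF.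
  by rewrite EFinM lee_pmul2l ?lte_fin ?exprn_gt0 ?invr_gt0.
move/(H _ _ _ z00 s00) : h0 => h0; move/(H _ _ _ z10 s10) : h1 => h1.
apply/H => //; apply: le_trans (m_logconcave (t := t) (c := z^-1) k01 _ _ h0 h1).
- rewrite lee_fin ler_expR.
  have -> : (1 - k) * (2 * ln (z0 / s0)) + k * (2 * ln (z1 / s1)) =
     - 2 * ((1 - k) * ln (s0 / z0) + k * ln (s1 / z1)).
    have e x y : 0 < x -> 0 < y -> ln (x / y) = - ln (y / x) :> R.
      by move=> x0 y0; rewrite -lnV ?posrE ?divr_gt0// invf_div.
    by rewrite (e z0)// (e z1)//; ring.
  have -> : ln (z / s) = - ln (s / z).
    by rewrite -lnV ?posrE ?divr_gt0// invf_div.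
  have k01' : 0 <= k <= 1 by rewrite !ltW.
  have := ln_concave k01' (divr_gt0 s00 z00) (divr_gt0 s10 z10).
  have -> : (1 - k) * (s0 / z0) + k * (s1 / z1) = s / z.
    by rewrite e1k /k /s; field; rewrite !gt_eqF.
  lra.
- by rewrite e1k /k /t; field; rewrite !gt_eqF.
- by rewrite e1k /k; field; rewrite !gt_eqF.
Qed.

Let G_pos t (z x : R) : 0 < x -> (x%:E <= G t z)%E -> 0 < z.
Proof.
move=> x0; rewrite /G indic_pos; case: ltP => // _; rewrite mul0r mul0e lee_fin.
by rewrite leNgt x0.
Qed.

(** G may be unbounded, whereas level sets are normalised by finite suprema. *)
Let T t (n : nat) (z : mR) : \bar R := Order.min (G t z) n%:R%:E.
Let mT t n : measurable_fun setT (T t n).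
Proof. by apply: measurable_mine. Qed.
Let T0 t n z : (0 <= T t n z)%E.
Proof. by rewrite /T le_min G0/= lee_fin ler0n. Qed.

Let T_nd t z (n k : nat) : (n <= k)%N -> (T t n z <= T t k z)%E.
Proof. by move=> nk; rewrite /T le_min ge_min lexx/= ge_min lee_fin ler_nat nk orbT. Qed.

Let int_nd t (n k : nat) : (n <= k)%N -> (\int[mu]_z T t n z <= \int[mu]_z T t k z)%E.
Proof.
move=> nk; apply: ge0_le_integral => //.
by move=> z _; exact: T_nd.
Qed.

Let trunc_lt t (r : R) : (r%:E < \int[mu]_z G t z)%E ->
  exists n, (r%:E < \int[mu]_z T t n z)%E.
Proof.
move=> h; apply: contrapT => H.
have Hn n : (\int[mu]_z T t n z <= r%:E)%E by rewrite leNgt; apply/negP => ?; apply: H; exists n.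
have := @monotone_convergence _ _ _ mu setT measurableT (T t) (fun n => mT t n)
  (fun n z _ => T0 t n z) (fun z _ a b => @T_nd t z a b).
have -> : (\int[mu]_(x in setT) limn (T t ^~ x) = \int[mu]_x G t x)%E.
  apply: eq_integral => x _; apply/cvg_lim => //.
  have := G0 t x; rewrite /T; case: (G t x) => [g g0|_|//].
    apply: cvg_near_cst.
    near=> n.
    rewrite min_l// lee_fin.
    by near: n; exact: nbhs_infty_ger.
  rewrite (_ : (fun _ => _) = (fun n : nat => n%:R%:E)); last first.
    by apply/funext => n; rewrite min_r// leey.
  by apply/cvgeryP; exact: cvgr_idn.
move=> e; move: h; rewrite e ltNge => /negP; apply.
apply: lime_le; first by apply: ereal_nondecreasing_is_cvgn => a b ab; exact: int_nd.
by near=> n; exact: Hn.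
Unshelve. all: by end_near. Qed.

Let J t := (\int[mu]_z G t z)%E.

Let sqrtVK (x : R) : 0 < x -> (Num.sqrt x)^-1^-1 ^+ 2 = x.
Proof. by move=> x0; rewrite invrK sqr_sqrtr// ltW. Qed.

Let T_oconvex t n (x : R) : 0 < x -> oconvex [set z | (x%:E <= T t n z)%E].
Proof.
move=> x0 a b z /=; rewrite !le_min => /andP[ha hn] /andP[hb _] /andP[az zb].
rewrite hn andbT.
have [->//|na] := eqVneq z a; have [->//|nb] := eqVneq z b.
have az' : a < z by rewrite lt_neqAle eq_sym na.
have zb' : z < b by rewrite lt_neqAle nb.
have a0 := G_pos x0 ha; have b0 := G_pos x0 hb.
pose l := (z - a) / (b - a).
have D0 : 0 < b - a by lra.
have l01 : 0 < l < 1.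
  apply/andP; rewrite /l ltr_pdivrMr//; split; [apply: divr_gt0|]; lra.
have s0 : 0 < (Num.sqrt x)^-1 by rewrite invr_gt0 sqrtr_gt0.
have := @G_conc l t t a b _ _ l01 a0 b0 s0 s0; rewrite (sqrtVK x0) => /(_ ha hb).
have e k : (1 - l) * k + l * k = k by ring.
rewrite (e t) (e (Num.sqrt x)^-1) (sqrtVK x0).
by have -> : (1 - l) * a + l * b = z by rewrite /l; field; rewrite gt_eqF.
Qed.

(** M is the supremum of the truncation, which is positive since the integral
    is. *)
Let sup_trunc t n : (0 < \int[mu]_z T t n z)%E ->
  exists M : R, [/\ 0 < M, (forall z, T t n z <= M%:E)%E &
   forall th, 0 < th < 1 -> superlevel (T t n) M th !=set0].
Proof.
move=> h.
pose S : set R := [set fine (T t n z) | z in setT].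
have Tfin z : (fine (T t n z))%:E = T t n z.
  rewrite fineK// fin_numElt (lt_le_trans _ (T0 t n z))//=.
  by rewrite (@le_lt_trans _ _ n%:R%:E) ?ltry// ge_min lexx orbT.
have hS : has_sup S.
  split; first by exists (fine (T t n 0)), 0.
  by exists n%:R => _ [z _ <-]; rewrite -lee_fin Tfin ge_min lexx orbT.
have ub z : (T t n z <= (sup S)%:E)%E.
  by rewrite -Tfin lee_fin; apply: ub_le_sup; [exact: hS.2|exists z].
have S0 : 0 < sup S.
  rewrite ltNge; apply/negP => S0; move: h; rewrite integral0_eq ?ltxx// => z _.
  by apply/le_anti; rewrite T0 andbT (le_trans (ub z))// lee_fin.
exists (sup S); split => // th /andP[th0 th1].
have e0 : 0 < (1 - th) * sup S by rewrite mulr_gt0// subr_gt0.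
have [_ [z _ <-] hz] := sup_adherent e0 hS.
exists z; rewrite /superlevel/= -Tfin lee_fin ltW//; apply: le_lt_trans hz; lra.
Qed.

(** With M0 and M1 the suprema of the two truncations, G_conc bounds the
    supremum at the intermediate position by M = ((1 - l) M0^(-1/2) + l M1^(-1/2))^(-2).
    The level set inequality then yields
    (1 - l) M / M0 r + l M / M1 r, and the weights sum to at least 1 by the
    convexity of the square. *)
Let quasi_lt l t0 t1 (r : R) : 0 < l < 1 -> 0 < r -> (r%:E < J t0)%E -> (r%:E < J t1)%E ->
  (r%:E <= J ((1 - l) * t0 + l * t1)%R)%E.
Proof.
move=> l01 r0 /trunc_lt[n0 h0] /trunc_lt[n1 h1]; have /andP[l0 l1] := l01.
pose n := maxn n0 n1.
have {}h0 : (r%:E < \int[mu]_z T t0 n z)%E.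
  by apply: lt_le_trans h0 (int_nd _ _); exact: leq_maxl.
have {}h1 : (r%:E < \int[mu]_z T t1 n z)%E.
  by apply: lt_le_trans h1 (int_nd _ _); exact: leq_maxr.
have pos t : (r%:E < \int[mu]_z T t n z)%E -> (0 < \int[mu]_z T t n z)%E.
  by apply: lt_trans; rewrite lte_fin.
have [M0 [M00 b0 ne0]] := sup_trunc (pos _ h0).
have [M1 [M10 b1 ne1]] := sup_trunc (pos _ h1).
pose s0 := (Num.sqrt M0)^-1; pose s1 := (Num.sqrt M1)^-1.
have s00 : 0 < s0 by rewrite invr_gt0 sqrtr_gt0.
have s10 : 0 < s1 by rewrite invr_gt0 sqrtr_gt0.
pose s := (1 - l) * s0 + l * s1.
have l1' : 0 < 1 - l by lra.
have sp : 0 < s by rewrite addr_gt0// mulr_gt0.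
have Mp : 0 < s^-1 ^+ 2 by rewrite exprn_gt0// invr_gt0.
have := @level_sets_ineq R (G ((1 - l) * t0 + l * t1)) (T t0 n) (T t1 n) (s^-1 ^+ 2) M0 M1 l
  l01 Mp M00 M10 (mG _) (mT _ _) (mT _ _) (G0 _) (T0 _ _) (T0 _ _) b0 b1 ne0 ne1.
move=> h; apply: le_trans (h _ _ _); last 3 first.
- by move=> th /andP[th0 _]; apply: T_oconvex; rewrite mulr_gt0.
- by move=> th /andP[th0 _]; apply: T_oconvex; rewrite mulr_gt0.
- move=> th x y /andP[th0 th1]; rewrite /superlevel/= !le_min => /andP[hx _] /andP[hy _].
  have tM0 : 0 < th * M0 by rewrite mulr_gt0.
  have tM1 : 0 < th * M1 by rewrite mulr_gt0.
  have q0 : 0 < Num.sqrt th by rewrite sqrtr_gt0.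
  have hM (M : R) : 0 < M -> ((Num.sqrt M)^-1 / Num.sqrt th)^-1 ^+ 2 = th * M.
    by move=> M'; rewrite invf_div invrK exprMn !sqr_sqrtr ?ltW// mulrC.
  have := @G_conc l t0 t1 x y (s0 / Num.sqrt th) (s1 / Num.sqrt th) l01
    (G_pos tM0 hx) (G_pos tM1 hy) (divr_gt0 s00 q0) (divr_gt0 s10 q0).
  rewrite !hM// => /(_ hx hy); apply: le_trans; rewrite lee_fin.
  have -> : (1 - l) * (s0 / Num.sqrt th) + l * (s1 / Num.sqrt th) = s / Num.sqrt th.
    by rewrite /s; ring.
  by rewrite invf_div exprMn sqr_sqrtr// ltW.
have e0 : M0^-1 = s0 ^+ 2 by rewrite /s0 exprVn sqr_sqrtr ?ltW.
have e1 : M1^-1 = s1 ^+ 2 by rewrite /s1 exprVn sqr_sqrtr ?ltW.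
apply: (@le_trans _ _ ((s^-1 ^+ 2)%:E * (((1 - l) / M0)%:E * r%:E + (l / M1)%:E * r%:E))%E).
  rewrite lee_fin e0 e1 -mulrDl mulrA ler_peMl ?(ltW r0)//.
  rewrite exprVn mulrC ler_pdivlMr ?exprn_gt0// mul1r.
  rewrite -subr_ge0 (_ : _ - _ = l * (1 - l) * (s0 - s1) ^+ 2); last by rewrite /s; ring.
  by apply: mulr_ge0; [apply: mulr_ge0; lra|exact: sqr_ge0].
rewrite lee_pmul2l ?lte_fin//.
have p0 : (0 <= ((1 - l) / M0)%:E)%E by rewrite lee_fin; apply: divr_ge0; exact: ltW.
have p1 : (0 <= (l / M1)%:E)%E by rewrite lee_fin; apply: divr_ge0; exact: ltW.
by apply: leeD; [exact: lee_wpmul2l p0 _ _ (ltW h0)|exact: lee_wpmul2l p1 _ _ (ltW h1)].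
Qed.

(** The strict inequalities of quasi_lt suffice, by letting r increase to the
    minimum. *)
Let quasi_J l t0 t1 : 0 < l < 1 ->
  (Order.min (J t0) (J t1) <= J ((1 - l) * t0 + l * t1)%R)%E.
Proof.
move=> l01; rewrite leNgt; apply/negP.
have : (0 <= J ((1 - l) * t0 + l * t1)%R)%E by apply: integral_ge0.
move: (@quasi_lt l t0 t1 ^~ l01).
case: (J ((1 - l) * t0 + l * t1)) => [j|//|//] H j0 jm; last first.
  by move: jm; rewrite ltNge leey.
have [r jr rm] : exists2 r : R, j < r & (r%:E < Order.min (J t0) (J t1))%E.
  move: jm; case: (Order.min _ _) => [a|_|//]; last by exists (j + 1); rewrite ?ltry// ltrDl.
  by rewrite lte_fin => ja; exists ((j + a) / 2); rewrite ?lte_fin; lra.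
move: rm; rewrite lt_min => /andP[r0 r1].
rewrite lee_fin in j0.
by have := H r (le_lt_trans j0 jr) r0 r1; rewrite lee_fin leNgt jr.
Qed.

Let int_even (g : mR -> \bar R) : measurable_fun setT g -> (forall x, 0 <= g x)%E ->
  (forall x, g (- x)%R = g x) ->
  (\int[mu]_x g x = \int[mu]_(x in `]0%R, +oo[) g x + \int[mu]_(x in `]0%R, +oo[) g x)%E.
Proof.
move=> mg g0 gN.
have mgD D : measurable_fun (D : set mR) g by apply: measurable_funTS.
have P : (\int[mu]_(x in `[0%R, +oo[) g x = \int[mu]_(x in `]0%R, +oo[) g x)%E.
  by apply/esym/integral_itv_obnd_cbnd; exact: mgD.
have N : (\int[mu]_(x in `]-oo, 0%R[) g x = \int[mu]_(x in `]0%R, +oo[) g x)%E.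
  rewrite integral_mkcond [RHS]integral_mkcond (ge0_integral_affine 0 (a := -1)) ?oppr_eq0 ?oner_eq0//; last 2 first.
  - by apply/(measurable_restrictT _ _).1 => //; exact: mgD.
  - by apply: erestrict_ge0.
  rewrite normrN1 mul1e; apply: eq_integral => x _.
  rewrite mulN1r addr0 !epatch_indic/= gN indic_pos indicE mem_setE in_itv/=.
  by rewrite oppr_lt0.
rewrite -{1}(setUv `]-oo, (0:R)[%classic) ge0_integral_setU//.
- by rewrite setCitvl N P.
- exact: measurableC.
- exact/disj_setPCl.
Qed.

Let even_mc t c : m t (- c)%R = m t c.
Proof.
rewrite /m (ge0_integral_affine 0 (a := -1)) ?oppr_eq0 ?oner_eq0//; last first.
  exact: (measurable_fun_pair1 (- c) (mF t)).
rewrite normrN1 mul1e; apply: eq_integral => a _; rewrite /F/=.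
by rewrite mulN1r addr0 mulrN Lev.
Qed.

(** The evenness of L makes the inner integral m t an even function of c, so
    that only c > 0 matters, where z = 1 / c is defined. *)
Theorem busemann_quasi l t0 t1 : 0 < l < 1 ->
  (Order.min (\int[mu2]_q (expR (- L q.1 (t0 * q.2) q.2))%:E) (\int[mu2]_q (expR (- L q.1 (t1 * q.2) q.2))%:E)
   <= \int[mu2]_q (expR (- L q.1 (((1 - l) * t0 + l * t1)%R * q.2) q.2))%:E)%E.
Proof.
move=> l01.
have H t : (\int[mu2]_q (expR (- L q.1 (t * q.2) q.2))%:E = J t + J t)%E.
  rewrite (integral2_swap (mF t) (F0 t)) (int_even (mm t) (m0 t) (even_mc t)).
  have -> // : (\int[mu]_(x in `]0%R, +oo[) m t x = J t)%E.
  rewrite ge0_integral_inv// integral_mkcond epatch_indic; apply: eq_integral => z _ /=.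
  by rewrite /G muleC muleA -EFinM.
rewrite !H.
have := quasi_J t0 t1 l01; rewrite !ge_min => /orP[h|h]; apply/orP; [left|right]; exact: leeD.
Qed.

End slices.
End busemann.

(** * Exponential integrals over the standard simplex *)

Section simplex.
Context {R : realType}.
Local Notation mR := (measurableTypeR R).
Local Notation mu := (@lebesgue_measure R).
Local Notation mu2 := (@lebesgue_measure2 R).

Definition simplex : set (mR * mR) := [set s | [/\ 0 <= s.1, 0 <= s.2 & s.1 + s.2 <= 1]].

Lemma measurable_simplex : measurable simplex.
Proof.
rewrite (_ : simplex = (`[0%R, +oo[%classic `*` `[0%R, +oo[%classic) `&`
   (setT `&` ((fun s : mR * mR => s.1 + s.2 : mR) @^-1` `]-oo, 1%R]%classic))); last first.
  apply/seteqP; split => s /=; rewrite !in_itv/= !andbT; last by case=> -[? ?] [_ ?].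
  by case.
apply: measurableI; first by apply: measurableX; exact: measurable_itv.
by apply: (measurable_funD measurable_fst measurable_snd) => //; exact: measurable_itv.
Qed.

(** The affine function on the simplex with values a, b, c at its vertices. *)
Definition bary (a b c : R) (s : mR * mR) : R := a + s.1 * (b - a) + s.2 * (c - a).

Lemma measurable_bary a b c : measurable_fun setT (bary a b c : mR * mR -> mR).
Proof.
apply: measurable_funD; last exact: measurable_funM.
by apply: measurable_funD => //; exact: measurable_funM.
Qed.

Lemma measurable_exp_bary a b c D : measurable_fun (D : set (mR * mR)) (fun s => (expR (bary a b c s))%:E).
Proof.
apply: measurable_funTS; apply/measurable_EFinP.
exact: measurableT_comp (measurable_bary a b c).
Qed.

Lemma bary_le a b c s : simplex s -> bary a b c s <= `|a| + `|b| + `|c|.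
Proof.
case: s => x y [/= x0 y0 xy]; rewrite /bary/=.
have := ler_norm a; have := ler_norm b; have := ler_norm c.
have := normr_ge0 a; have := normr_ge0 b; have := normr_ge0 c.
set A := `|a|; set B := `|b|; set C := `|c| => *.
have -> : a + x * (b - a) + y * (c - a) = (1 - x - y) * a + x * b + y * c by ring.
have h k K z : 0 <= K -> k <= K -> 0 <= z -> z <= 1 -> z * k <= K :> R by move=> *; nra.
by apply: lerD; [apply: lerD|]; apply: h => //; lra.
Qed.

Lemma integral_simplexE (f : mR * mR -> \bar R) : measurable_fun setT f -> (forall s, 0 <= f s)%E ->
  (\int[mu2]_(s in simplex) f s =
   \int[mu]_(x in `[0%R, 1%R]) \int[mu]_(t in `[0%R, (1 - x)%R]) f (x, t))%E.
Proof.
move=> mf f0; rewrite integral_mkcond epatch_indic.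
have ms : measurable_fun setT (fun s => (\1_simplex s : R)%:E).
  by apply/measurable_EFinP; apply: measurable_indic; exact: measurable_simplex.
rewrite integral2E; [|exact: emeasurable_funM|by move=> s; rewrite mule_ge0// lee_fin].
rewrite [RHS]integral_mkcond epatch_indic; apply: eq_integral => x _/=.
have [x01|x01] := boolP (0 <= x <= 1); last first.
  rewrite indicE memNset; last by rewrite /= in_itv; apply/negP.
  rewrite mule0; apply: integral0_eq => t _; rewrite indicE memNset ?mule0// => -[/= h1 h2 h3].
  by move: x01; rewrite h1/=; lra.
rewrite [X in (_ * X%:E)%E]indicE mem_set; last by rewrite /= in_itv.
have /andP[x0 x1] := x01.
rewrite mule1 [RHS]integral_mkcond epatch_indic; apply: eq_integral => t _/=.
congr (_ * _%:E)%E; apply: eq_indic; rewrite /simplex/= in_itv/=; split.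
  by move=> [h1 h2 h3]; apply/andP; split => //; lra.
by move=> /andP[h1 h2]; split => //; lra.
Qed.

Lemma is_derive_expR_affine (k p x : R) :
  is_derive x (1 : R) (fun x => expR (k * x + p)) (k * expR (k * x + p)).
Proof.
by apply: is_derive_eq; rewrite /GRing.scale/= addr0 mulr1 mulrC.
Qed.

Lemma continuous_expR_affine (k p : R) : continuous (fun x => expR (k * x + p)).
Proof.
move=> x; apply: differentiable_continuous; apply/derivable1_diffP.
by apply: ex_derive; exact: is_derive_expR_affine.
Qed.

Lemma integral_expR_affine (k p L : R) : k != 0 -> 0 <= L ->
  (\int[mu]_(t in `[0%R, L]) (expR (k * t + p))%:E = ((expR (k * L + p) - expR p) / k)%:E)%E.
Proof.
move=> k0; rewrite le_eqVlt => /predU1P[<-|L0].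
  by rewrite set_itv1 integral_set1 mulr0 add0r subrr mul0r.
have dF (t : R) : is_derive t (1 : R) (k^-1 *: (fun x => expR (k * x + p))) (expR (k * t + p)).
  by apply: is_derive_eq; rewrite /GRing.scale/= addr0 mulr1 mulrC mulfK.
rewrite (FTC2 L0 (@continuous_expR_affine k p) dF) /GRing.scale/= mulr0 add0r.
by rewrite -mulrBr mulrC.
Qed.

(** The integral of exp over a triangle at the vertices of which the exponent
    takes the values a, b and c, per unit of determinant. *)
Definition sexp (a b c : R) : R := fine (\int[mu2]_(s in simplex) (expR (bary a b c s))%:E)%E.

Lemma mu2_simplex : mu2 simplex = (2^-1)%:E.
Proof.
transitivity (\int[mu2]_(s in simplex) 1)%E.
  by rewrite integral_cst ?mul1e//; exact: measurable_simplex.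
rewrite integral_simplexE//.
transitivity (\int[mu]_(x in `[0%R, 1%R]) (1 - x)%:E)%E.
  apply: eq_integral => x; rewrite inE/= in_itv/= => /andP[x0 x1].
  rewrite integral_cst//= mul1e lebesgue_measure_itv/= lte_fin.
  by case: ltP => h; rewrite ?oppr0 ?adde0//; congr EFin; lra.
have dF (t : R) : is_derive t (1 : R) (fun x => x - x ^+ 2 / 2) (1 - t).
  apply/is_derive1_caratheodory; exists (fun z => 1 - (z + t) / 2); split.
  - by move=> z; field.
  - apply: cvgB; first exact: cvg_cst.
    by apply: cvgM; [apply: cvgD; [exact: cvg_id|exact: cvg_cst]|exact: cvg_cst].
  - by field.
have cf : continuous (fun x : R => 1 - x).
  by move=> x; apply: cvgB; [exact: cvg_cst|exact: cvg_id].
by rewrite (FTC2 ltr01 cf dF); congr EFin; field.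
Qed.

Lemma sexpE a b c : (\int[mu2]_(s in simplex) (expR (bary a b c s))%:E = (sexp a b c)%:E)%E.
Proof.
rewrite fineK// ge0_fin_numE; last by apply: integral_ge0 => s _; rewrite lee_fin expR_ge0.
apply: (@le_lt_trans _ _ (\int[mu2]_(s in simplex) (expR (`|a| + `|b| + `|c|))%:E)%E).
  apply: ge0_le_integral => //.
  - exact: measurable_simplex.
  - exact: measurable_exp_bary.
  - by move=> s Ss; rewrite lee_fin ler_expR; exact: bary_le.
rewrite integral_cst//; last exact: measurable_simplex.
by rewrite mu2_simplex -EFinM ltry.
Qed.

Lemma sexp000 : sexp 0 0 0 = 2^-1 :> R.
Proof.
apply: EFin_inj; rewrite -sexpE -mu2_simplex.
rewrite (eq_integral (cst 1%E)) ?integral_cst ?mul1e//; first exact: measurable_simplex.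
by move=> s _; rewrite /bary subrr !mulr0 !addr0 expR0.
Qed.

Lemma sexp_gt0 a b c : 0 < sexp a b c.
Proof.
rewrite -lte_fin -sexpE.
apply: (@lt_le_trans _ _ (\int[mu2]_(s in simplex) (expR (- (`|a| + `|b| + `|c|)))%:E)%E); last first.
  apply: ge0_le_integral => //.
  - exact: measurable_simplex.
  - exact: measurable_exp_bary.
  - move=> s Ss; rewrite lee_fin ler_expR.
    have := bary_le (- a) (- b) (- c) Ss; rewrite !normrN /bary => h.
    by rewrite lerNl (le_trans _ h)//; lra.
rewrite integral_cst//; last exact: measurable_simplex.
by rewrite mu2_simplex -EFinM lte_fin mulr_gt0 ?expR_gt0.
Qed.

(** The second divided difference of exp at a, b, c, which is how the integral
    comes out when the values differ. *)
Lemma sexp_closed a b c : a != b -> b != c -> c != a ->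
  sexp a b c = ((expR b - expR c) / (b - c) - (expR b - expR a) / (b - a)) / (c - a).
Proof.
move=> ab bc ca; apply: EFin_inj; rewrite -sexpE integral_simplexE; last 2 first.
- exact: measurable_exp_bary.
- by move=> s; rewrite lee_fin expR_ge0.
have ba0 : b - a != 0 by rewrite subr_eq0 eq_sym.
have bc0 : b - c != 0 by rewrite subr_eq0.
have ca0 : c - a != 0 by rewrite subr_eq0.
transitivity (\int[mu]_(x in `[0%R, 1%R])
   ((c - a)^-1 * (expR ((b - c) * x + c) - expR ((b - a) * x + a)))%:E)%E.
  apply: eq_integral => x; rewrite inE/= in_itv/= => /andP[x0 x1].
  rewrite -[LHS](_ : \int[mu]_(t in `[0%R, (1 - x)%R]) (expR ((c - a) * t + ((b - a) * x + a)))%:E = _)%E; last first.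
    by apply: eq_integral => t _; rewrite /bary/=; congr (expR _)%:E; ring.
  rewrite integral_expR_affine//; last lra.
  rewrite mulrC; congr ((_ * (expR _ - _))%:E); ring.
pose F1 := (c - a)^-1 *: ((b - c)^-1 *: (fun x => expR ((b - c) * x + c)) - (b - a)^-1 *: (fun x => expR ((b - a) * x + a))).
have dF (t : R) : is_derive t (1 : R) F1 ((c - a)^-1 * (expR ((b - c) * t + c) - expR ((b - a) * t + a))).
  apply: is_derive_eq; rewrite /GRing.scale/= !addr0 !mulr1.
  by rewrite ![_^-1 * (expR _ * _)]mulrC !mulfK.
have cf : continuous (fun x : R => (c - a)^-1 * (expR ((b - c) * x + c) - expR ((b - a) * x + a))).
  move=> x; apply: cvgM; first exact: cvg_cst.
  by apply: cvgB; exact: continuous_expR_affine.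
rewrite (FTC2 ltr01 cf dF) /F1/=; congr EFin.
rewrite !fctE /GRing.scale/= !mulr1 !mulr0 !subrK !add0r.
by field; rewrite ca0 bc0 ba0.
Qed.

(** The parameter k makes this family of linear inequalities equivalent to
    log-convexity, by optimising over k, and linear inequalities add up: sums and
    integrals of functions with this property have it too. With the geometric
    mean on the right, each of these steps would require Hoelder's inequality. *)
Lemma expR_logconvex (l k u v : R) : 0 <= l <= 1 ->
  expR ((1 - l) * u + l * v) <= (1 - l) * expR (l * k) * expR u + l * expR (- ((1 - l) * k)) * expR v.
Proof.
move=> l01; have := expR_convex (u + l * k) (v - (1 - l) * k) l01.
have -> : (1 - l) * (u + l * k) + l * (v - (1 - l) * k) = (1 - l) * u + l * v by ring.
by rewrite [expR (u + _)]expRD [expR (v - _)]expRD; rewrite -!mulrA [expR u * _]mulrC [expR v * _]mulrC.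
Qed.

Lemma sexp_logconvex (l k a b c a' b' c' : R) : 0 <= l <= 1 ->
  sexp ((1 - l) * a + l * a') ((1 - l) * b + l * b') ((1 - l) * c + l * c') <=
  (1 - l) * expR (l * k) * sexp a b c + l * expR (- ((1 - l) * k)) * sexp a' b' c'.
Proof.
move=> l01; have /andP[l0 l1] := l01; rewrite -lee_fin EFinD !(EFinM _ (sexp _ _ _)) -!sexpE.
have p1 : 0 <= (1 - l) * expR (l * k) by rewrite mulr_ge0 ?expR_ge0 ?subr_ge0.
have p2 : 0 <= l * expR (- ((1 - l) * k)) by rewrite mulr_ge0 ?expR_ge0.
have ms := measurable_simplex.
have e0 a1 b1 c1 s : simplex s -> (0 <= (expR (bary a1 b1 c1 s))%:E)%E by rewrite lee_fin expR_ge0.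
have me a1 b1 c1 := @measurable_exp_bary a1 b1 c1 simplex.
rewrite -!ge0_integralZl//.
rewrite -ge0_integralD//.
- apply: ge0_le_integral => //.
  + by apply: emeasurable_funD; apply: emeasurable_funM => //.
  + move=> s _; rewrite -!EFinM -EFinD lee_fin.
    apply: le_trans (expR_logconvex k _ _ l01); rewrite ler_expR /bary.
    by rewrite le_eqVlt; apply/orP; left; apply/eqP; ring.
- by move=> s _; rewrite mule_ge0// lee_fin expR_ge0.
- by apply: emeasurable_funM.
- by move=> s _; rewrite mule_ge0// lee_fin expR_ge0.
- by apply: emeasurable_funM.
Qed.

Lemma measurable_sexp d (T : measurableType d) (a b c : T -> mR) :
  measurable_fun setT a -> measurable_fun setT b -> measurable_fun setT c ->
  measurable_fun setT (fun y => sexp (a y) (b y) (c y) : mR).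
Proof.
move=> ma mb mc.
pose F (q : T * mR * mR) : \bar R :=
  ((\1_simplex (q.1.2, q.2))%:E * (expR (bary (a q.1.1) (b q.1.1) (c q.1.1) (q.1.2, q.2)))%:E)%E.
have F0 q : (0 <= F q)%E by rewrite mule_ge0// lee_fin ?expR_ge0.
have m11 : measurable_fun setT (fun q : T * mR * mR => q.1.1) by exact: measurableT_comp.
have m12 : measurable_fun setT (fun q : T * mR * mR => q.1.2) by exact: measurableT_comp.
have mF : measurable_fun setT F.
  apply: emeasurable_funM; apply/measurable_EFinP.
    apply: (measurableT_comp (measurable_indic measurable_simplex : measurable_fun setT (\1_simplex : mR * mR -> mR))).
    exact: measurable_fun_pair.
  apply: measurableT_comp => //; rewrite /bary/=.
  have ma' := measurableT_comp ma m11; have mb' := measurableT_comp mb m11.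
  have mc' := measurableT_comp mc m11.
  apply: measurable_funD; last by apply: measurable_funM => //; exact: measurable_funB.
  by apply: measurable_funD => //; apply: measurable_funM => //; exact: measurable_funB.
have mG : measurable_fun setT (fun y : T * mR => \int[mu]_t F (y, t))%E.
  exact: (measurable_fun_fubini_tonelli_F F mF F0).
have G0 (y : T * mR) : (0 <= \int[mu]_t F (y, t))%E by exact: integral_ge0.
have mH : measurable_fun setT (fun y : T => \int[mu]_x \int[mu]_t F ((y, x), t))%E.
  exact: (measurable_fun_fubini_tonelli_F (fun y : T * mR => \int[mu]_t F (y, t))%E mG G0).
rewrite (_ : (fun y => _) = fine \o (fun y => \int[mu]_x \int[mu]_t F ((y, x), t))%E); last first.
  apply/funext => y /=; rewrite /sexp integral_mkcond epatch_indic; congr fine.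
  rewrite integral2E.
  - apply: eq_integral => x _; apply: eq_integral => t _; exact: muleC.
  - apply: emeasurable_funM; first exact: measurable_exp_bary.
    by apply/measurable_EFinP; apply: measurable_indic; exact: measurable_simplex.
  - by move=> s; rewrite mule_ge0// lee_fin ?expR_ge0.
exact: measurableT_comp.
Qed.

End simplex.

(** * Symmetric polygons as lists of edges *)

Section polygon.
Context {R : realType}.
Local Notation mR := (measurableTypeR R).
Local Notation mu := (@lebesgue_measure R).
Local Notation mu2 := (@lebesgue_measure2 R).
Implicit Types (u v w d e P y : R * R) (ds : seq (R * R)).

Definition sc (k : R) u : R * R := (k * u.1, k * u.2).

Fixpoint vsum ds : R * R := if ds is d :: ds' then d + vsum ds' else 0.

(** The vertex between the edges already met, with sum P, and the edges ds yet to
    come before the opposite of the first vertex: since the last vertex is minus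
    the first one, the first is minus half the sum of all edges. *)
Definition vert P ds : R * R := sc 2^-1 (P - vsum ds).

(** Sum of D over the pairs of consecutive vertices along half the boundary; for
    an even D this is half of the sum over the boundary. *)
Fixpoint chain (D : R * R -> R * R -> R) P ds : R :=
  if ds is d :: ds' then D (vert P ds) (vert (P + d) ds') + chain D (P + d) ds' else 0.

(** All pairs are compared, not only consecutive ones: the edges make less than
    half a turn. *)
Definition ccw ds : bool := pairwise (fun d e => 0 < det d e) ds.

Lemma pairP u v : u.1 = v.1 -> u.2 = v.2 -> u = v.
Proof. by case: u v => [a b] [c d] /= -> ->. Qed.

Lemma detC u v : det u v = - det v u. Proof. by rewrite /det; ring. Qed.
Lemma detDl u v w : det (u + v) w = det u w + det v w.
Proof. by case: u v w => [a b] [c d] [e f]; rewrite /det/=; ring. Qed.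
Lemma detDr u v w : det u (v + w) = det u v + det u w.
Proof. by case: u v w => [a b] [c d] [e f]; rewrite /det/=; ring. Qed.
Lemma detNl u v : det (- u) v = - det u v.
Proof. by case: u v => [a b] [c d]; rewrite /det/=; ring. Qed.
Lemma detNr u v : det u (- v) = - det u v.
Proof. by case: u v => [a b] [c d]; rewrite /det/=; ring. Qed.
Lemma detZl k u v : det (sc k u) v = k * det u v.
Proof. by case: u v => [a b] [c d]; rewrite /det/=; ring. Qed.
Lemma detZr k u v : det u (sc k v) = k * det u v.
Proof. by case: u v => [a b] [c d]; rewrite /det/=; ring. Qed.
Lemma detxx u : det u u = 0. Proof. by rewrite /det; ring. Qed.
Lemma det0l u : det 0 u = 0. Proof. by rewrite /det/= !mul0r subrr. Qed.
Lemma det0r u : det u 0 = 0. Proof. by rewrite /det/= !mulr0 subrr. Qed.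

Lemma vert_cons P d ds : vert (P + d) ds = vert P (d :: ds) + d.
Proof.
rewrite /vert/=; case: P d (vsum ds) => [a b] [c e] [f g]; rewrite /sc/=.
by congr (_, _); rewrite /=; field.
Qed.

Lemma det_vert P d ds : det (vert P (d :: ds)) (vert (P + d) ds) =
  2^-1 * (det P d + det d (vsum ds)).
Proof.
by rewrite vert_cons detDr detxx add0r /vert/= detZl detDl detNl detDl detxx add0r (detC (vsum ds)) opprK.
Qed.

Lemma det_vsum_ge0 d ds : all (fun e => 0 < det d e) ds -> 0 <= det d (vsum ds).
Proof.
elim: ds => [|e ds IH] /=; first by rewrite det0r.
by move=> /andP[de /IH]; rewrite detDr => h; rewrite addr_ge0// ltW.
Qed.

Lemma vsum_rcons ds e : vsum (rcons ds e) = vsum ds + e.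
Proof. by elim: ds => [|d ds IH] /=; rewrite ?add0r ?addr0// IH addrA. Qed.

Lemma chain_rcons D P ds e : chain D P (rcons ds e) =
  chain D (P - e) ds + D (sc 2^-1 (P + vsum ds - e)) (sc 2^-1 (P + vsum ds + e)).
Proof.
elim: ds P => [|d ds IH] P /=.
  rewrite addr0 add0r /vert/=; by congr (D _ _); apply: pairP => /=; field.
rewrite IH /vert/= !vsum_rcons addrA; congr (D _ _ + chain _ _ _ + D _ _);
  by apply: pairP => /=; ring.
Qed.

Definition evenD (D : R * R -> R * R -> R) := forall u v, D (- u) (- v) = D u v.

(** The same symmetric polygon, read from its second vertex on. *)
Lemma chain_rotate D d ds : evenD D ->
  chain D 0 (rcons ds (- d)) = chain D 0 (d :: ds).
Proof.
move=> De; rewrite chain_rcons /= opprK !add0r addrC; congr (_ + _).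
rewrite -[RHS]De; congr (D _ _); rewrite /vert/=.
  by apply: pairP => /=; field.
by apply: pairP => /=; field.
Qed.

Section exponential.
Variables (p : R).
Hypothesis p0 : 0 < p.

Definition pd u y : R := p * dotp u y.

Lemma pdDl u v y : pd (u + v) y = pd u y + pd v y.
Proof. by rewrite /pd /dotp/=; ring. Qed.
Lemma pdNl u y : pd (- u) y = - pd u y. Proof. by rewrite /pd /dotp/=; ring. Qed.
Lemma pdNr u y : pd u (- y) = - pd u y. Proof. by rewrite /pd /dotp/=; ring. Qed.
Lemma pdZl k u y : pd (sc k u) y = k * pd u y. Proof. by rewrite /pd /dotp/=; ring. Qed.
Lemma pd0l y : pd 0 y = 0. Proof. by rewrite /pd /dotp/=; ring. Qed.

(** The two terms come from a triangle and its opposite. *)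
Definition evexp a b c : R := sexp a b c + sexp (- a) (- b) (- c).
Definition tri_exp u v w y : R := evexp (pd u y) (pd v y) (pd w y).
(** The integral of exp(p <x, y>) over the triangle 0, u, v and its opposite. *)
Definition cone_exp y u v : R := det u v * tri_exp 0 u v y.

Lemma cone_exp_even y : evenD (cone_exp y).
Proof.
move=> u v; rewrite /cone_exp detNl detNr opprK /tri_exp /evexp pd0l !pdNl !opprK oppr0.
by congr (_ * _); exact: addrC.
Qed.
Lemma det_even : evenD det.
Proof. by move=> u v; rewrite detNl detNr opprK. Qed.

(** Each triangle 0, u, v has area det u v / 2 and occurs with its opposite. *)
Definition parea ds : R := chain det 0 ds.
Definition pexp ds y : R := chain (cone_exp y) 0 ds.
Definition pmahler ds : \bar R :=
  ((parea ds)%:E * \int[mu2]_y (expR (- (p^-1 * ln (pexp ds y / parea ds))))%:E)%E.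

Lemma evexp_gt0 a b c : 0 < evexp a b c.
Proof. by rewrite addr_gt0// sexp_gt0. Qed.

Lemma pd0r u : pd u 0 = 0. Proof. by rewrite /pd /dotp/=; ring. Qed.

Lemma parea_pexp ds : parea ds = pexp ds 0.
Proof.
rewrite /parea /pexp; elim: ds {1 3}0 => //= d ds IH P; rewrite -IH; congr (_ + _).
set u := vert _ _; set v := vert _ _.
by rewrite /cone_exp /tri_exp pd0l !pd0r /evexp oppr0 sexp000 -[_ + _]mulr2n -[_ *+ 2]mulr_natr mulVf ?pnatr_eq0// mulr1.
Qed.

Lemma evexpN a b c : evexp (- a) (- b) (- c) = evexp a b c.
Proof. by rewrite /evexp !opprK addrC. Qed.

Lemma evexp_logconvex (l k a b c a' b' c' : R) : 0 <= l <= 1 ->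
  evexp ((1 - l) * a + l * a') ((1 - l) * b + l * b') ((1 - l) * c + l * c') <=
  (1 - l) * expR (l * k) * evexp a b c + l * expR (- ((1 - l) * k)) * evexp a' b' c'.
Proof.
move=> l01; rewrite /evexp !mulrDr addrACA; apply: lerD; first exact: sexp_logconvex.
have e x x' : - ((1 - l) * x + l * x') = (1 - l) * - x + l * - x' by ring.
by rewrite !e; exact: sexp_logconvex.
Qed.

Lemma measurable_pd u : measurable_fun setT (pd u : mR * mR -> mR).
Proof.
apply: measurable_funM => //; apply: measurable_funD; exact: measurable_funM.
Qed.

Lemma measurable_evexp (disp : measure_display) (T : measurableType disp) (a b c : T -> mR) :
  measurable_fun setT a -> measurable_fun setT b -> measurable_fun setT c ->
  measurable_fun setT (fun z => evexp (a z) (b z) (c z) : mR).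
Proof.
move=> ma mb mc; apply: measurable_funD; first exact: measurable_sexp.
by apply: measurable_sexp; exact: measurableT_comp.
Qed.

Lemma measurable_tri_exp u v w : measurable_fun setT (tri_exp u v w : mR * mR -> mR).
Proof. by apply: measurable_evexp; exact: measurable_pd. Qed.

Lemma measurable_chain P ds : measurable_fun setT (fun y : mR * mR => chain (cone_exp y) P ds : mR).
Proof.
elim: ds P => [|d ds IH] P /=; first exact: measurable_cst.
by apply: measurable_funD; [apply: measurable_funM => //; exact: measurable_tri_exp|exact: IH].
Qed.

Definition generic u v w y := [/\ pd u y != 0, pd v y != 0 & pd w y != 0] /\
  [/\ pd u y != pd v y, pd v y != pd w y & pd w y != pd u y].

(** The quadrilateral 0, u, v, w is cut along either of its diagonals. Away
    from the lines where two exponents coincide, this is an identity between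
    divided differences of exp and only requires the Pluecker relation between
    the three exponents; it avoids integrating over four-sided regions. *)
Lemma split_cone u v w y : generic u v w y ->
  cone_exp y u v + cone_exp y v w = cone_exp y u w + det (v - u) (w - u) * tri_exp u v w y.
Proof.
move=> [[a0 b0 c0] [ab bc ca]].
have plu : pd u y * det v w - pd v y * det u w + pd w y * det u v = 0.
  by rewrite /pd /dotp /det; ring.
have -> : det (v - u) (w - u) = det u v + det v w - det u w by rewrite /det/=; ring.
rewrite /cone_exp /tri_exp /evexp pd0l !mulrDr oppr0.
suff K (a b c A B C : R) : a != 0 -> b != 0 -> c != 0 -> a != b -> b != c -> c != a ->
    a * B - b * C + c * A = 0 ->
    A * sexp 0 a b + B * sexp 0 b c = C * sexp 0 a c + (A + B - C) * sexp a b c.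
  have h1 := K _ _ _ _ _ _ a0 b0 c0 ab bc ca plu.
  have h2 : det u v * sexp 0 (- pd u y) (- pd v y) + det v w * sexp 0 (- pd v y) (- pd w y) =
     det u w * sexp 0 (- pd u y) (- pd w y) +
     (det u v + det v w - det u w) * sexp (- pd u y) (- pd v y) (- pd w y).
    apply: K; rewrite ?oppr_eq0 ?eqr_opp// -?[RHS]oppr0 -?plu; ring.
  by apply: etrans (addrACA _ _ _ _) _; rewrite h1 h2; exact: addrACA.
move=> {}a0 {}b0 {}c0 {}ab {}bc {}ca {}plu.
rewrite !sexp_closed//; try by rewrite eq_sym.
rewrite expR0.
have ab' : a - b != 0 by rewrite subr_eq0.
have bc' : b - c != 0 by rewrite subr_eq0.
have ca' : c - a != 0 by rewrite subr_eq0.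
have ba' : b - a != 0 by rewrite subr_eq0 eq_sym.
have ac' : a - c != 0 by rewrite subr_eq0 eq_sym.
have eC : C = (a * B + c * A) / b.
  by apply: (mulIf b0); rewrite divfK//; lra.
rewrite eC; field; rewrite ?ab' ?bc' ?ca' ?ba' ?ac' ?a0 ?b0 ?c0 //.
Qed.

Lemma line_pd_null u : u != 0 -> mu2.-negligible [set y | pd u y = 0].
Proof.
move=> u0; exists (oline u.1 u.2); split.
- exact: measurable_oline.
- by apply: oline_null; case: u u0.
- move=> y /= /eqP; rewrite /pd mulf_eq0 gt_eqF//= => /eqP; exact.
Qed.

Lemma ae_generic u v w : u != 0 -> v != 0 -> w != 0 -> u != v -> v != w -> w != u ->
  {ae mu2, forall y, generic u v w y}.
Proof.
move=> u0 v0 w0 uv vw wu.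
have H x z : x != z -> mu2.-negligible [set y | pd x y = pd z y].
  move=> xz; have xz0 : x - z != 0 by rewrite subr_eq0.
  apply: negligibleS (line_pd_null xz0) => y /= e.
  by rewrite pdDl pdNl e subrr.
have := negligibleU (negligibleU (line_pd_null u0) (negligibleU (line_pd_null v0) (line_pd_null w0)))
  (negligibleU (H _ _ uv) (negligibleU (H _ _ vw) (H _ _ wu))).
apply: negligibleS => y /= ng; apply: contrapT => ny; apply: ng.
by split; split; apply/eqP => e; apply: ny; tauto.
Qed.

Lemma pmahler_ae (A B : R * R -> R) (a : R) :
  measurable_fun setT (A : mR * mR -> mR) -> measurable_fun setT (B : mR * mR -> mR) ->
  {ae mu2, forall y, A y = B y} ->
  (\int[mu2]_y (expR (- (p^-1 * ln (A y / a))))%:E =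
   \int[mu2]_y (expR (- (p^-1 * ln (B y / a))))%:E)%E.
Proof.
move=> mA mB AB; apply: ge0_ae_eq_integral => //.
- apply/measurable_EFinP; apply: measurableT_comp => //; apply: measurableT_comp => //.
  by apply: measurable_funM => //; apply: measurableT_comp => //; apply: measurable_funM.
- apply/measurable_EFinP; apply: measurableT_comp => //; apply: measurableT_comp => //.
  by apply: measurable_funM => //; apply: measurableT_comp => //; apply: measurable_funM.
- move: AB; apply: negligibleS => y /=; apply: contra_not => e _.
  by rewrite e.
Qed.

End exponential.
End polygon.

(** * Quasi-concavity along the motion of a vertex *)

Section integral_ln.
Context {R : realType}.
Local Notation mR := (measurableTypeR R).
Local Notation mu2 := (@lebesgue_measure2 R).

Lemma measurable_exp_ln (A : mR * mR -> mR) (q a : R) : measurable_fun setT A ->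
  measurable_fun setT (fun y => (expR (- (q * ln (A y / a))))%:E).
Proof.
move=> mA; apply/measurable_EFinP; apply: measurableT_comp => //; apply: measurableT_comp => //.
by apply: measurable_funM => //; apply: measurableT_comp => //; exact: measurable_funM.
Qed.

Lemma integral_lcomb_ln (A A' : mR * mR -> mR) (q a k : R) (u v : R * R) : measurable_fun setT A ->
  det u v != 0 -> `|det u v| = k -> (forall s, A (lcomb u v s) = A' s) ->
  (\int[mu2]_y (expR (- (q * ln (A y / a))))%:E =
   k%:E * \int[mu2]_s (expR (- (q * ln (A' s / a))))%:E)%E.
Proof.
move=> mA uv <- AA'; rewrite (ge0_integral_lcomb (measurable_exp_ln q a mA) _ uv).
  by congr (_ * _)%E; apply: eq_integral => s _; rewrite AA'.
by move=> y; rewrite lee_fin expR_ge0.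
Qed.

End integral_ln.

Section busemann_ln.
Context {R : realType}.
Local Notation mR := (measurableTypeR R).
Local Notation mu2 := (@lebesgue_measure2 R).

(** The optimal choice k = ln X' - ln X makes both exponentials equal. *)
Lemma ln_le_of_logconvex (X X' Z l : R) : 0 < X -> 0 < X' -> 0 < Z ->
  (forall k, Z <= (1 - l) * expR (l * k) * X + l * expR (- ((1 - l) * k)) * X') ->
  ln Z <= (1 - l) * ln X + l * ln X'.
Proof.
move=> X0 X'0 Z0 /(_ (ln X' - ln X)).
rewrite -[in X in _ <= X -> _](lnK (x := X)) ?posrE// -[in X in _ <= X -> _](lnK (x := X')) ?posrE//.
rewrite !expRK.
rewrite -![_ * expR _ * expR _]mulrA -!expRD.
have -> : l * (ln X' - ln X) + ln X = (1 - l) * ln X + l * ln X' by ring.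
have -> : - ((1 - l) * (ln X' - ln X)) + ln X' = (1 - l) * ln X + l * ln X' by ring.
by rewrite -mulrDl subrK mul1r -{1}(lnK (x := Z)) ?posrE// ler_expR.
Qed.

Variables (q a : R) (B : R -> R -> R -> R).
Hypothesis q0 : 0 < q.
Hypothesis a0 : 0 < a.
Hypothesis B0 : forall x b c, 0 < B x b c.
Hypothesis Bcvx : forall l k x b c x' b' c', 0 <= l <= 1 ->
  B ((1 - l) * x + l * x') ((1 - l) * b + l * b') ((1 - l) * c + l * c') <=
  (1 - l) * expR (l * k) * B x b c + l * expR (- ((1 - l) * k)) * B x' b' c'.
Hypothesis Bev : forall x b c, B (- x) (- b) (- c) = B x b c.
Hypothesis mB : forall t, measurable_fun setT (fun s : mR * mR => B s.1 (t * s.2) s.2 : mR).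

Let L (x b c : R) : R := q * ln (B x b c / a).

Let L_convex (l x b c x' b' c' : R) : 0 <= l <= 1 ->
  L ((1 - l) * x + l * x') ((1 - l) * b + l * b') ((1 - l) * c + l * c') <=
  (1 - l) * L x b c + l * L x' b' c'.
Proof.
move=> l01; rewrite /L ![_ * (q * _)]mulrCA -mulrDr ler_pM2l//.
have ia : 0 < a^-1 by rewrite invr_gt0.
rewrite (lnM (B0 _ _ _) ia) (lnM (B0 x b c) ia) (lnM (B0 x' b' c') ia).
have := ln_le_of_logconvex (B0 x b c) (B0 x' b' c') (B0 _ _ _)
  (fun k => Bcvx k x b c x' b' c' l01).
lra.
Qed.

Let mL t : measurable_fun setT (fun s : mR * mR => L s.1 (t * s.2) s.2 : mR).
Proof.
apply: measurable_funM => //; apply: measurableT_comp => //.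
by apply: measurable_funM => //; exact: mB.
Qed.

Lemma busemann_ln (l t0 t1 : R) : 0 < l < 1 ->
  (Order.min (\int[mu2]_s (expR (- (q * ln (B s.1 (t0 * s.2) s.2 / a))))%:E)
             (\int[mu2]_s (expR (- (q * ln (B s.1 (t1 * s.2) s.2 / a))))%:E)
   <= \int[mu2]_s (expR (- (q * ln (B s.1 (((1 - l) * t0 + l * t1)%R * s.2) s.2 / a))))%:E)%E.
Proof.
apply: (@busemann_quasi R L L_convex _ mL).
by move=> x b c; rewrite /L Bev.
Qed.

End busemann_ln.

Section moves.
Context {R : realType}.
Local Notation mR := (measurableTypeR R).
Local Notation mu2 := (@lebesgue_measure2 R).
Implicit Types (u v w d e P y : R * R) (ds : seq (R * R)).
Variables (p : R).
Hypothesis p0 : 0 < p.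
Local Notation pd := (pd p).
Local Notation cone_exp := (cone_exp p).
Local Notation tri_exp := (tri_exp p).
Local Opaque evexp.

Lemma comb_add3 (A B d f1 f2 f3 g1 g2 g3 : R) :
  (A * f1 + B * g1) + d * (A * f2 + B * g2) + (A * f3 + B * g3) =
  A * ((f1 + d * f2) + f3) + B * ((g1 + d * g2) + g3).
Proof. by ring. Qed.

Lemma cone_exp_opp y u v : cone_exp (- y) u v = cone_exp y u v.
Proof. by rewrite /cone_exp /tri_exp !pdNr evexpN. Qed.

Definition cmb (l : R) y y' : R * R := sc (1 - l) y + sc l y'.

Lemma pd_cmb l u y y' : pd u (cmb l y y') = (1 - l) * pd u y + l * pd u y'.
Proof. by rewrite /pd /dotp/=; ring. Qed.

Lemma lcomb_cmb u v l y y' : lcomb u v (cmb l y y') = cmb l (lcomb u v y) (lcomb u v y').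
Proof. by apply: pairP => /=; ring. Qed.

(** Log-convexity in the form that is stable under sums, see expR_logconvex. *)
Definition logconvex (f : R * R -> R) := forall (l k : R) y y', 0 <= l <= 1 ->
  f (cmb l y y') <= (1 - l) * expR (l * k) * f y + l * expR (- ((1 - l) * k)) * f y'.

Lemma cone_exp_logconvex u v : 0 <= det u v -> logconvex (fun y => cone_exp y u v).
Proof.
move=> uv l k y y' l01; rewrite /cone_exp /tri_exp !pd_cmb !pd0l.
have := evexp_logconvex k 0 (pd u y) (pd v y) 0 (pd u y') (pd v y') l01.
rewrite !mulr0 addr0 => h; apply: le_trans (ler_wpM2l uv h) _.
by rewrite le_eqVlt; apply/orP; left; apply/eqP; ring.
Qed.

Lemma logconvexD f g : logconvex f -> logconvex g -> logconvex (fun y => f y + g y).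
Proof.
move=> hf hg l k y y' l01; apply: le_trans (lerD (hf _ k _ _ l01) (hg _ k _ _ l01)) _.
by rewrite le_eqVlt; apply/orP; left; apply/eqP; ring.
Qed.

Definition nonneg_from P ds := all (fun d => 0 <= det P d) ds.

Lemma det_vert_ge0 P d ds : ccw (d :: ds) -> nonneg_from P (d :: ds) ->
  0 <= det (vert P (d :: ds)) (vert (P + d) ds).
Proof.
move=> /= /andP[h _] /= /andP[Pd _]; rewrite det_vert mulr_ge0//.
by rewrite addr_ge0// det_vsum_ge0.
Qed.

Lemma nonneg_fromS P d ds : ccw (d :: ds) -> nonneg_from P (d :: ds) -> nonneg_from (P + d) ds.
Proof.
move=> /= /andP[h _] /= /andP[_ h']; apply/allP => e eds.
by rewrite detDl addr_ge0//; [exact: (allP h')|rewrite ltW//; exact: (allP h)].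
Qed.

Lemma ccwS d ds : ccw (d :: ds) -> ccw ds. Proof. by case/andP. Qed.

Lemma chain_logconvex P ds : ccw ds -> nonneg_from P ds ->
  logconvex (fun y => chain (cone_exp y) P ds).
Proof.
elim: ds P => [|d ds IH] P cc nn /=.
  by move=> l k y y' _; rewrite !mulr0 addr0.
apply: logconvexD; first by apply: cone_exp_logconvex; exact: det_vert_ge0.
by apply: IH; [exact: ccwS cc|exact: nonneg_fromS cc nn].
Qed.

Lemma chain_cone_exp_ge0 P ds y : ccw ds -> nonneg_from P ds -> 0 <= chain (cone_exp y) P ds.
Proof.
elim: ds P => [|d ds IH] P cc nn //=.
rewrite addr_ge0//; first by rewrite mulr_ge0 ?det_vert_ge0// ltW// evexp_gt0.
by apply: IH; [exact: ccwS cc|exact: nonneg_fromS cc nn].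
Qed.

Lemma chain_even y P ds : chain (cone_exp (- y)) P ds = chain (cone_exp y) P ds.
Proof.
have E : cone_exp (- y) = cone_exp y.
  by apply/funext => u; apply/funext => v; exact: cone_exp_opp.
by rewrite E.
Qed.

(** The exponential integral of the polygon when its vertex w1 has been moved to
    w1 + t v: the triangle w0, w1, w2, of constant determinant dl, is the only
    part that depends on t. *)
Section family.
Variables (w0 w1 w2 v P : R * R) (ds : seq (R * R)) (dl a : R).
Hypothesis hw : 0 <= det w0 w2.
Hypothesis dl0 : 0 < dl.
Hypothesis a0 : 0 < a.
Hypothesis v0 : v != 0.
Hypothesis cc : ccw ds.
Hypothesis nn : nonneg_from P ds.

Definition family (t : R) y : R :=
  (cone_exp y w0 w2 + dl * evexp (pd w0 y) (pd w1 y + t * pd v y) (pd w2 y)) + chain (cone_exp y) P ds.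

Let n2 : R := v.1 ^+ 2 + v.2 ^+ 2.
Let n20 : 0 < n2.
Proof.
rewrite lt_neqAle addr_ge0 ?sqr_ge0// andbT eq_sym paddr_eq0 ?sqr_ge0// !sqrf_eq0.
by apply: contra v0 => /andP[/eqP h1 /eqP h2]; apply/eqP/pairP.
Qed.
(** Together with v', coordinates in which p <v, y> is the second one. *)
Let u' : R * R := (- v.2, v.1).
Let v' : R * R := sc (p * n2)^-1 v.

Let pdu : pd v u' = 0.
Proof. by rewrite /pd /dotp/=; ring. Qed.
Let pdv : pd v v' = 1.
Proof.
rewrite /pd /dotp/= !mulrA ![_ * (p * n2)^-1]mulrC -!mulrA.
have -> : (p * n2)^-1 * (v.1 * v.1) + (p * n2)^-1 * (v.2 * v.2) = (p * n2)^-1 * n2 by rewrite /n2; ring.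
by field; rewrite !gt_eqF.
Qed.

Let Y (a c : R) : R * R := lcomb u' v' (a, c).
Let pdY b c : pd v (Y b c) = c.
Proof.
have -> : pd v (Y b c) = b * pd v u' + c * pd v v' by rewrite /pd/dotp/=; ring.
by rewrite pdu pdv mulr0 add0r mulr1.
Qed.

(** With b in the place of t c, family t is B in the coordinates given by u' and
    v'. As a function of the three variables x, b, c it is log-convex. *)
Let B (x b c : R) : R :=
  (cone_exp (Y x c) w0 w2 + dl * evexp (pd w0 (Y x c)) (pd w1 (Y x c) + b) (pd w2 (Y x c)))
  + chain (cone_exp (Y x c)) P ds.

Let B_gt0 x b c : 0 < B x b c.
Proof.
rewrite ltr_pwDl ?chain_cone_exp_ge0// ltr_wpDl ?mulr_gt0 ?evexp_gt0//.
by rewrite mulr_ge0// ltW// evexp_gt0.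
Qed.

Let Ycmb l (x c x' c' : R) : Y ((1 - l) * x + l * x') ((1 - l) * c + l * c') = cmb l (Y x c) (Y x' c').
Proof. by rewrite /Y -lcomb_cmb. Qed.

Let B_logconvex l k x b c x' b' c' : 0 <= l <= 1 ->
  B ((1 - l) * x + l * x') ((1 - l) * b + l * b') ((1 - l) * c + l * c') <=
  (1 - l) * expR (l * k) * B x b c + l * expR (- ((1 - l) * k)) * B x' b' c'.
Proof.
move=> l01; rewrite /B Ycmb.
have h1 := cone_exp_logconvex hw k (Y x c) (Y x' c') l01.
have h2 := chain_logconvex cc nn k (Y x c) (Y x' c') l01.
have h3 := evexp_logconvex k (pd w0 (Y x c)) (pd w1 (Y x c) + b) (pd w2 (Y x c))
  (pd w0 (Y x' c')) (pd w1 (Y x' c') + b') (pd w2 (Y x' c')) l01.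
have h4 := lerD (lerD h1 (ler_wpM2l (ltW dl0) h3)) h2.
rewrite !pd_cmb.
have -> : (1 - l) * pd w1 (Y x c) + l * pd w1 (Y x' c') + ((1 - l) * b + l * b') =
  (1 - l) * (pd w1 (Y x c) + b) + l * (pd w1 (Y x' c') + b') by ring.
by rewrite comb_add3 in h4; exact: h4.
Qed.

Let B_even x b c : B (- x) (- b) (- c) = B x b c.
Proof.
have e : Y (- x) (- c) = - Y x c by apply: pairP => /=; ring.
by rewrite /B e chain_even !pdNr -opprD evexpN cone_exp_opp.
Qed.

Let mpdY w : measurable_fun setT (fun q : mR * mR => pd w (Y q.1 q.2) : mR).
Proof.
rewrite (_ : (fun q => _) = (pd w \o lcomb u' v')); last by apply/funext => -[].
exact: (measurableT_comp (measurable_pd p w) (measurable_lcomb u' v')).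
Qed.

Let mB t : measurable_fun setT (fun q : mR * mR => B q.1 (t * q.2) q.2 : mR).
Proof.
apply: measurable_funD; first apply: measurable_funD.
- by apply: measurable_funM => //; apply: measurable_evexp; exact: mpdY.
- apply: measurable_funM => //; apply: measurable_evexp; [exact: mpdY| |exact: mpdY].
  by apply: measurable_funD; [exact: mpdY|exact: measurable_funM].
- rewrite (_ : (fun q => _) = (fun y => chain (cone_exp y) P ds) \o lcomb u' v'); last by apply/funext => -[].
  exact: (measurableT_comp (measurable_chain p P ds) (measurable_lcomb u' v')).
Qed.

Lemma measurable_family t : measurable_fun setT (family t : mR * mR -> mR).
Proof.
apply: measurable_funD; last exact: measurable_chain.
apply: measurable_funD.
  by apply: measurable_funM => //; apply: measurable_evexp; exact: measurable_pd.
apply: measurable_funM => //; apply: measurable_evexp; [exact: measurable_pd| |exact: measurable_pd].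
by apply: measurable_funD; [|apply: measurable_funM => //]; exact: measurable_pd.
Qed.

Definition family_integral t : \bar R := (\int[mu2]_y (expR (- (p^-1 * ln (family t y / a))))%:E)%E.

Let det_uv : det u' v' = - p^-1.
Proof.
rewrite detZr /det/=; have -> : - v.2 * v.2 - v.1 * v.1 = - n2 by rewrite /n2; ring.
by field; rewrite !gt_eqF.
Qed.

Let fintE t : (family_integral t =
  p^-1%:E * \int[mu2]_s (expR (- (p^-1 * ln (B s.1 (t * s.2) s.2 / a))))%:E)%E.
Proof.
have nz : det u' v' != 0 by rewrite det_uv oppr_eq0 invr_eq0 gt_eqF.
apply: (@integral_lcomb_ln _ (family t) (fun s => B s.1 (t * s.2) s.2)) nz _ _.
- exact: measurable_family.
- by rewrite det_uv normrN gtr0_norm ?invr_gt0.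
- move=> s; have e : lcomb u' v' s = Y s.1 s.2 by case: s.
  by rewrite e /family pdY.
Qed.

Lemma family_quasi (l t0 t1 : R) : 0 < l < 1 ->
  (Order.min (family_integral t0) (family_integral t1) <= family_integral ((1 - l) * t0 + l * t1)%R)%E.
Proof.
move=> l01; rewrite !fintE.
have ip : 0 < p^-1 by rewrite invr_gt0.
have := busemann_ln ip a0 B_gt0 B_logconvex B_even mB t0 t1 l01.
have d0 : (0 <= p^-1%:E)%E by rewrite lee_fin ltW.
by rewrite !ge_min => /orP[h|h]; apply/orP; [left|right]; exact: lee_wpmul2l d0 _ _ h.
Qed.

End family.

End moves.

(** * Reduction to parallelograms *)

Section induction.
Context {R : realType}.
Local Notation mR := (measurableTypeR R).
Local Notation mu2 := (@lebesgue_measure2 R).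
Implicit Types (u v w d e f P y : R * R) (ds : seq (R * R)).
Variables (p : R).
Hypothesis p0 : 0 < p.
Local Notation pd := (pd p).
Local Notation cone_exp := (cone_exp p).
Local Notation tri_exp := (tri_exp p).
Local Notation pexp := (pexp p).
Local Notation pmahler := (pmahler p).
Local Opaque evexp.

Lemma ae_imp (A B : R * R -> Prop) : (forall y, A y -> B y) ->
  {ae mu2, forall y, A y} -> {ae mu2, forall y, B y}.
Proof. by move=> AB; apply: negligibleS => y /=; apply: contra_not; exact: AB. Qed.

Lemma det_neq0l u v : det u v != 0 -> u != 0.
Proof. by apply: contra_neq => ->; rewrite det0l. Qed.
Lemma det_neq0r u v : det u v != 0 -> v != 0.
Proof. by apply: contra_neq => ->; rewrite det0r. Qed.

Lemma vert_merge P e f ds : vert P ((e + f) :: ds) = vert P [:: e, f & ds].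
Proof. by rewrite /vert/= addrA. Qed.

(** The triangle that split_cone cuts off between the two edges is flat. *)
Lemma chain_merge y P e f ds : det e f = 0 ->
  generic p (vert P [:: e, f & ds]) (vert (P + e) (f :: ds)) (vert (P + e + f) ds) y ->
  chain (cone_exp y) P [:: e, f & ds] = chain (cone_exp y) P ((e + f) :: ds).
Proof.
move=> ef /split_cone h.
have := h; rewrite [X in det X _](_ : _ = e); last first.
  by rewrite vert_cons addrC addKr.
rewrite [X in det _ X](_ : _ = e + f); last first.
  rewrite [vert (P + e + f) ds]vert_cons [vert (P + e) _]vert_cons.
  by move: (vert P _) => W; apply: pairP => /=; ring.
rewrite detDr detxx add0r ef mul0r addr0 => {}h.
by rewrite /= vert_merge !addrA h.
Qed.

Lemma chain_det_merge P e f ds : det e f = 0 ->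
  chain det P [:: e, f & ds] = chain det P ((e + f) :: ds).
Proof.
move=> ef; rewrite /= vert_merge !addrA; congr (_ + _).
rewrite [vert (P + e + f) ds]vert_cons [vert (P + e) _]vert_cons.
move: (vert P _) ef => W; rewrite /det/= => ef.
by rewrite -[RHS]addr0 -ef; ring.
Qed.

(** The conditions keep the three vertices involved nonzero and distinct, so that
    split_cone applies at almost all y. *)
Lemma merge_ae P e f ds : det e f = 0 ->
  e != 0 -> f != 0 -> e + f != 0 -> det (vert P [:: e, f & ds]) f != 0 ->
  {ae mu2, forall y, chain (cone_exp y) P [:: e, f & ds] = chain (cone_exp y) P ((e + f) :: ds)}.
Proof.
move=> ef e0 f0 s0 W.
have e2 : vert (P + e) (f :: ds) = vert P [:: e, f & ds] + e by rewrite vert_cons.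
have e3 : vert (P + e + f) ds = vert P [:: e, f & ds] + (e + f) by rewrite 2!vert_cons addrA.
apply: (ae_imp (fun y => @chain_merge y P e f ds ef)).
rewrite e2 e3; set W0 := vert P [:: e, f & ds] in W *.
have h0 : W0 != 0 := det_neq0l W.
have h1 : W0 + e != 0 by apply: (@det_neq0l _ f); rewrite detDl ef addr0.
have h2 : W0 + (e + f) != 0 by apply: (@det_neq0l _ f); rewrite !detDl ef detxx !addr0.
apply: ae_generic => //.
- by rewrite -subr_eq0 opprD addNKr oppr_eq0.
- by rewrite -subr_eq0 addrA opprD addNKr oppr_eq0.
- by rewrite -subr_eq0 addrC addKr.
Qed.

Lemma ccw_vsum_gt0 d e ds : ccw [:: d, e & ds] -> 0 < det d (vsum (e :: ds)).
Proof.
move=> /= /andP[/andP[de h] _]; rewrite detDr ltr_pwDl//.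
by apply: det_vsum_ge0.
Qed.

Lemma pexp_gt0 d e ds y : ccw [:: d, e & ds] -> 0 < pexp [:: d, e & ds] y.
Proof.
move=> cc; rewrite /pexp -[X in 0 < X]/(_ + chain _ (0 + d) (e :: ds)); apply: ltr_pwDl.
  rewrite /cone_exp (det_vert 0 d (e :: ds)) det0l add0r !mulr_gt0 ?evexp_gt0//.
  exact: ccw_vsum_gt0.
apply: chain_cone_exp_ge0; first exact: ccwS cc.
by apply: nonneg_fromS cc _; apply/allP => x _; rewrite det0l.
Qed.

Lemma parea_gt0 d e ds : ccw [:: d, e & ds] -> 0 < parea [:: d, e & ds].
Proof. by rewrite (parea_pexp p); exact: pexp_gt0. Qed.

(** The chord v between the neighbours of the moving vertex is the sum of the
    two edges d0 and d1. *)
Section slide.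
Variables (d0 d1 : R * R) (ds : seq (R * R)).
Local Notation v := (d0 + d1).
Definition slide (t : R) : seq (R * R) := [:: d0 + sc t v, d1 - sc t v & ds].
Let W0 := vert 0 [:: d0, d1 & ds].
Let W2 := vert v ds.
Hypothesis cc : ccw [:: d0, d1 & ds].
Hypothesis ne : ds != [::].
Let dl := det d0 d1.
Let dl0 : 0 < dl. Proof. by case/andP: cc => /= /andP[]. Qed.

Let slide_sum t : (d0 + sc t v) + (d1 - sc t v) = v.
Proof. by apply: pairP => /=; ring. Qed.
Let slide_det t : det (d0 + sc t v) (d1 - sc t v) = dl.
Proof. by rewrite /dl/det/=; ring. Qed.

Let W0E t : vert 0 (slide t) = W0.
Proof. by rewrite /W0 /vert/=; congr (sc _ _); apply: pairP => /=; ring. Qed.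
Let W2E : W2 = W0 + v.
Proof. by rewrite /W2/W0 /vert; apply: pairP => /=; field. Qed.

Let vsum_v : 0 < det v (vsum ds).
Proof.
case: ds ne cc => [//|d2 ds' _] /= /andP[/andP[_ /andP[h02 h0]] /andP[/andP[h12 h1] _]].
rewrite detDl !detDr; have := det_vsum_ge0 h0; have := det_vsum_ge0 h1; lra.
Qed.

Lemma slide_W02 : 0 < det W0 W2.
Proof.
have -> : det W0 W2 = 2^-1 * det v (vsum ds) by rewrite /W0 /W2 /vert /det/=; field.
by rewrite mulr_gt0.
Qed.

Let slide_P t : 0 + (d0 + sc t v) + (d1 - sc t v) = v.
Proof. by apply: pairP => /=; ring. Qed.

Let slide_W1 t : vert (0 + (d0 + sc t v)) (d1 - sc t v :: ds) = W0 + (d0 + sc t v).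
Proof. by rewrite -(W0E t) vert_cons. Qed.

Let chain_slide D t : chain D 0 (slide t) =
  D W0 (W0 + (d0 + sc t v)) + D (W0 + (d0 + sc t v)) W2 + chain D v ds.
Proof.
by rewrite /= -/(slide t) W0E slide_W1 slide_P addrA.
Qed.

Lemma parea_slide t : parea (slide t) = parea [:: d0, d1 & ds].
Proof.
have -> : [:: d0, d1 & ds] = slide 0.
  by rewrite /slide; congr [:: _, _ & _]; apply: pairP => /=; ring.
rewrite /parea !chain_slide; congr (_ + _).
by rewrite W2E /det/=; ring.
Qed.

(** split_cone separates the moving triangle W0, W1, W2 from the fixed part of
    the polygon; the assumption says that W0 and W1 are still in the right
    order, so that W1 has not crossed the line through 0 and W0. *)
Lemma slide_ae t : 0 <= det (d0 + sc t v) (vsum ds) ->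
  {ae mu2, forall y, pexp (slide t) y = family p W0 (W0 + d0) W2 v v ds dl t y}.
Proof.
move=> h.
have e0 : det (d0 + sc t v) (d1 - sc t v) != 0 by rewrite slide_det gt_eqF.
have W1 : det W0 (W0 + (d0 + sc t v)) != 0.
  have -> : det W0 (W0 + (d0 + sc t v)) = 2^-1 * (dl + det (d0 + sc t v) (vsum ds)).
    by rewrite /W0 /vert /dl /det/=; field.
  by rewrite gt_eqF// mulr_gt0// ltr_pwDl.
have W02 : det W0 W2 != 0 by rewrite gt_eqF// slide_W02.
apply: (ae_imp (A := generic p W0 (W0 + (d0 + sc t v)) W2)).
  move=> y /split_cone h'; rewrite /pexp chain_slide h' /family.
  have -> : det (W0 + (d0 + sc t v) - W0) (W2 - W0) = dl.
    by rewrite W2E /dl /det/=; ring.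
  have e1 : pd (W0 + (d0 + sc t v)) y = pd (W0 + d0) y + t * pd v y.
    by rewrite /pd /dotp/=; ring.
  by rewrite /tri_exp e1.
apply: ae_generic => //.
- exact: det_neq0l W02.
- exact: det_neq0r W1.
- exact: det_neq0r W02.
- by rewrite -subr_eq0 opprD addNKr oppr_eq0; exact: det_neq0l e0.
- rewrite W2E -{2}(slide_sum t) -subr_eq0.
  have -> : W0 + (d0 + sc t v) - (W0 + (d0 + sc t v + (d1 - sc t v))) = - (d1 - sc t v).
    by apply: pairP => /=; ring.
  by rewrite oppr_eq0; exact: det_neq0r e0.
- rewrite W2E -subr_eq0 [W0 + _]addrC addrK; apply: (@det_neq0r W0).
  by have := W02; rewrite W2E detDr detxx add0r.
Qed.

Lemma slide_quasi (l t0 t1 : R) : 0 < l < 1 ->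
  0 <= det (d0 + sc t0 v) (vsum ds) -> 0 <= det (d0 + sc t1 v) (vsum ds) ->
  (1 - l) * t0 + l * t1 = 0 ->
  (Order.min (pmahler (slide t0)) (pmahler (slide t1)) <= pmahler [:: d0, d1 & ds])%E.
Proof.
move=> l01 h0 h1 e.
have s0 : [:: d0, d1 & ds] = slide 0.
  by rewrite /slide; congr [:: _, _ & _]; apply: pairP => /=; ring.
have a0 : 0 < parea [:: d0, d1 & ds] := parea_gt0 cc.
have h : 0 <= det (d0 + sc 0 v) (vsum ds).
  have -> : d0 + sc 0 v = d0 by apply: pairP => /=; ring.
  case/andP: cc => /= /andP[_ hh] _; exact: det_vsum_ge0.
have nnv : nonneg_from v ds.
  case/andP: cc => /= /andP[_ hh] /andP[hh' _]; apply/allP => x xds.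
  by rewrite detDl addr_ge0// ltW//; [exact: (allP hh)|exact: (allP hh')].
have ccds : ccw ds := ccwS (ccwS cc).
have vv0 : v != 0 by apply: (@det_neq0l _ (vsum ds)); rewrite gt_eqF.
pose F := family_integral p W0 (W0 + d0) W2 v v ds dl (parea [:: d0, d1 & ds]).
have I t : 0 <= det (d0 + sc t v) (vsum ds) ->
    pmahler (slide t) = ((parea [:: d0, d1 & ds])%:E * F t)%E.
  move=> ht; rewrite /pmahler parea_slide.
  by rewrite (pmahler_ae p _ (measurable_chain p 0 (slide t))
    (measurable_family p W0 (W0 + d0) W2 v v ds dl t) (slide_ae ht)).
rewrite [in leRHS]s0 !I//.
have := @family_quasi R p p0 W0 (W0 + d0) W2 v v ds dl (parea [:: d0, d1 & ds])
  (ltW slide_W02) dl0 a0 vv0 ccds nnv l t0 t1 l01.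
rewrite e -/F => hq.
have p1 : (0 <= (parea [:: d0, d1 & ds])%:E)%E by rewrite lee_fin ltW.
move: hq; rewrite !ge_min => /orP[hq|hq]; apply/orP; [left|right]; exact: lee_wpmul2l p1 _ _ hq.
Qed.

End slide.

Lemma parallelE x y z : det x y = 0 -> 0 < det z y -> x = sc (det z x / det z y) y.
Proof.
move=> xy zy; have zy0 : det z y != 0 by rewrite gt_eqF.
have h1 : det z y * x.1 - det z x * y.1 = z.1 * det x y by rewrite /det; ring.
have h2 : det z y * x.2 - det z x * y.2 = z.2 * det x y by rewrite /det; ring.
move/eqP: h1; rewrite xy mulr0 subr_eq0 => /eqP h1.
move/eqP: h2; rewrite xy mulr0 subr_eq0 => /eqP h2.
by apply: pairP => /=; apply: (mulfI zy0); rewrite ?h1 ?h2; field.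
Qed.

Lemma pmahler_eq ds ds' : parea ds = parea ds' ->
  {ae mu2, forall y, pexp ds y = pexp ds' y} -> pmahler ds = pmahler ds'.
Proof.
by move=> e h; rewrite /pmahler e (pmahler_ae p _ (measurable_chain _ _ _) (measurable_chain _ _ _) h).
Qed.

Lemma pmahler_rotate d ds : pmahler (rcons ds (- d)) = pmahler (d :: ds).
Proof.
apply: pmahler_eq; first by rewrite /parea chain_rotate//; exact: det_even.
apply: (ae_imp (A := fun=> True)) => [y _|]; first by rewrite /pexp chain_rotate//; exact: cone_exp_even.
by apply: aeW.
Qed.

Lemma chain_cons_eq D P d es es' : chain D (P + d) es = chain D (P + d) es' ->
  vsum es = vsum es' -> chain D P (d :: es) = chain D P (d :: es').
Proof. by move=> /= -> e; rewrite /vert /= e. Qed.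

(** At t = det d1 d2 / det v d2, the second of the two moving edges becomes
    parallel to d2. *)
Lemma slide_plus d0 d1 d2 ds : ccw [:: d0, d1, d2 & ds] ->
  exists t : R, exists dp : seq (R * R), [/\ 0 < t,
    0 <= det (d0 + sc t (d0 + d1)) (vsum (d2 :: ds)),
    ccw dp, size dp = (size ds).+2 &
    pmahler (slide d0 d1 (d2 :: ds) t) = pmahler dp].
Proof.
move=> cc; have := cc; rewrite /ccw/= => /and4P[/and3P[h01 h02 a0] /andP[h12 a1] a2 pw].
set v := d0 + d1.
have hv : 0 < det v d2 by rewrite detDl addr_gt0.
pose t := det d1 d2 / det v d2.
have t0 : 0 < t by rewrite divr_gt0.
have t1 : t < 1 by rewrite ltr_pdivrMr// mul1r detDl ltrDr.
pose e0 := d0 + sc t v; pose e1 := d1 - sc t v.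
have e12 : det e1 d2 = 0.
  by rewrite detDl detNl detZl /t divfK ?subrr ?gt_eqF.
have e1E := parallelE e12 h02.
have kE : det d0 e1 = (1 - t) * det d0 d1 by rewrite /e1 /v /det/=; ring.
pose k := det d0 e1 / det d0 d2.
have k0 : 0 < k by rewrite divr_gt0// kE mulr_gt0// subr_gt0.
have e0d x : 0 < det d0 x -> 0 < det d1 x -> 0 < det e0 x.
  by move=> hx hx'; rewrite /e0 /v detDl detZl detDl addr_gt0// mulr_gt0// addr_gt0.
have e0a : all (fun e => 0 < det e0 e) ds.
  by apply/allP => x xds; apply: e0d; [exact: (allP a0)|exact: (allP a1)].
have e0d2 : 0 < det e0 d2 by exact: e0d.
have s12 : e1 + d2 = sc (k + 1) d2.
  by rewrite e1E -/k; apply: pairP => /=; ring.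
exists t, (e0 :: (e1 + d2) :: ds); split => //.
- by rewrite /= detDr addr_ge0//; [exact: ltW|exact: det_vsum_ge0].
- have k10 : 0 < k + 1 by exact: addr_gt0.
  rewrite /ccw /= s12 detZr; apply/and3P; split => //; first by rewrite mulr_gt0.
  by apply: sub_all a2 => x xds; rewrite detZl mulr_gt0.
- have e2 : det (vert (0 + e0) [:: e1, d2 & ds]) d2 != 0.
    have -> : det (vert (0 + e0) [:: e1, d2 & ds]) d2 =
        2^-1 * (det e0 d2 + det d2 (vsum ds) - det e1 d2).
      by rewrite /vert /det/=; field.
    by rewrite e12 subr0 gt_eqF// mulr_gt0// ltr_pwDl// det_vsum_ge0.
  have e1n : e1 != 0.
    by apply: (@det_neq0r d0); rewrite kE gt_eqF// mulr_gt0// subr_gt0.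
  have d2n : d2 != 0 by apply: (@det_neq0r d0); rewrite gt_eqF.
  have sn : e1 + d2 != 0.
    by apply: (@det_neq0r d0); rewrite s12 detZr gt_eqF// mulr_gt0// addr_gt0.
  apply: pmahler_eq.
    by rewrite /parea; apply: (chain_cons_eq (P := 0) (d := e0) (chain_det_merge _ _ e12)) => /=; rewrite addrA.
  apply: ae_imp (merge_ae e12 e1n d2n sn e2) => y hy.
  by apply: (chain_cons_eq (P := 0) (d := e0) hy) => /=; rewrite addrA.
Qed.

(** At the opposite end the first moving edge becomes parallel to the edge that
    precedes it around the polygon, which is the opposite of the last edge g. *)
Lemma slide_minus d0 d1 g ds : ccw [:: d0, d1 & rcons ds g] ->
  exists t : R, exists dp : seq (R * R), [/\ t < 0,
    0 <= det (d0 + sc t (d0 + d1)) (vsum (rcons ds g)),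
    ccw dp, size dp = (size ds).+2 &
    pmahler (slide d0 d1 (rcons ds g) t) = pmahler dp].
Proof.
rewrite /ccw/= !all_rcons pairwise_rcons.
move=> /and3P[/and3P[h01 h0g a0] /andP[h1g a1] /andP[ag pw]].
set v := d0 + d1.
have hv : 0 < det v g by rewrite detDl addr_gt0.
pose t := - (det d0 g / det v g).
have t0 : t < 0 by rewrite oppr_lt0 divr_gt0.
have t1 : 0 < 1 + t.
  by rewrite subr_gt0 ltr_pdivrMr// mul1r detDl ltrDl.
pose e0 := d0 + sc t v; pose e1 := d1 - sc t v.
have e0g : det e0 g = 0.
  by rewrite /e0 detDl detZl /t mulNr divfK ?subrr ?gt_eqF.
pose k := det e0 d1 / det d1 g.
have k0 : 0 < k.
  have -> : k = (1 + t) * det d0 d1 / det d1 g.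
    by rewrite /k; congr (_ / _); rewrite /e0 /v /det/=; ring.
  by rewrite divr_gt0// mulr_gt0.
have e0E : e0 = sc k (- g).
  rewrite {1}(parallelE e0g h1g) detC mulNr -/k.
  by apply: pairP => /=; ring.
have e1x x : 0 < det d0 x -> 0 < det d1 x -> 0 < det e1 x.
  move=> hx hx'; rewrite /e1 /v detDl detNl detZl detDl -mulNr addr_gt0// mulr_gt0 ?oppr_gt0//.
  exact: addr_gt0.
have gx x : 0 < det x g -> 0 < det (- g) x by rewrite detNl -detC.
have s01 : - g + e0 = sc (1 + k) (- g).
  by rewrite e0E; apply: pairP => /=; ring.
have k1 : 0 < 1 + k by rewrite addr_gt0.
have gds : 0 <= det (- g) (vsum ds).
  by apply: det_vsum_ge0; apply: sub_all ag => x; exact: gx.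
have g1 : 0 < det (- g) e1 by apply: gx; exact: e1x.
exists t, ((- g + e0) :: e1 :: ds); split => //.
- rewrite -/v -/e0 e0E detZl vsum_rcons detDr [det (- g) g]detNl detxx oppr0 addr0.
  by rewrite mulr_ge0// ltW.
- rewrite /ccw/= s01 detZl mulr_gt0//= pw andbT; apply/andP; split.
    apply/allP => x xds; rewrite detZl mulr_gt0// gx//; exact: (allP ag).
  by apply/allP => x xds; apply: e1x; [exact: (allP a0)|exact: (allP a1)].
- have g0 : det (- g) e0 = 0 by rewrite e0E detZr detxx mulr0.
  have -> : slide d0 d1 (rcons ds g) t = rcons [:: e0, e1 & ds] (- - g) by rewrite opprK.
  rewrite pmahler_rotate.
  have gn : - g != 0 by apply: (@det_neq0l _ e1); rewrite gt_eqF.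
  have e0n : e0 != 0 by apply: (@det_neq0l _ e1); rewrite e0E detZl gt_eqF// mulr_gt0.
  have sn : - g + e0 != 0 by apply: (@det_neq0l _ e1); rewrite s01 detZl gt_eqF// mulr_gt0.
  have e2 : det (vert 0 [:: - g, e0, e1 & ds]) e0 != 0.
    have -> : det (vert 0 [:: - g, e0, e1 & ds]) e0 =
        2^-1 * k * (det (- g) e1 + det (- g) (vsum ds)).
      by rewrite e0E /vert /det/=; field.
    have k2 : 0 < 2^-1 * k by rewrite mulr_gt0.
    by rewrite gt_eqF// (mulr_gt0 k2)// (ltr_pwDl g1 gds).
  apply: pmahler_eq; first by rewrite /parea (chain_det_merge _ _ g0).
  exact: merge_ae.
Qed.

Definition unit_parallelogram : seq (R * R) := [:: (1, 0); (0, 1)].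

(** The exponential integral of a parallelogram of area 1, in the coordinates
    given by p times the scalar products of y with the edges. *)
Definition par_exp (s : R * R) : R :=
  2^-1 * (evexp 0 (2^-1 * (- s.1 - s.2)) (2^-1 * (s.1 - s.2)) +
          evexp 0 (2^-1 * (s.1 - s.2)) (2^-1 * (s.1 + s.2))).

(** The right-hand side no longer depends on the edges: y is expressed in the
    dual basis u, w of the edges, divided by p. *)
Lemma parallelogramE d0 d1 : 0 < det d0 d1 ->
  pmahler [:: d0; d1] = ((p^-1 * p^-1)%:E *
    \int[mu2]_s (expR (- (p^-1 * ln (par_exp s))))%:E)%E.
Proof.
move=> D0; have Dn : det d0 d1 != 0 by rewrite gt_eqF.
have pn : p != 0 by rewrite gt_eqF.
have pD0 : p * det d0 d1 != 0 by rewrite mulf_neq0.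
pose u := sc (p * det d0 d1)^-1 (d1.2, - d1.1).
pose w := sc (p * det d0 d1)^-1 (- d0.2, d0.1).
have uw : det u w = (p * p * det d0 d1)^-1.
  rewrite /u /w detZl detZr.
  have -> : det (d1.2, - d1.1) (- d0.2, d0.1) = det d0 d1 by rewrite /det/=; ring.
  by field; rewrite Dn.
have uw0 : det u w != 0 by rewrite uw invr_eq0 !mulf_neq0.
have pd0 s : pd d0 (lcomb u w s) = s.1.
  have -> : pd d0 (lcomb u w s) = (p * det d0 d1)^-1 * (p * det d0 d1) * s.1.
    by rewrite /pd /dotp /lcomb /u /w /=; move: (_^-1) => z; rewrite /det; ring.
  by rewrite mulVf// mul1r.
have pd1 s : pd d1 (lcomb u w s) = s.2.
  have -> : pd d1 (lcomb u w s) = (p * det d0 d1)^-1 * (p * det d0 d1) * s.2.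
    by rewrite /pd /dotp /lcomb /u /w /=; move: (_^-1) => z; rewrite /det; ring.
  by rewrite mulVf// mul1r.
have W0 : vert 0 [:: d0; d1] = sc 2^-1 (- d0 - d1) by apply: pairP => /=; ring.
have W1 : vert (0 + d0) [:: d1] = sc 2^-1 (d0 - d1) by apply: pairP => /=; ring.
have W2 : vert (0 + d0 + d1) [::] = sc 2^-1 (d0 + d1) by apply: pairP => /=; ring.
have D01 : det (sc 2^-1 (- d0 - d1)) (sc 2^-1 (d0 - d1)) = 2^-1 * det d0 d1.
  by rewrite /det/=; field.
have D12 : det (sc 2^-1 (d0 - d1)) (sc 2^-1 (d0 + d1)) = 2^-1 * det d0 d1.
  by rewrite /det/=; field.
have ar : parea [:: d0; d1] = det d0 d1.
  by rewrite /parea [LHS]/= W0 W1 W2 D01 D12; field.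
have px s : pexp [:: d0; d1] (lcomb u w s) = det d0 d1 * par_exp s.
  rewrite /pexp [LHS]/= W0 W1 W2 /cone_exp /tri_exp D01 D12 pd0l !pdZl !pdDl !pdNl pd0 pd1 /par_exp.
  by move: (evexp _ _ _) (evexp _ _ _) => A B; ring.
rewrite /pmahler ar (integral_lcomb_ln _ _ (measurable_chain _ _ _) uw0 erefl px).
have ip0 : 0 < (p * p * det d0 d1)^-1 by rewrite invr_gt0 !mulr_gt0.
rewrite muleA -EFinM uw gtr0_norm; last exact: ip0.
have -> : det d0 d1 * (p * p * det d0 d1)^-1 = p^-1 * p^-1.
  by field; rewrite pn Dn.
rewrite (_ : (fun s => _) = (fun s => (expR (- (p^-1 * ln (par_exp s))))%:E))//.
by apply/funext => s; rewrite mulrAC divff// mul1r.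
Qed.

Lemma parallelogram d0 d1 : 0 < det d0 d1 -> pmahler [:: d0; d1] = pmahler unit_parallelogram.
Proof.
by move=> D; rewrite !parallelogramE//= /det/= mulr0 mulr1 subr0.
Qed.

(** Position 0 lies between the two positions at which the number of edges drops,
    hence one of the two has a smaller value. *)
Theorem pmahler_min n ds : size ds = n.+2 -> ccw ds ->
  (pmahler unit_parallelogram <= pmahler ds)%E.
Proof.
elim: n ds => [|n IH] ds.
  by case: ds => [|d0 [|d1 [|]]]//= _ cc; have /andP[/andP[h _] _] := cc; rewrite -(parallelogram h).
case: ds => [|d0 [|d1 [|d2 ds]]] // [sz] cc.
have [tp [dp [tp0 hp cp sp ep]]] := slide_plus cc.
have [g [ds' e]] : exists g, exists ds', d2 :: ds = rcons ds' g.
  by exists (last d2 ds), (belast d2 ds); rewrite lastI.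
have cc' : ccw [:: d0, d1 & rcons ds' g] by rewrite -e.
have [tm [dm [tm0 hm cm sm em]]] := slide_minus cc'.
have sz' : size ds' = size ds.
  by have := congr1 size e; rewrite size_rcons /= => -[].
have D : 0 < tp - tm by lra.
pose l := - tm / (tp - tm).
have l01 : 0 < l < 1.
  by apply/andP; rewrite /l ltr_pdivrMr//; split; [apply: divr_gt0|]; lra.
have := @slide_quasi d0 d1 (d2 :: ds) cc isT l tm tp l01; rewrite {1 3}e => /(_ hm hp).
have -> : (1 - l) * tm + l * tp = 0 by rewrite /l; field; rewrite gt_eqF.
move=> /(_ erefl); rewrite em ep; apply: le_trans.
by rewrite le_min !IH// ?sm ?sp ?sz' ?sz.
Qed.
End induction.

(** * Integrals over a body and over inscribed polygons *)

Section triangles.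
Context {R : realType}.
Local Notation mR := (measurableTypeR R).
Local Notation mu2 := (@lebesgue_measure2 R).
Implicit Types (u v w a b x y : R * R) (l : seq (R * R)).
Variables (p : R).
Local Notation pd := (pd p).
Local Notation cone_exp := (cone_exp p).

(** The contribution of the two opposite points x and - x. *)
Definition cosh2 y x : \bar R := (expR (pd x y) + expR (- pd x y))%:E.

Lemma pdC x y : pd x y = pd y x.
Proof. by rewrite /pd /dotp; ring. Qed.

Lemma measurable_exp_pd y : measurable_fun setT (fun x : mR * mR => (expR (pd x y))%:E).
Proof.
apply/measurable_EFinP; apply: measurableT_comp => //.
by under eq_fun do rewrite pdC; exact: measurable_pd.
Qed.

Lemma measurable_exp_pdN y : measurable_fun setT (fun x : mR * mR => (expR (- pd x y))%:E).
Proof.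
apply/measurable_EFinP; apply: measurableT_comp => //; apply: measurableT_comp => //.
by under eq_fun do rewrite pdC; exact: measurable_pd.
Qed.

Lemma measurable_cosh2 y : measurable_fun setT (cosh2 y : mR * mR -> \bar R).
Proof.
exact: emeasurable_funD (measurable_exp_pd y) (measurable_exp_pdN y).
Qed.

Lemma cosh2_ge0 y x : (0 <= cosh2 y x)%E.
Proof. by rewrite lee_fin addr_ge0// expR_ge0. Qed.

Lemma cone_exp_integral y u v : ((cone_exp y u v)%:E =
  (det u v)%:E * \int[mu2]_(s in simplex) cosh2 y (lcomb u v s))%E.
Proof.
rewrite /cone_exp EFinM; congr (_ * _)%E.
have e s : pd (lcomb u v s) y = bary 0 (pd u y) (pd v y) s.
  by rewrite /bary /pd /dotp/=; ring.
have e' s : - pd (lcomb u v s) y = bary (- 0) (- pd u y) (- pd v y) s.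
  by rewrite /bary /pd /dotp/=; ring.
have m0 (a b c : R) : measurable_fun simplex (fun s : mR * mR => (expR (bary a b c s))%:E).
  exact: measurable_exp_bary.
have g0 (a b c : R) (s : mR * mR) : simplex s -> (0 <= (expR (bary a b c s))%:E)%E.
  by rewrite lee_fin expR_ge0.
have := ge0_integralD mu2 measurable_simplex (g0 0 (pd u y) (pd v y)) (m0 _ _ _)
  (g0 (- 0) (- pd u y) (- pd v y)) (m0 _ _ _).
rewrite !sexpE /tri_exp /evexp pd0l -EFinD => <-.
by apply: eq_integral => s _; rewrite -e -e'.
Qed.

Definition halfplane a : set (mR * mR) := [set x | 0 < det a x].

Lemma measurable_det a : measurable_fun setT (det a : mR * mR -> mR).
Proof. by apply: measurable_funB; apply: measurable_funM. Qed.

Lemma measurable_halfplane a : measurable (halfplane a).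
Proof.
rewrite -[halfplane a]setTI (_ : halfplane a = det a @^-1` `]0, +oo[%classic); last first.
  by apply/seteqP; split => x /=; rewrite in_itv/= andbT.
by apply: measurable_det => //; exact: measurable_itv.
Qed.

Let N : set (mR * mR) := oline 1 0 `|` oline 0 1.

Let mN : measurable N.
Proof. by apply: measurableU; exact: measurable_oline. Qed.

Let N0 : mu2 N = 0%E.
Proof.
apply/eqP; rewrite -measure_le0; apply: le_trans (measureU2 _ _ _) _; try exact: measurable_oline.
have n10 : (1 : R, 0 : R) != 0 by apply/eqP => -[] /eqP; rewrite oner_eq0.
have n01 : (0 : R, 1 : R) != 0 by apply/eqP => -[] /eqP; rewrite oner_eq0.
have := le_refl (0%E : \bar R); rewrite -{1}(adde0 0%E).
by rewrite -{1}(oline_null n10) -{1}(oline_null n01).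
Qed.

Lemma measurable_cosh2_lcomb y u v : measurable_fun setT (fun s : mR * mR => cosh2 y (lcomb u v s)).
Proof. exact: measurableT_comp (measurable_cosh2 y) (measurable_lcomb u v). Qed.

(** The linear change of variables that maps the simplex to the triangle
    0, u, v. *)
Lemma integral_region y u v (A : set (mR * mR)) : measurable A -> 0 < det u v ->
  (\int[mu2]_(x in A) cosh2 y x =
   (det u v)%:E * \int[mu2]_(s in lcomb u v @^-1` A) cosh2 y (lcomb u v s))%E.
Proof.
move=> mA uv; rewrite integral_mkcond epatch_indic.
rewrite (@ge0_integral_lcomb _ _ u v); [|  | |by rewrite gt_eqF].
- rewrite gtr0_norm// [in RHS]integral_mkcond epatch_indic.
  by [].
- apply: emeasurable_funM; first exact: measurable_cosh2.
  by apply/measurable_EFinP; exact: measurable_indic.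
- by move=> x; rewrite mule_ge0 ?cosh2_ge0// lee_fin.
Qed.

Lemma measurable_lcomb_preimage u v (A : set (mR * mR)) : measurable A -> measurable (lcomb u v @^-1` A).
Proof. by move=> mA; rewrite -[X in measurable X]setTI; apply: measurable_lcomb. Qed.

(** Points of the triangle on its two sides through 0 are left aside, since they
    lie on a null set. *)
Lemma cone_exp_le y u v (A : set (mR * mR)) : measurable A -> 0 < det u v ->
  (forall s, 0 < s.1 -> 0 < s.2 -> s.1 + s.2 <= 1 -> A (lcomb u v s)) ->
  ((cone_exp y u v)%:E <= \int[mu2]_(x in A) cosh2 y x)%E.
Proof.
move=> mA uv h; rewrite cone_exp_integral (integral_region y mA uv).
have d0 : (0 <= (det u v)%:E)%E by rewrite lee_fin ltW.
apply: lee_wpmul2l d0 _ _ _.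
rewrite (@ge0_negligible_integral _ _ _ mu2 simplex N); [|exact: mN|exact: measurable_simplex|
  by apply: measurable_funTS; exact: measurable_cosh2_lcomb|by move=> s _; exact: cosh2_ge0|exact: N0].
apply: ge0_subset_integral => //.
- by apply: measurableD => //; exact: measurable_simplex.
- exact: measurable_lcomb_preimage.
- by apply: measurable_funTS; exact: measurable_cosh2_lcomb.
- by move=> s _; exact: cosh2_ge0.
- move=> s [[s1 s2 s12] ns]; apply: h => //; rewrite lt_neqAle ?s1 ?s2 andbT; apply/eqP => e;
    apply: ns; [left|right]; rewrite /oline/= -e; ring.
Qed.

Lemma le_cone_exp y u v (A : set (mR * mR)) : measurable A -> 0 < det u v ->
  (forall s, A (lcomb u v s) -> simplex s) ->
  (\int[mu2]_(x in A) cosh2 y x <= (cone_exp y u v)%:E)%E.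
Proof.
move=> mA uv h; rewrite cone_exp_integral (integral_region y mA uv).
have d0 : (0 <= (det u v)%:E)%E by rewrite lee_fin ltW.
apply: lee_wpmul2l d0 _ _ _.
apply: ge0_subset_integral => //.
- exact: measurable_lcomb_preimage.
- exact: measurable_simplex.
- by apply: measurable_funTS; exact: measurable_cosh2_lcomb.
- by move=> s _; exact: cosh2_ge0.
Qed.

(** chain, for a polygon given by its vertices. *)
Fixpoint pchain (D : R * R -> R * R -> R) a l : R :=
  if l is b :: l' then D a b + pchain D b l' else 0.

Variable K : set (mR * mR).
Hypothesis mK : measurable K.

(** The part of K in the half-turn after w0 that comes after a. *)
Definition region w0 a : set (mR * mR) := K `&` halfplane w0 `&` halfplane a.

Lemma measurable_region w0 a : measurable (region w0 a).
Proof. by apply: measurableI; [apply: measurableI|] => //; exact: measurable_halfplane. Qed.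

(** Vertices in counterclockwise order from w0 to - w0. The last step is treated
    apart, because det w0 b vanishes at b = - w0. *)
Fixpoint arc w0 a l : Prop :=
  if l is b :: l' then
    [/\ 0 < det a b, 0 <= det w0 a, 0 < det w0 b \/ b = - w0 /\ 0 < det w0 a & arc w0 b l']
  else a = - w0.

Lemma region_opp w0 : region w0 (- w0) = set0.
Proof.
apply/seteqP; split => x //= -[[_]]; rewrite /halfplane/= detNl => h1 h2.
by move: h2; rewrite oppr_gt0 ltNge ltW.
Qed.

Definition consecutive (C : R * R -> R * R -> Prop) := fix consecutive a l : Prop :=
  if l is b :: l' then C a b /\ consecutive b l' else True.

(** The cone between a and b and the region after b are disjoint parts of the
    region after a. *)
Lemma pchain_le y w0 a l : arc w0 a l ->
  consecutive (fun a b => forall s, simplex s -> K (lcomb a b s)) a l ->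
  ((pchain (cone_exp y) a l)%:E <= \int[mu2]_(x in region w0 a) cosh2 y x)%E.
Proof.
elim: l a => [|b l IH] a /=.
  by move=> _ _; apply: integral_ge0 => x _; exact: cosh2_ge0.
move=> [ab w0a w0b arcb] [Kab Kl].
set A := region w0 a `&` [set x | 0 < det x b].
have mA : measurable A.
  apply: measurableI; first exact: measurable_region.
  rewrite (_ : [set x | _] = halfplane (- b)); first exact: measurable_halfplane.
  by apply/seteqP; split => x; rewrite /halfplane/= detNl -detC.
apply: (@le_trans _ _ (\int[mu2]_(x in A `|` region w0 b) cosh2 y x)%E); last first.
  apply: ge0_subset_integral => //.
  - by apply: measurableU => //; exact: measurable_region.
  - exact: measurable_region.
  - by apply: measurable_funTS; exact: measurable_cosh2.
  - by move=> s _; exact: cosh2_ge0.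
  - rewrite subUset; split; first by move=> x [].
    move=> x [[Kx w0x] bx]; split => //; rewrite /halfplane/= in w0x bx *.
    case: w0b => [w0b|[eb _]]; last by move: bx; rewrite eb detNl oppr_gt0 ltNge ltW.
    have : 0 < det w0 b * det a x.
      have -> : det w0 b * det a x = det a b * det w0 x + det w0 a * det b x by rewrite /det; ring.
      by rewrite ltr_pwDl ?mulr_gt0// mulr_ge0// ltW.
    by rewrite pmulr_rgt0.
rewrite ge0_integral_setU//; last 4 first.
- exact: measurable_region.
- by apply: measurable_funTS; exact: measurable_cosh2.
- by move=> s _; exact: cosh2_ge0.
- apply/disj_setPS => x [[_ /= h1] [_ h2]]; move: h1 h2; rewrite /halfplane/= detC oppr_gt0 => h1.
  by rewrite ltNge ltW.
rewrite EFinD; apply: leeD; last exact: IH.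
apply: cone_exp_le => // s s1 s2 s12; split; [split; [split|]|].
- by apply: Kab; split => //; exact: ltW.
- rewrite /halfplane/=; have -> : det w0 (lcomb a b s) = s.1 * det w0 a + s.2 * det w0 b by rewrite /det/=; ring.
  case: w0b => [w0b|[-> w0a']]; first by rewrite ltr_wpDl ?mulr_ge0 ?mulr_gt0// ltW.
  by rewrite detNr detxx oppr0 mulr0 addr0 mulr_gt0.
- rewrite /halfplane/=; have -> : det a (lcomb a b s) = s.2 * det a b by rewrite /det/=; ring.
  by rewrite mulr_gt0.
- rewrite /=; have -> : det (lcomb a b s) b = s.1 * det a b by rewrite /det/=; ring.
  by rewrite mulr_gt0.
Qed.

(** The region after a is covered by its part between a and b and by the region
    after b; after the last vertex - w0 nothing of the half-turn remains. *)
Lemma le_pchain y w0 (k : R) a l : 0 < k -> last a l = - w0 ->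
  consecutive (fun a b => 0 < det a b) a l ->
  consecutive (fun a b => forall s, 0 <= s.1 -> 0 <= s.2 -> K (lcomb a b s) -> s.1 + s.2 <= k) a l ->
  (\int[mu2]_(x in region w0 a) cosh2 y x <=
   (pchain (cone_exp y) (sc k a) (map (sc k) l))%:E)%E.
Proof.
move=> k0; elim: l a => [|b l IH] a /=.
  by move=> -> _ _; rewrite region_opp integral_set0.
move=> hl [ab sl] [Kab Kl].
set A := region w0 a `&` ~` halfplane b.
have mA : measurable A.
  by apply: measurableI; [exact: measurable_region|apply: measurableC; exact: measurable_halfplane].
apply: (@le_trans _ _ (\int[mu2]_(x in A `|` region w0 b) cosh2 y x)%E).
  apply: ge0_subset_integral => //.
  - exact: measurable_region.
  - by apply: measurableU => //; exact: measurable_region.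
  - by apply: measurable_funTS; exact: measurable_cosh2.
  - by move=> s _; exact: cosh2_ge0.
  - move=> x ax; have [bx|bx] := pselect (halfplane b x); last by left.
    by right; case: ax => -[Kx wx] _.
rewrite ge0_integral_setU//; last 4 first.
- exact: measurable_region.
- by apply: measurable_funTS; exact: measurable_cosh2.
- by move=> s _; exact: cosh2_ge0.
- by apply/disj_setPS => x [[_ /= h1] [_ h2]].
rewrite EFinD; apply: leeD; last exact: IH.
apply: le_cone_exp => //; first by rewrite detZl detZr !mulr_gt0.
move=> s [[[Ks _]]]; rewrite /halfplane/=.
have -> : det a (lcomb (sc k a) (sc k b) s) = s.2 * (k * det a b) by rewrite /det/=; ring.
have -> : det b (lcomb (sc k a) (sc k b) s) = - s.1 * (k * det a b) by rewrite /det/=; ring.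
have kab : 0 < k * det a b by exact: mulr_gt0.
rewrite !pmulr_lgt0// oppr_gt0 => s2 /negP; rewrite -leNgt => s1.
split => //; first exact: ltW.
have := Kab (sc k s); have -> : lcomb a b (sc k s) = lcomb (sc k a) (sc k b) s.
  by apply: pairP => /=; ring.
have ks1 : 0 <= (sc k s).1 by rewrite /= mulr_ge0// ltW.
have ks2 : 0 <= (sc k s).2 by rewrite /= mulr_ge0// ltW.
move=> /(_ ks1 ks2 Ks); rewrite /= -mulrDr -[X in _ <= X -> _](mulr1 k) ler_pM2l//.
Qed.

Lemma integral_half w0 y : w0 != 0 -> (forall x, K x -> K (- x)) ->
  (\int[mu2]_(x in K) (expR (pd x y))%:E = \int[mu2]_(x in region w0 w0) cosh2 y x)%E.
Proof.
move=> w00 Ksym.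
pose L := oline (- w0.2) w0.1.
have mL : measurable L by exact: measurable_oline.
have L0 : mu2 L = 0%E.
  by apply: oline_null; apply: contra w00 => /eqP[/eqP]; rewrite oppr_eq0 => /eqP h1 h2; apply/eqP/pairP.
have Lx x : L x <-> det w0 x = 0 by rewrite /L/oline/= /det mulNr addrC.
have e0 x : (0 <= (expR (pd x y))%:E)%E by rewrite lee_fin expR_ge0.
have me D : measurable_fun D (fun x : mR * mR => (expR (pd x y))%:E).
  by apply: measurable_funTS; exact: measurable_exp_pd.
have rE (w : R * R) : region w w = K `&` halfplane w by rewrite /region -setIA setIid.
have mr w : measurable (K `&` halfplane w) by apply: measurableI => //; exact: measurable_halfplane.
rewrite (@ge0_negligible_integral _ _ _ mu2 K L)// rE.
have -> : K `\` L = (K `&` halfplane w0) `|` (K `&` halfplane (- w0)).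
  apply/seteqP; split => x.
    move=> [Kx nL]; have [h|h|h] := ltgtP 0 (det w0 x); first by left.
      by right; split => //; rewrite /halfplane/= detNl oppr_gt0.
    by case: nL; apply/Lx.
  rewrite /halfplane/= detNl oppr_gt0; move=> [[Kx h]|[Kx h]]; split => // /Lx e; move: h; rewrite e ltxx//.
rewrite ge0_integral_setU//; last first.
  apply/disj_setPS => x [[_ h1] [_]]; move: h1; rewrite /halfplane/= detNl oppr_gt0 => h1.
  by rewrite ltNge ltW.
have -> : (\int[mu2]_(x in K `&` halfplane (- w0)%R) (expR (pd x y))%:E =
   \int[mu2]_(x in K `&` halfplane w0) (expR (- pd x y)%R)%:E)%E.
  rewrite integral_mkcond epatch_indic [RHS]integral_mkcond epatch_indic -ge0_integral2_opp; last 2 first.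
  - apply: emeasurable_funM; first exact: me.
    by apply/measurable_EFinP; exact: measurable_indic.
  - by move=> x; rewrite mule_ge0// lee_fin.
  apply: eq_integral => x _ /=; rewrite pdNl; congr (_ * _%:E)%E.
  apply: eq_indic; rewrite /halfplane/= detNl detNr opprK; split => -[/Ksym + ?]; rewrite ?opprK//.
rewrite -ge0_integralD//.
apply: measurable_funTS; exact: measurable_exp_pdN.
Qed.

End triangles.

(** * Polygons inscribed in the unit curve of a norm *)

Section polygon_of_norm.
Context {R : realType}.
Implicit Types (u v w a b c d x y : R * R) (l : seq (R * R)).

Fixpoint edges a l : seq (R * R) := if l is b :: l' then (b - a) :: edges b l' else [::].

Lemma vsum_edges a l : vsum (edges a l) = last a l - a.
Proof.
elim: l a => [|b l IH] a /=; first by rewrite subrr.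
by rewrite IH addrC addrA subrK.
Qed.

Lemma size_edges a l : size (edges a l) = size l.
Proof. by elim: l a => //= b l IH a; rewrite IH. Qed.

Lemma chain_edges (D : R * R -> R * R -> R) P a l : vert P (edges a l) = a ->
  chain D P (edges a l) = pchain D a l.
Proof.
elim: l a P => [|b l IH] a P //= h.
have hb : vert (P + (b - a)) (edges b l) = b by rewrite vert_cons h addrC subrK.
by rewrite h hb IH.
Qed.

Lemma chain_edges0 (D : R * R -> R * R -> R) w l : last w l = - w ->
  chain D 0 (edges w l) = pchain D w l.
Proof.
move=> h; apply: chain_edges; rewrite /vert vsum_edges h.
by apply: pairP => /=; field.
Qed.

Lemma edges_sc (k : R) a l : edges (sc k a) (map (sc k) l) = map (sc k) (edges a l).
Proof.
elim: l a => //= b l IH a; rewrite IH; congr (_ :: _).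
by apply: pairP => /=; ring.
Qed.

Lemma ccw_sc (k : R) l : 0 < k -> ccw l -> ccw (map (sc k) l).
Proof.
move=> k0; rewrite /ccw pairwise_map; apply: sub_pairwise => x y /= h.
by rewrite detZl detZr !mulr_gt0.
Qed.

Lemma consecutive_impl (C C' : R * R -> R * R -> Prop) a l :
  (forall a b, C a b -> C' a b) -> consecutive C a l -> consecutive C' a l.
Proof. by move=> h; elim: l a => //= b l IH a [/h ? /IH]. Qed.

Variables (N : R * R -> R).
Hypothesis Nge0 : forall x, 0 <= N x.
Hypothesis Ntri : forall x y, N (x + y) <= N x + N y.
Hypothesis Nsc : forall (k : R) x, N (sc k x) = `|k| * N x.
Hypothesis Nstrict : forall x y, det x y != 0 -> N (x + y) < N x + N y.

(** The Pluecker relation expresses det a c times b as a combination of a and c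
    with the two other determinants as coefficients; compare norms. *)
Lemma unit_tri a b c : N a = 1 -> N b = 1 -> N c = 1 ->
  0 < det a b -> 0 < det b c -> 0 < det a c -> det a c < det a b + det b c.
Proof.
move=> Na Nb Nc ab bc ac.
have e : sc (det a c) b = sc (det b c) a + sc (det a b) c.
  by apply: pairP; rewrite /= /det; ring.
have : N (sc (det a c) b) < N (sc (det b c) a) + N (sc (det a b) c).
  by rewrite e; apply: Nstrict; rewrite detZl detZr gt_eqF// !mulr_gt0.
by rewrite !Nsc Na Nb Nc !mulr1 !gtr0_norm// addrC.
Qed.

Lemma NN x : N (- x) = N x.
Proof.
have -> : - x = sc (-1) x by apply: pairP => /=; ring.
by rewrite Nsc normrN1 mul1r.
Qed.

(** For unit vectors a, b, c, d in this order along half a turn. The linear form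
    f(x) = det a x - det b x takes the value M = det a b at a and b, the value - M
    at - a, and values less than M at the unit vectors after b; the claim says
    that it decreases from c to d. If
    0 <= f(d), then c is a combination of b and d with coefficients of sum greater
    than 1, whence f(c) > f(d); if f(c) <= f(d) < 0, then d is a combination of c
    and - a, and f(d) < f(c), a contradiction. *)
Lemma unit_quad a b c d : N a = 1 -> N b = 1 -> N c = 1 -> N d = 1 ->
  0 < det a b -> 0 < det b c -> 0 < det c d -> 0 < det a c -> 0 < det b d ->
  0 < det a d \/ d = - a -> 0 < det (b - a) (d - c).
Proof.
move=> Na Nb Nc Nd ab bc cd ac bd ad.
have t1 : det b d < det b c + det c d by exact: unit_tri.
have t2 : det b c < det a c + det a b.
  have := @unit_tri c (- a) (- b).
  rewrite !NN !detNr !detNl !opprK -!(detC a) -!(detC b) => h.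
  rewrite [det b c]detC -detNr.
  by have := h Nc Na Nb; rewrite detNr -detC; apply.
have [t3 t4] : det a d - det b d < det a b /\ det a c <= det a d + det c d.
  case: ad => [ad|->].
    split; first by have := unit_tri Na Nb Nd ab bd ad; lra.
    have := @unit_tri c d (- a); rewrite !NN !detNr -!detC => h.
    by have := h Nc Nd Na cd ad ac; lra.
  by rewrite !detNr detxx (detC b) (detC c); split; lra.
have e1 : det b d * (det a c - det b c) = det c d * det a b + det b c * (det a d - det b d).
  by rewrite /det; ring.
have e2 : det a c * (det a d - det b d) = det a d * (det a c - det b c) - det c d * det a b.
  by rewrite /det; ring.
have -> : det (b - a) (d - c) = (det a c - det b c) - (det a d - det b d).
  by rewrite /det/=; ring.
have ad0 : 0 <= det a d by case: ad => [/ltW//|->]; rewrite detNr detxx oppr0.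
move: ad0 t1 t2 t3 t4 e1 e2 {ad}; set M := det a b; set f := _ - det b c; set g := _ - det b d.
move=> ad0 t1 t2 t3 t4 e1 e2; rewrite subr_gt0 ltNge; apply/negP => fg.
have [g0|g0] := leP 0 g.
  have h1 : det c d * g < det c d * M by rewrite ltr_pM2l.
  have h2 : det b d * f <= det b d * g by rewrite ler_pM2l.
  have h3 : det b d * g <= (det b c + det c d) * g by rewrite ler_wpM2r// ltW.
  by lra.
have f0 : f < 0 by lra.
have h1 : det c d * (- f) < det c d * M by rewrite ltr_pM2l// /f; lra.
have h2 : (det a d + det c d) * f <= det a c * f by rewrite ler_wnM2r// ltW.
have h3 : det a c * f <= det a c * g by rewrite ler_pM2l.
by lra.
Qed.

Variable e : R.
Hypothesis e0 : 0 < e.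
Hypothesis Nlow : forall x, e ^+ 2 * (x.1 ^+ 2 + x.2 ^+ 2) <= N x ^+ 2.

(** A parabola from (1, 0) to (-1, 0) parametrises half of the directions, with
    determinants that factor. *)
Definition para (t : R) : R * R := (t, 1 - t ^+ 2).

Lemma det_para s t : det (para s) (para t) = (s - t) * (1 + s * t).
Proof. by rewrite /det/=; ring. Qed.

Lemma N_para t : e / 2 <= N (para t).
Proof.
have h : (e / 2) ^+ 2 <= N (para t) ^+ 2.
  apply: le_trans (Nlow _); rewrite expr_div_n ler_pM2l ?exprn_gt0//=.
  by have := sqr_ge0 (t ^+ 2 - 2^-1); nra.
by rewrite -(ler_pXn2r (n := 2))// ?nnegrE ?Nge0// divr_ge0// ltW.
Qed.

Lemma N_para_gt0 t : 0 < N (para t).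
Proof. by apply: lt_le_trans (N_para t); rewrite divr_gt0. Qed.

Definition uvec (t : R) : R * R := sc (N (para t))^-1 (para t).

Lemma N_uvec t : N (uvec t) = 1.
Proof.
have h := N_para_gt0 t.
by rewrite Nsc gtr0_norm ?invr_gt0// mulVf// gt_eqF.
Qed.

Lemma det_uvec s t : -1 <= t -> t < s -> s <= 1 -> s - t < 2 ->
  0 < det (uvec s) (uvec t).
Proof.
move=> t1 ts s1 h; rewrite detZl detZr !mulr_gt0 ?invr_gt0 ?N_para_gt0//.
rewrite det_para mulr_gt0 ?subr_gt0//.
have [t1'|t1'] := leP t (-1); last by nra.
have s1' : s < 1 by lra.
by nra.
Qed.

Lemma uvecN : uvec (-1) = - uvec 1.
Proof.
rewrite /uvec; have -> : para (-1) = - para 1 by apply: pairP => /=; ring.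
by rewrite NN; apply: pairP => /=; ring.
Qed.

(** Normalising at most doubles the distance, relative to the norm. *)
Lemma uvec_gap s t : 0 <= s - t -> -1 <= s <= 1 -> -1 <= t <= 1 ->
  N (uvec t - uvec s) <= (s - t) * (4 / e * (N (1, 0) + 2 * N (0, 1))).
Proof.
move=> st /andP[s1 s2] /andP[t1 t2].
set B := N (1, 0) + _.
have B0 : 0 <= B by rewrite addr_ge0// mulr_ge0.
have hs := N_para_gt0 s; have ht := N_para_gt0 t.
have h1 : N (para t - para s) <= (s - t) * B.
  have -> : para t - para s = sc (s - t) (sc (-1) (1, 0) + sc (s + t) (0, 1)).
    by apply: pairP => /=; ring.
  rewrite Nsc ger0_norm// ler_wpM2l//; apply: le_trans (Ntri _ _) _.
  rewrite !Nsc normrN1 mul1r lerD2l ler_wpM2r// ler_norml; lra.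
have h2 : `|N (para s) - N (para t)| <= N (para t - para s).
  rewrite ler_norml; apply/andP; split.
    have := Ntri (para t - para s) (para s); rewrite subrK; lra.
  have := Ntri (para s - para t) (para t); rewrite subrK -[N (para s - _)]NN opprB; lra.
have -> : uvec t - uvec s = sc (N (para t))^-1 (para t - para s) +
    sc ((N (para t))^-1 - (N (para s))^-1) (para s).
  by apply: pairP => /=; ring.
apply: le_trans (Ntri _ _) _; rewrite !Nsc.
have -> : (N (para t))^-1 - (N (para s))^-1 = (N (para s) - N (para t)) * ((N (para t))^-1 * (N (para s))^-1).
  by field; rewrite !gt_eqF.
rewrite normrM [`|_^-1|]gtr0_norm ?invr_gt0// [`|_^-1 * _|]gtr0_norm ?mulr_gt0 ?invr_gt0//.
rewrite -!mulrA mulVf ?gt_eqF// mulr1 mulrC -mulrDl.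
have i2 : (N (para t))^-1 <= 2 / e.
  by rewrite -[2 / e]invrK lef_pV2 ?posrE// ?invr_gt0 ?divr_gt0// invf_div; exact: N_para.
have -> : (s - t) * (4 * (e^-1 * B)) = (2 * ((s - t) * B)) * (2 / e) by field; rewrite gt_eqF.
apply: ler_pM => //; [|by rewrite invr_ge0|lra].
by rewrite addr_ge0.
Qed.

Section list.
Variable eta : R.
Hypothesis eta1 : eta < 1.

(** Consecutive parameters, which decrease from 1 to -1. *)
Definition step : rel R := fun s t => [&& -1 <= t, t < s, s <= 1 & s - t <= eta].

Lemma edges_pairwise (s : R) t0 t1 (l : seq R) : step t0 t1 -> s <= t1 -> path step s l ->
  all (fun d => 0 < det (uvec t1 - uvec t0) d) (edges (uvec s) (map uvec l)).
Proof.
elim: l s => [|t l IH] s //= st01 st1 /andP[st pl].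
apply/andP; split; last first.
  by apply: IH => //; case/and4P: st => _ h _ _; apply: le_trans st1; exact: ltW.
have /and4P[a1 a2 a3 a4] := st01; have /and4P[b1 b2 b3 b4] := st.
move: st1; rewrite le_eqVlt => /orP[/eqP se|st1].
  rewrite se in b1 b2 b3 b4 *.
  have -> : det (uvec t1 - uvec t0) (uvec t - uvec t1) =
      det (uvec t0) (uvec t1) + det (uvec t1) (uvec t) - det (uvec t0) (uvec t).
    by rewrite /det/=; ring.
  rewrite subr_gt0; apply: unit_tri; rewrite ?N_uvec//; apply: det_uvec; have := eta1; lra.
apply: unit_quad; rewrite ?N_uvec//; try (by apply: det_uvec; have := eta1; lra).
have [h|h] := ltP (t0 - t) 2; first by left; apply: det_uvec => //;have := eta1; lra.
right; have -> : t = -1 by apply/eqP; rewrite eq_le b1 andbT;have := eta1; lra.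
have -> : t0 = 1 by apply/eqP; rewrite eq_le a3 /=;have := eta1; lra.
exact: uvecN.
Qed.

Lemma edges_ccw s (l : seq R) : path step s l -> ccw (edges (uvec s) (map uvec l)).
Proof.
elim: l s => [|t l IH] s //= /andP[st pl]; rewrite IH// andbT.
exact: edges_pairwise.
Qed.

Lemma consecutive_path (C : R * R -> R * R -> Prop) s (l : seq R) :
  (forall s t, step s t -> C (uvec s) (uvec t)) -> path step s l -> consecutive C (uvec s) (map uvec l).
Proof.
by move=> h; elim: l s => [|t l IH] s //= /andP[/h st /IH].
Qed.

(** A gap below 1 prevents a single step from 1 to -1. *)
Lemma arc_path (s : R) (l : seq R) : -1 < s \/ l = [::] -> s <= 1 -> path step s l -> last s l = -1 ->
  arc (uvec 1) (uvec s) (map uvec l).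
Proof.
elim: l s => [|t l IH] s /=; first by move=> _ _ _ ->; exact: uvecN.
move=> [s1|//] s2 /andP[/and4P[h1 h2 h3 h4] pl] hl; split.
- by apply: det_uvec => //;have := eta1; lra.
- move: s2; rewrite le_eqVlt => /orP[/eqP ->|s2]; first by rewrite detxx.
  by apply/ltW/det_uvec => //; [exact: ltW|have := eta1; lra].
- move: h1; rewrite le_eqVlt => /orP[/eqP te|h1]; last first.
    by left; apply: det_uvec; have := eta1; lra.
  right; split; first by rewrite -te; exact: uvecN.
  rewrite -te in h2 h4.
  by apply: det_uvec; have := eta1; lra.
- apply: IH => //; last by have := eta1; lra.
  move: h1; rewrite le_eqVlt => /orP[/eqP te|]; last by left.
  right; case: l pl {hl} => //= t' l /andP[/and4P[k1 k2 _ _] _].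
  by move: k2; rewrite -te ltNge k1.
Qed.

End list.

(** The vertices belong to equidistant parameters of the parabola. *)
Lemma norm_polygon (delta : R) : 0 < delta -> exists w l,
  [/\ last w l = - w, N w = 1, ccw (edges w l), (2 <= size l)%N & arc w w l] /\
  consecutive (fun a b => [/\ 0 < det a b, N a = 1, N b = 1 & N (b - a) <= delta]) w l.
Proof.
move=> d0; pose B := 4 / e * (N (1, 0) + 2 * N (0, 1)) + 1.
have B0 : 0 < B.
  by rewrite ltr_wpDl// mulr_ge0// ?divr_ge0 ?addr_ge0 ?mulr_ge0// ltW.
(* gaps of at most 1 / 2 for arc_path, of at most delta / B for uvec_gap *)
pose eta := Num.min 2^-1 (delta / B).
have eta0 : 0 < eta by rewrite lt_min invr_gt0 ltr0n divr_gt0.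
have eta1 : eta < 1 by rewrite gt_min; apply/orP; left; lra.
have etag : eta * (4 / e * (N (1, 0) + 2 * N (0, 1))) <= delta.
  apply: (@le_trans _ _ (eta * B)); first by rewrite ler_pM2l// lerDl.
  by rewrite -ler_pdivlMr// ge_min lexx orbT.
have [m mE] : exists m : nat, 2 / eta < m%:R.
  by exists (Num.truncn (2 / eta)).+1; exact: truncnS_gt.
have m0 : (0 < m%:R :> R) by apply: lt_trans mE; rewrite divr_gt0.
have gapE : 2 / m%:R < eta by rewrite ltr_pdivrMr// mulrC -ltr_pdivrMr.
pose f (i : nat) : R := 1 - i%:R * (2 / m%:R).
pose l := [seq f i | i <- iota 1 m].
have fm : f m = -1 by rewrite /f mulrCA divff ?gt_eqF//; ring.
have f0 : f 0%N = 1 by rewrite /f mul0r subr0.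
have fS i : f i.+1 = f i - 2 / m%:R by rewrite /f -natr1; ring.
have fge i : (i <= m)%N -> -1 <= f i.
  move=> im; rewrite -fm lerD2l lerN2 ler_wpM2r ?divr_ge0 ?ler_nat//; exact: ltW.
have fle i : f i <= 1 by rewrite gerBl mulr_ge0// divr_ge0// ltW.
have stepf i : (i < m)%N -> step eta (f i) (f i.+1).
  move=> im; apply/and4P; split => //; first exact: fge.
    by rewrite fS gtrBl divr_gt0.
  by rewrite fS; lra.
have pl i k : (i + k <= m)%N -> path (step eta) (f i) [seq f j | j <- iota i.+1 k].
  elim: k i => //= k IH i ik; rewrite stepf /=; last by apply: leq_trans ik; rewrite addnS ltnS leq_addr.
  by apply: IH; rewrite addSnnS.
have ll i k : last (f i) [seq f j | j <- iota i.+1 k] = f (i + k)%N.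
  by elim: k i => [|k IH] i /=; rewrite ?addn0// IH addSnnS.
have p1 : path (step eta) 1 l by rewrite -f0; apply: pl.
have l1 : last 1 l = -1 by rewrite -fm -[1]f0 ll.
exists (uvec 1), (map uvec l); split; last first.
  apply: consecutive_path p1 => s t /and4P[h1 h2 h3 h4]; split.
  - by apply: det_uvec => //; lra.
  - exact: N_uvec.
  - exact: N_uvec.
  - apply: le_trans (uvec_gap _ _ _) _; try lra.
    apply: le_trans etag; rewrite ler_wpM2r// mulr_ge0// ?divr_ge0 ?addr_ge0 ?mulr_ge0//.
    exact: ltW.
split.
- by rewrite last_map l1 uvecN.
- exact: N_uvec.
- exact: edges_ccw eta1 _ _ p1.
- rewrite size_map size_map size_iota -(ltr_nat R); apply: lt_trans mE.
  by rewrite ltr_pdivlMr//; lra.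
- have h1 : -1 < (1 : R) by lra.
  by apply: (arc_path eta1 (or_introl h1) (lexx 1) p1 l1).
Qed.

End polygon_of_norm.

(** * The gauge of a symmetric convex set *)

Section gauge.
Context {R : realType}.
Implicit Types (u v w a b x y : R * R) (l : seq (R * R)).
Variable K : set (R * R).
Variables (r C : R).
Hypothesis r0 : 0 < r.
Hypothesis C0 : 0 < C.
Hypothesis Kball : forall x, `|x.1| < r -> `|x.2| < r -> K x.
Hypothesis Kbd : forall x, K x -> `|x.1| <= C /\ `|x.2| <= C.
Hypothesis Kclosed : forall x, (forall t : R, 1 < t -> K (sc t^-1 x)) -> K x.
Hypothesis Kcvx : forall (k : R) x y, 0 <= k <= 1 -> K x -> K y -> K (cmb k x y).
Hypothesis Ksym : forall x, K x -> K (- x).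

Let E x : set R := [set t | 0 < t /\ K (sc t^-1 x)].
Definition gauge x : R := inf (E x).

Let K0 : K 0. Proof. by apply: Kball; rewrite normr0. Qed.

Let E_nonempty x : E x !=set0.
Proof.
pose t := (`|x.1| + `|x.2| + 1) / r.
have t0 : 0 < t by rewrite divr_gt0// ltr_wpDl ?addr_ge0.
exists t; split => //; apply: Kball; rewrite /= normrM gtr0_norm ?invr_gt0//
  ltr_pdivrMl// /t divfK ?gt_eqF//; have := normr_ge0 x.1; have := normr_ge0 x.2; lra.
Qed.

Let E_lb x : has_lbound (E x).
Proof. by exists 0 => t [/ltW]. Qed.

Lemma gauge_ge0 x : 0 <= gauge x.
Proof. by apply: lb_le_inf; [exact: E_nonempty|move=> t [/ltW]]. Qed.

Lemma gauge_le t x : 0 < t -> K (sc t^-1 x) -> gauge x <= t.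
Proof. by move=> t0 Kt; apply: ge_inf; [exact: E_lb|split]. Qed.

Lemma K_starshaped (k : R) x : 0 <= k <= 1 -> K x -> K (sc k x).
Proof.
move=> k01 Kx; have := Kcvx k01 K0 Kx; congr K.
by apply: pairP => /=; ring.
Qed.

(** K is star-shaped around 0, so that every t above the infimum is admissible. *)
Lemma gauge_lt t x : gauge x < t -> 0 < t /\ K (sc t^-1 x).
Proof.
move=> h; have [s [s0 Ks] st] := inf_lt (E_nonempty x) h.
have t0 : 0 < t by exact: lt_trans st.
split => //; have -> : sc t^-1 x = sc (s / t) (sc s^-1 x).
  by apply: pairP => /=; field; rewrite !gt_eqF.
apply: K_starshaped => //; rewrite (divr_ge0 (ltW s0) (ltW t0))/=.
by rewrite ler_pdivrMr// mul1r ltW.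
Qed.

Lemma gauge_K x : K x -> gauge x <= 1.
Proof.
move=> Kx; apply: gauge_le => //; have -> : sc 1^-1 x = x by apply: pairP => /=; field.
by [].
Qed.

(** The infimum itself need not be tested: K is closed along rays. *)
Lemma K_gauge x : gauge x <= 1 -> K x.
Proof. by move=> g1; apply: Kclosed => t t1; apply: (gauge_lt _).2; exact: le_lt_trans t1. Qed.

Lemma gauge_tri x y : gauge (x + y) <= gauge x + gauge y.
Proof.
apply/ler_addgt0Pr => e e0.
have [s0 Ks] : 0 < gauge x + e / 2 /\ K (sc (gauge x + e / 2)^-1 x).
  by apply: gauge_lt; rewrite ltrDl divr_gt0.
have [t0 Kt] : 0 < gauge y + e / 2 /\ K (sc (gauge y + e / 2)^-1 y).
  by apply: gauge_lt; rewrite ltrDl divr_gt0.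
have -> : gauge x + gauge y + e = (gauge x + e / 2) + (gauge y + e / 2) by field.
move: (gauge x + e / 2) (gauge y + e / 2) s0 t0 Ks Kt => s t s0 t0 Ks Kt.
have st0 : 0 < s + t by exact: addr_gt0.
apply: gauge_le => //.
have k01 : 0 <= t / (s + t) <= 1.
  by rewrite (divr_ge0 (ltW t0) (ltW st0)) /= ler_pdivrMr// mul1r lerDr ltW.
have := Kcvx k01 Ks Kt; congr K; apply: pairP => /=; field; rewrite !gt_eqF//.
Qed.

Lemma gauge0 : gauge 0 = 0.
Proof.
apply/eqP; rewrite eq_le gauge_ge0 andbT; apply/ler_addgt0Pr => e e0; rewrite add0r.
apply: gauge_le => //; have -> : sc e^-1 (0 : R * R) = 0 by apply: pairP; rewrite /= mulr0.
exact: K0.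
Qed.

Let gauge_sc_le (k : R) x : k != 0 -> gauge (sc k x) <= `|k| * gauge x.
Proof.
move=> k0; have ak : 0 < `|k| by rewrite normr_gt0.
rewrite -ler_pdivrMl//; apply/ler_addgt0Pr => e e0.
have [t0 Kt] : 0 < gauge x + e /\ K (sc (gauge x + e)^-1 x).
  by apply: gauge_lt; rewrite ltrDl.
rewrite ler_pdivrMl//; move: (gauge x + e) t0 Kt => t t0 Kt.
apply: gauge_le; first exact: mulr_gt0.
have [kp|kn] := ltP 0 k.
  rewrite gtr0_norm//; move: Kt; congr K.
  by apply: pairP => /=; field; rewrite !gt_eqF.
have kn' : k < 0 by rewrite lt_neqAle k0.
rewrite ltr0_norm//; move/Ksym: Kt; congr K.
by apply: pairP => /=; field; rewrite k0 gt_eqF.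
Qed.

Lemma gauge_sc (k : R) x : gauge (sc k x) = `|k| * gauge x.
Proof.
have [->|k0] := eqVneq k 0.
  have -> : sc 0 x = 0 by apply: pairP; rewrite /= mul0r.
  by rewrite gauge0 normr0 mul0r.
apply/eqP; rewrite eq_le gauge_sc_le//=.
have ak : 0 < `|k| by rewrite normr_gt0.
have e : x = sc k^-1 (sc k x) by apply: pairP => /=; field.
rewrite {1}e -ler_pdivlMl// -normfV; apply: gauge_sc_le.
by rewrite invr_eq0.
Qed.

Definition eucl x : R := Num.sqrt (x.1 ^+ 2 + x.2 ^+ 2).

Lemma eucl_sqr x : eucl x ^+ 2 = x.1 ^+ 2 + x.2 ^+ 2.
Proof. by rewrite sqr_sqrtr// addr_ge0 ?sqr_ge0. Qed.

Lemma eucl_ge0 x : 0 <= eucl x. Proof. exact: sqrtr_ge0. Qed.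

Lemma eucl_sc (k : R) x : eucl (sc k x) = `|k| * eucl x.
Proof.
have -> : eucl (sc k x) = Num.sqrt (k ^+ 2 * (x.1 ^+ 2 + x.2 ^+ 2)).
  by congr Num.sqrt; rewrite /=; ring.
by rewrite sqrtrM ?sqr_ge0// sqrtr_sqr.
Qed.

Lemma eucl_dot x y : dotp x y ^+ 2 + det x y ^+ 2 = (eucl x * eucl y) ^+ 2.
Proof. by rewrite exprMn !eucl_sqr /dotp /det; ring. Qed.

Lemma eucl_add x y : eucl (x + y) ^+ 2 = (eucl x + eucl y) ^+ 2 + 2 * (dotp x y - eucl x * eucl y).
Proof. by rewrite sqrrD !eucl_sqr /dotp/=; ring. Qed.

Lemma eucl_tri x y : eucl (x + y) <= eucl x + eucl y.
Proof.
rewrite -(ler_pXn2r (n := 2))// ?nnegrE ?addr_ge0 ?eucl_ge0// eucl_add.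
rewrite gerDl pmulr_rle0// subr_le0; apply: le_trans (ler_norm _) _.
rewrite -(ler_pXn2r (n := 2))// ?nnegrE ?mulr_ge0 ?eucl_ge0//.
by rewrite real_normK ?num_real// -eucl_dot lerDl sqr_ge0.
Qed.

(** Lagrange's identity: the defect in the squared Cauchy-Schwarz inequality is the
    square of the determinant. *)
Lemma eucl_strict x y : det x y != 0 -> eucl (x + y) < eucl x + eucl y.
Proof.
move=> xy.
rewrite -(ltr_pXn2r (n := 2))// ?nnegrE ?addr_ge0 ?eucl_ge0// eucl_add.
rewrite gtrDl pmulr_rlt0// subr_lt0; apply: le_lt_trans (ler_norm _) _.
rewrite -(ltr_pXn2r (n := 2))// ?nnegrE ?mulr_ge0 ?eucl_ge0//.
by rewrite real_normK ?num_real// -eucl_dot ltrDl lt_neqAle eq_sym sqrf_eq0 xy sqr_ge0.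
Qed.

Lemma eucl_bd x : K x -> eucl x <= 2 * C.
Proof.
move=> /Kbd[]; rewrite !ler_norml => /andP[h1 h2] /andP[h3 h4].
have C2 : 0 <= 2 * C by rewrite mulr_ge0// ltW.
rewrite -(ler_pXn2r (n := 2))// ?nnegrE ?eucl_ge0// eucl_sqr.
have := C0; nra.
Qed.

(** The gauge plus e times the Euclidean norm is a strictly convex norm, at most
    1 + h on K. A point with coordinates s in the basis of two unit vectors a, b
    at distance at most h has norm at least (s.1 + s.2) (1 - h); hence
    s.1 + s.2 <= (1 + h) / (1 - h) on K, and h is chosen so that this is k. *)
Lemma inner_polygon (k : R) : 1 < k -> exists w l,
  [/\ last w l = - w, w != 0, ccw (edges w l), (2 <= size l)%N & arc w w l] /\
  [/\ consecutive (fun a b => 0 < det a b) w l,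
      consecutive (fun a b => forall s, simplex s -> K (lcomb a b s)) w l &
      consecutive (fun a b => forall s, 0 <= s.1 -> 0 <= s.2 -> K (lcomb a b s) -> s.1 + s.2 <= k) w l].
Proof.
move=> k1; pose h := (k - 1) / (k + 1).
have h0 : 0 < h by rewrite divr_gt0; lra.
have h1 : h < 1 by rewrite ltr_pdivrMr; lra.
pose e := h / (2 * C).
have e0 : 0 < e by rewrite divr_gt0// mulr_gt0.
pose N x := gauge x + e * eucl x.
have Nge0 x : 0 <= N x.
  by rewrite addr_ge0 ?gauge_ge0// mulr_ge0 ?eucl_ge0// ltW.
have Ntri x y : N (x + y) <= N x + N y.
  rewrite /N addrACA; apply: lerD; first exact: gauge_tri.
  by rewrite -mulrDr ler_pM2l// eucl_tri.
have Nsc (c : R) x : N (sc c x) = `|c| * N x by rewrite /N gauge_sc eucl_sc; ring.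
have Nst x y : det x y != 0 -> N (x + y) < N x + N y.
  move=> xy; rewrite /N addrACA; apply: ler_ltD; first exact: gauge_tri.
  by rewrite -mulrDr ltr_pM2l// eucl_strict.
have Nlow x : e ^+ 2 * (x.1 ^+ 2 + x.2 ^+ 2) <= N x ^+ 2.
  have ee : 0 <= e * eucl x by rewrite mulr_ge0 ?eucl_ge0// ltW.
  rewrite -eucl_sqr -exprMn ler_pXn2r// ?nnegrE//.
  by rewrite lerDr gauge_ge0.
have [w [l [[hl Nw cc sz ar] st]]] := norm_polygon Nge0 Ntri Nsc Nst e0 Nlow h0.
exists w, l; split.
  split => //; apply/eqP => w0; have := Nsc 0 w.
  have -> : sc 0 w = w by rewrite w0; apply: pairP; rewrite /= mul0r.
  by rewrite Nw normr0 mul0r => /eqP; rewrite oner_eq0.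
have lc a b (s : R * R) : lcomb a b s = sc s.1 a + sc s.2 b by apply: pairP.
split.
- by apply: consecutive_impl st => a b [].
- apply: consecutive_impl st => a b [_ Na Nb _] s [s1 s2 s12]; apply: K_gauge.
  apply: (@le_trans _ _ (N (lcomb a b s))); first by rewrite lerDl mulr_ge0 ?eucl_ge0// ltW.
  by rewrite lc; apply: le_trans (Ntri _ _) _; rewrite !Nsc Na Nb !mulr1 !ger0_norm.
- apply: consecutive_impl st => a b [_ Na Nb Nab] s s1 s2 Ks.
  have u1 : N (lcomb a b s) <= 1 + h.
    apply: lerD; first exact: gauge_K.
    have -> : h = e * (2 * C) by rewrite /e divfK// gt_eqF// mulr_gt0.
    by rewrite ler_pM2l// eucl_bd.
  have u2 : N (sc (s.1 + s.2) a) <= N (lcomb a b s) + N (sc (- s.2) (b - a)).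
    apply: le_trans (Ntri _ _); rewrite le_eqVlt; apply/orP; left; apply/eqP; congr N.
    by apply: pairP => /=; ring.
  rewrite !Nsc Na mulr1 normrN !ger0_norm ?addr_ge0// in u2.
  have u3 : s.2 * N (b - a) <= s.2 * h by rewrite ler_wpM2l.
  have u4 : (s.1 + s.2) * (1 - h) <= 1 + h.
    have : 0 <= s.1 * h by rewrite mulr_ge0// ltW.
    lra.
  have -> : k = (1 + h) / (1 - h).
    rewrite /h; field; apply/andP; split; rewrite gt_eqF//; lra.
  by rewrite ler_pdivlMr//; lra.
Qed.

End gauge.

(** * Mahler volumes of convex bodies *)

Section bounds.
Context {R : realType}.
Local Notation mR := (measurableTypeR R).
Local Notation mu2 := (@lebesgue_measure2 R).
Implicit Types (u v w a b x y : R * R) (l : seq (R * R)).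

(** From the definition of the integral as a supremum over simple functions.
    It also serves for integrands that are not known to be measurable, such as
    the one given by a general K. *)
Lemma ge0_le_integralT (f g : mR * mR -> \bar R) :
  (forall x, 0 <= f x)%E -> (forall x, f x <= g x)%E -> (\int[mu2]_x f x <= \int[mu2]_x g x)%E.
Proof.
move=> f0 fg; have g0 x : (0 <= g x)%E := le_trans (f0 x) (fg x).
rewrite !ge0_integralTE//; apply: ereal_sup_le => _ [h hf <-].
by exists h => // x; exact: le_trans (hf x) (fg x).
Qed.

Variable p : R.
Hypothesis p0 : 0 < p.
Local Notation pd := (pd p).
Local Notation pexp := (pexp p).
Local Notation pmahler := (pmahler p).

(** A 0 is the area of K. *)
Lemma Lp_MahlerE (K : set (mR * mR)) (A : R * R -> R) : measurable K ->
  (forall y, \int[mu2]_(x in K) (expR (pd x y))%:E = (A y)%:E)%E ->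
  Lp_Mahler p K = ((A 0)%:E * \int[mu2]_y (expR (- (p^-1 * ln (A y / A 0))))%:E)%E.
Proof.
move=> mK KA.
have mE : mu2 K = (A 0)%:E.
  rewrite -KA (eq_integral (cst 1%E)) ?integral_cst ?mul1e// => x _.
  by rewrite pdC pd0l expR0.
have A00 : 0 <= A 0 by rewrite -lee_fin -mE.
rewrite /Lp_Mahler mE /=; congr (_ * _)%E; apply: eq_integral => y _.
rewrite /Lp_support mE /= /Rintegral; congr (expR (- (_ * ln _)))%:E.
under eq_integral do rewrite EFinM.
rewrite ge0_integralZr//; first by rewrite KA -EFinM.
  by apply: measurable_funTS; exact: measurable_exp_pd.
by rewrite lee_fin invr_ge0.
Qed.

Lemma pexp_sc (k : R) ds : pexp (map (sc k) ds) 0 = k ^+ 2 * pexp ds 0.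
Proof.
rewrite -!parea_pexp /parea; have {1}-> : 0 = sc k 0 :> R * R by apply: pairP; rewrite /= mulr0.
elim: ds 0 => [|d ds IH] P /=; first by rewrite mulr0.
have vs : vsum (map (sc k) ds) = sc k (vsum ds).
  elim: ds {IH} => [|e ds IH] /=; first by apply: pairP; rewrite /= mulr0.
  by rewrite IH; apply: pairP => /=; ring.
have -> : sc k P + sc k d = sc k (P + d) by apply: pairP => /=; ring.
rewrite IH mulrDr; congr (_ + _); rewrite /vert /= vs /det/=; ring.
Qed.

Variables (K : set (mR * mR)) (w : R * R) (l : seq (R * R)).
Hypothesis mK : measurable K.
Hypothesis Ksym : forall x, K x -> K (- x).
Hypothesis w0 : w != 0.
Hypothesis hl : last w l = - w.

Lemma pexp_le_integral y : arc w w l ->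
  consecutive (fun a b => forall s, simplex s -> K (lcomb a b s)) w l ->
  ((pexp (edges w l) y)%:E <= \int[mu2]_(x in K) (expR (pd x y))%:E)%E.
Proof.
move=> ar st; rewrite (integral_half p mK y w0 Ksym) /pexp chain_edges0//.
exact: pchain_le.
Qed.

Lemma integral_le_pexp (k : R) y : 0 < k -> consecutive (fun a b => 0 < det a b) w l ->
  consecutive (fun a b => forall s, 0 <= s.1 -> 0 <= s.2 -> K (lcomb a b s) -> s.1 + s.2 <= k) w l ->
  (\int[mu2]_(x in K) (expR (pd x y))%:E <= (pexp (map (sc k) (edges w l)) y)%:E)%E.
Proof.
move=> k0 sd st; rewrite (integral_half p mK y w0 Ksym) /pexp -edges_sc chain_edges0; last first.
  by rewrite last_map hl; apply: pairP => /=; ring.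
exact: le_pchain.
Qed.

End bounds.

Section main.
Context {R : realType}.
Local Notation mR := (measurableTypeR R).
Local Notation mu2 := (@lebesgue_measure2 R).
Variable p : R.
Hypothesis p0 : 0 < p.

Definition sq_edges : seq (R * R) := edges (-1, -1) [:: (1, -1); (1, 1)].

(** The square is the polygon with these two edges, so both comparisons hold
    with factor 1. *)
Lemma Lp_Mahler_square : Lp_Mahler p square = pmahler p (@unit_parallelogram R).
Proof.
have mK : measurable (square : set (mR * mR)).
  by apply: measurableX; exact: measurable_itv.
have sqE (x : R * R) : square x <-> [/\ -1 <= x.1, x.1 <= 1, -1 <= x.2 & x.2 <= 1].
  rewrite /square/= !in_itv/=; split; first by case=> /andP[-> ->] /andP[-> ->].
  by case=> -> -> -> ->.
have Ks (x : R * R) : square x -> square (- x).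
  by move=> /sqE[*]; apply/sqE; split => /=; lra.
have w0 : (-1, -1) != 0 :> R * R.
  by apply/eqP => -[/eqP]; rewrite oppr_eq0 oner_eq0.
have hl : last (-1, -1) [:: (1, -1); (1, 1)] = - (-1, -1) :> R * R.
  by apply: pairP => /=; rewrite opprK.
have ar : arc (-1, -1) (-1, -1) ([:: (1, -1); (1, 1)] : seq (R * R)).
  rewrite /= /det /=; split; [lra|lra|left; lra|split; [lra|lra| |]].
    by right; split; [apply: pairP => /=; rewrite opprK|lra].
  by apply: pairP => /=; rewrite opprK.
have lo y := @pexp_le_integral R p _ _ _ mK Ks w0 hl y ar.
have up y := @integral_le_pexp R p _ _ _ mK Ks w0 hl 1 y ltr01.
have e1 : map (sc 1) (edges (-1, -1) [:: (1, -1); (1, 1)]) = sq_edges :> seq (R * R).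
  by rewrite /sq_edges /=; congr [:: _; _]; apply: pairP => /=; ring.
have A y : (\int[mu2]_(x in square) (expR (pd p x y))%:E = (pexp p sq_edges y)%:E)%E.
  apply/eqP; rewrite eq_le lo ?andbT; last first.
    rewrite /=; split; [|split => //]; move=> s [s1 s2 s12]; apply/sqE; split => /=; lra.
  rewrite -e1 up//=; rewrite /det/=; first by split; [lra|split => //; lra].
  by split; [|split => //] => s s1 s2 /sqE/= [*]; lra.
rewrite (Lp_MahlerE mK A) -parea_pexp.
rewrite -/(pmahler p sq_edges); apply: parallelogram => //.
by rewrite /det/=; lra.
Qed.

Lemma nbhs_box (A : set (R * R)) (x0 : R * R) : nbhs x0 A ->
  exists2 r : R, 0 < r & forall x : R * R, `|x.1| < r -> `|x.2| < r -> A (x0 + x).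
Proof.
move=> /nbhs_ballP[r r0 hr]; exists r => // x h1 h2; apply: hr.
by split; rewrite -ball_normE /ball_ /= opprD addNKr normrN.
Qed.

(** It suffices to lose an arbitrary factor z < 1. For k = exp(eps), the polygon
    k P has area at most k^2 |K|, so that replacing K by k P costs at most
    k^(2 (1 + 1/p)), and eps is chosen so that this is 1 / z. *)
Theorem Lp_Mahler_ge (K : set (R * R)) : convex_body K -> symmetric_set K ->
  (pmahler p (@unit_parallelogram R) <= Lp_Mahler p K)%E.
Proof.
move=> [cK vK [x0 iK]] sK.
have Ksym x : K x -> K (- x) by move=> Kx; rewrite sK; exists x.
have Kcvx (k : R) x y : 0 <= k <= 1 -> K x -> K y -> K (cmb k x y).
  move=> /andP[k0 k1] /mem_set Kx /mem_set Ky.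
  have k0' : 0 <= 1 - k by rewrite subr_ge0.
  have k1' : 1 - k <= 1 by rewrite gerBl.
  have := vK x y (Itv01 k0' k1') Kx Ky; rewrite inE; congr K.
  have e : 1 - (1 - k) = k by ring.
  apply: pairP; rewrite -[in RHS]e.
  - by change ((1 - k) * x.1 + (1 - (1 - k)) * y.1 = (1 - (1 - (1 - k))) * x.1 + (1 - (1 - k)) * y.1); ring.
  - by change ((1 - k) * x.2 + (1 - (1 - k)) * y.2 = (1 - (1 - (1 - k))) * x.2 + (1 - (1 - k)) * y.2); ring.
have clK : closed K by apply: compact_closed cK; exact: norm_hausdorff.
have mK : measurable (K : set (mR * mR)).
  rewrite -[K]setCK; apply: measurableC; apply: open2_measurable; exact: closed_openC.
have [rho rho0 hr] : exists2 rho : R, 0 < rho & forall x : R * R, `|x.1| < rho -> `|x.2| < rho -> K (x0 + x).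
  exact: nbhs_box.
have Kball (x : R * R) : `|x.1| < rho / 2 -> `|x.2| < rho / 2 -> K x.
  move=> h1 h2; have K1 : K (x0 + sc 2 x).
    apply: hr; rewrite /= normrM gtr0_norm//; lra.
  have K2 : K (- x0).
    by apply: Ksym; rewrite -[x0]addr0; apply: hr; rewrite /= normr0.
  have hf : (2 : R)^-1 <= 1 by rewrite invf_le1 ?ler1n.
  have hf0 : 0 <= (2 : R)^-1 by rewrite invr_ge0.
  by have := Kcvx _ _ _ (introT andP (conj hf0 hf)) K1 K2; congr K; apply: pairP => /=; field.
have [C C0 Kbd] : exists2 C : R, 0 < C & forall x, K x -> `|x.1| <= C /\ `|x.2| <= C.
  have [M [_ hM]] := compact_bounded cK.
  exists (`|M| + 1); first by rewrite ltr_wpDl.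
  have Mlt : M < `|M| + 1 by rewrite (le_lt_trans (ler_norm M))// ltrDl.
  move=> x Kx; have h : `|x| <= `|M| + 1 := hM _ Mlt x Kx.
  by move: h; rewrite prod_normE ge_max => /andP.
have Kclosed x : (forall t : R, 1 < t -> K (sc t^-1 x)) -> K x.
  move=> h; apply: contrapT => nK.
  have [e e0 he] := nbhs_box (open_nbhs_nbhs (conj (closed_openC clK) nK)).
  pose M := `|x.1| + `|x.2| + 1.
  have M0 : 0 < M by rewrite ltr_wpDl ?addr_ge0.
  pose t := 1 + e / M.
  have eM : 0 < e / M by rewrite divr_gt0.
  have t1 : 1 < t by rewrite ltrDl.
  have t0 : 0 < t by exact: lt_trans t1.
  have sm (z : R) : `|z| < M -> `|(t^-1 - 1) * z| < e.
    move=> zM; rewrite normrM distrC [`|1 - _|]ger0_norm; last first.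
      by rewrite subr_ge0 invf_le1// ltW.
    have eMt : e / M = t - 1 by rewrite /t [1 + _]addrC addrK.
    have -> : 1 - t^-1 = (e / M) / t by rewrite eMt mulrBl divff ?gt_eqF// mul1r.
    apply: (@le_lt_trans _ _ (e / M * `|z|)).
      by rewrite ler_wpM2r// ler_pdivrMr// ler_pMr// ltW.
    by rewrite mulrAC ltr_pdivrMr// ltr_pM2l.
  apply: (he (sc (t^-1 - 1) x)) => /=.
  - by apply: sm; rewrite /M; have := normr_ge0 x.2; lra.
  - by apply: sm; rewrite /M; have := normr_ge0 x.1; lra.
  - by have := h t t1; congr K; apply: pairP => /=; ring.
have c0 : (0 <= pmahler p (@unit_parallelogram R))%E.
  apply: mule_ge0; last by apply: integral_ge0 => y _; rewrite lee_fin expR_ge0.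
  by rewrite lee_fin ltW// (parea_gt0 p)//= /det/=; rewrite !andbT; lra.
apply/(lee_mul01Pr _ c0) => z /andP[z0 z1].
have q0 : 0 < p^-1 by rewrite invr_gt0.
pose eps := - ln z / (2 * (1 + p^-1)).
have lz : ln z < 0 by rewrite ln_lt0// z0.
have eps0 : 0 < eps by rewrite divr_gt0 ?oppr_gt0// mulr_gt0// addr_gt0.
have k1 : 1 < expR eps by rewrite expR_gt1.
have k0 := expR_gt0 eps.
have rho2 : 0 < rho / 2 by rewrite divr_gt0.
have [w [l [[hl w0 cc sz ar] [sd sK1 sK2]]]] :=
  inner_polygon rho2 C0 Kball Kbd Kclosed Kcvx Ksym k1.
have lo y := @pexp_le_integral R p _ _ _ mK Ksym w0 hl y ar sK1.
have up y := @integral_le_pexp R p _ _ _ mK Ksym w0 hl _ y k0 sd sK2.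
set ds := edges w l in lo up cc.
set ds' := map (sc (expR eps)) ds in up.
have [A KA] : exists A : R * R -> R,
    forall y, (\int[mu2]_(x in K) (expR (pd p x y))%:E = (A y)%:E)%E.
  exists (fun y => fine (\int[mu2]_(x in K) (expR (pd p x y))%:E)%E) => y.
  rewrite fineK// ge0_fin_numE; first exact: le_lt_trans (up y) (ltry _).
  by apply: integral_ge0 => x _; rewrite lee_fin expR_ge0.
have {}lo y : pexp p ds y <= A y by rewrite -lee_fin -KA.
have {}up y : A y <= pexp p ds' y by rewrite -lee_fin -KA.
rewrite (Lp_MahlerE mK KA).
have ad : 0 < parea ds.
  by move: cc sz; rewrite -(size_edges w l) -/ds; case: (ds) => [|d [|e dd]]// cc _; exact: (parea_gt0 p).
have m0 : 0 < A 0 by apply: lt_le_trans (lo 0); rewrite -parea_pexp.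
have [n szn] : exists n, size ds' = n.+2.
  rewrite size_map size_edges; exists (size l).-2.
  by case: (l) sz => [|? []].
have a'E : parea ds' = expR eps ^+ 2 * parea ds by rewrite !(parea_pexp p) pexp_sc.
have a0 : 0 < parea ds' by rewrite a'E mulr_gt0// exprn_gt0.
have am : parea ds <= A 0 by rewrite (parea_pexp p).
have ln_a : ln (parea ds') <= eps *+ 2 + ln (A 0).
  rewrite a'E lnM ?posrE ?exprn_gt0// lnXn// expRK lerD2l.
  by rewrite ler_ln ?posrE.
have h := pmahler_min p0 szn (ccw_sc k0 cc).
have z0' : (0 <= z%:E)%E by rewrite lee_fin ltW.
apply: (@le_trans _ _ (z%:E * pmahler p ds')%E); first exact: lee_wpmul2l z0' _ _ h.
rewrite /pmahler muleA.
set I := (\int[mu2]_y _)%E; pose c := expR (p^-1 * (ln (A 0) - ln (parea ds'))).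
have I0 : (0 <= I)%E by apply: integral_ge0 => y _; rewrite lee_fin expR_ge0.
have Apos y : 0 < A y.
  apply: lt_le_trans (lo y); move: cc sz; rewrite -(size_edges w l) -/ds.
  by case: (ds) => [|d [|d' dd]]// cc _; exact: pexp_gt0.
have step1 : (c%:E * I <= \int[mu2]_y (expR (- (p^-1 * ln (A y / A 0))))%:E)%E.
  have mP : measurable_fun setT (fun y : mR * mR => (expR (- (p^-1 * ln (pexp p ds' y / parea ds'))))%:E).
    exact: (measurable_exp_ln _ _ (measurable_chain p 0 ds')).
  rewrite -(ge0_integralZl mu2 measurableT mP); last 2 first.
  - by move=> y _; rewrite lee_fin expR_ge0.
  - by rewrite lee_fin expR_ge0.
  apply: ge0_le_integralT => y; first by rewrite mule_ge0// lee_fin expR_ge0.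
  rewrite -EFinM lee_fin -expRD ler_expR.
  have Py : 0 < pexp p ds' y := lt_le_trans (Apos y) (up y).
  rewrite !lnM ?posrE ?invr_gt0// !lnV ?posrE//.
  have : p^-1 * ln (A y) <= p^-1 * ln (pexp p ds' y) by rewrite ler_pM2l// ler_ln ?posrE.
  lra.
have A0 : (0 <= (A 0)%:E)%E by rewrite lee_fin ltW.
apply: (@le_trans _ _ ((A 0)%:E * (c%:E * I))%E); last exact: lee_wpmul2l A0 _ _ step1.
rewrite muleA.
apply: lee_wpmul2r => //; rewrite -!EFinM lee_fin.
rewrite -[z]lnK ?posrE// -[X in _ * X]lnK ?posrE// -[A 0 in X in _ <= X]lnK ?posrE// -!expRD ler_expR.
have ez : ln z = - (eps * (2 * (1 + p^-1))).
  by rewrite /eps divfK ?opprK// gt_eqF// mulr_gt0// addr_gt0.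
have : (1 + p^-1) * ln (parea ds') <= (1 + p^-1) * (eps *+ 2 + ln (A 0)).
  by rewrite ler_pM2l// addr_gt0.
rewrite ez; lra.
Qed.

End main.

Theorem theorem1p9 (R : realType) (p : R) (hp : 0 < p) (K : set (R * R))
    (hK : convex_body K) (hsym : symmetric_set K) :
  (Lp_Mahler p square <= Lp_Mahler p K)%E.
Proof. by rewrite (Lp_Mahler_square hp); exact: Lp_Mahler_ge. Qed.
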